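(* Let $n=2$, $c>0$, $d>0$, and $E=\{(x_1,x_2)\in\mathbb{R}^2:|x_i|\le d,\ i=1,2\}$. Let $u$ be the maximal viscosity solution of $$u_t-\left(\operatorname{div}\left(\frac{Du}{|Du|}\right)+1\right)|Du|=c\,\mathbf{1}_E\ \text{ in }\mathbb{R}^2\times(0,\infty),\qquad u(\cdot,0)=0\ \text{ on }\mathbb{R}^2 .$$ Then the following hold. (i) If $d<1/\sqrt2$, then $u$ is bounded on $\mathbb{R}^2\times[0,\infty)$. In particular, $\lim_{t\to\infty}u(x,t)/t=0$ uniformly for $x\in\mathbb{R}^2$. (ii) If $d>1$, then $\lim_{t\to\infty}u(x,t)/t=c$ locally uniformly for $x\in\mathbb{R}^2$. (iii) If $d=1$, then $\lim_{t\to\infty}u(x,t)/t=c$ uniformly for $x\in\overline{B}(0,1)$. (iv) If $1/\sqrt2<d<1$, then there exist $\alpha,\beta$ with $0<\alpha<\beta<c$ such that $$\alpha\le\liminf_{t\to\infty}\frac{u(x,t)}{t}\le\limsup_{t\to\infty}\frac{u(x,t)}{t}\le\beta\quad\text{locally uniformly for }x\in\mathbb{R}^2 .$$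
   Context: $B(x,R)$ is the open ball of radius $R$ centered at $x$, $\overline{B}(x,R)$ its closure, $\mathbf{1}_E$ the indicator function of $E$. ''Locally uniformly'' in (iv) means: for every compact $K\subset\mathbb{R}^2$, $\liminf_{t\to\infty}\inf_{x\in K}u(x,t)/t\ge\alpha$ and $\limsup_{t\to\infty}\sup_{x\in K}u(x,t)/t\le\beta$ (with $\alpha,\beta$ independent of $K$). Viscosity solutions (here with $n=2$). Let $\mathbb{S}^n$ be the real symmetric $n\times n$ matrices. For $p\in\mathbb{R}^n\setminus\{0\}$, $X\in\mathbb{S}^n$ put $\sigma(p)=I-(p\otimes p)/|p|^2$ and $H(p,X)=-\operatorname{tr}[\sigma(p)X]-|p|$; $H_*$, $H^*$ denote the lower and upper semicontinuous envelopes of $H$ on $\mathbb{R}^n\times\mathbb{S}^n$. In general $h^*$, $h_*$ denote the upper and lower semicontinuous envelopes of a locally bounded function $h$. For a locally bounded right-hand side $f:\mathbb{R}^n\to\mathbb{R}$ and continuous initial datum $u_0$, a locally bounded $u:\mathbb{R}^n\times[0,\infty)\to\mathbb{R}$ is a viscosity subsolution of $u_t-(\operatorname{div}(Du/|Du|)+1)|Du|=f(x)$, $u(\cdot,0)=u_0$, if $u^*(\cdot,0)\le u_0$ and $\tau+H_*(p,X)\le f^*(x_0)$ for all $(x_0,t_0)\in\mathbb{R}^n\times(0,\infty)$ and $(p,X,\tau)\in J^+u^*(x_0,t_0)$; it is a viscosity supersolution if $u_*(\cdot,0)\ge u_0$ and $\tau+H^*(p,X)\ge f_*(x_0)$ for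 all $(x_0,t_0)\in\mathbb{R}^n\times(0,\infty)$ and $(p,X,\tau)\in J^-u_*(x_0,t_0)$; it is a viscosity solution if it is both. Here $J^\pm$ are the parabolic super/sub semijets: $(p,X,\tau)\in J^+v(x_0,t_0)$ iff $v(x,t)\le v(x_0,t_0)+\tau(t-t_0)+p\cdot(x-x_0)+\frac12X(x-x_0)\cdot(x-x_0)+o(|t-t_0|+|x-x_0|^2)$ as $(x,t)\to(x_0,t_0)$, and $J^-v=-J^+(-v)$. A function $u$ is called compactly supported in space if for every $T>0$ there is $R_T>0$ with $u(x,t)=0$ for $x\notin B(0,R_T)$, $t\in[0,T]$. The maximal viscosity solution is the viscosity solution $u$, compactly supported in space, such that $u\ge v$ on $\mathbb{R}^n\times[0,\infty)$ for every viscosity solution $v$ compactly supported in space. *)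

(* Defs.v *)
From HB Require Import structures.
From mathcomp Require Import all_boot all_order all_algebra.
From mathcomp Require Import all_classical all_reals all_analysis.

Set Implicit Arguments.
Unset Strict Implicit.
Unset Printing Implicit Defensive.

Import Order.TTheory GRing.Theory Num.Theory.
Import numFieldNormedType.Exports.

Local Open Scope classical_set_scope.
Local Open Scope ring_scope.

(* Points of R^n are row vectors.  The canonical norm of 'rV[R]_n is the sup
   norm, so the Euclidean structure is introduced separately (it induces the
   same topology). *)
Section euclidean.
Variables (R : realType) (n : nat).
Implicit Types (x y : 'rV[R]_n).

Definition dotp x y : R := \sum_(i < n) x 0 i * y 0 i.

Definition enorm x : R := Num.sqrt (dotp x x).

Definition eball x (r : R) : set 'rV[R]_n := [set y | enorm (y - x) < r].

End euclidean.

(* Semicontinuous envelopes of h : D -> R, relative to D, at a point z of the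
   closure of D.  The neighbourhoods of z in D are not punctured.  They are
   meant for h locally bounded on D near z, where the limits are finite. *)
Section envelopes.
Variables (R : realType) (T : topologicalType).
Implicit Types (D : set T) (h : T -> R) (z : T).

Definition usc_env D h z : R := fine (limf_esup (EFin \o h) (within D (nbhs z))).

Definition lsc_env D h z : R := fine (limf_einf (EFin \o h) (within D (nbhs z))).

Definition locally_bounded_on D h : Prop :=
  forall z, D z -> bounded_near (h : T -> R^o) (within D (nbhs z)).

End envelopes.

Section hamiltonian.
Variables (R : realType) (n : nat).
Implicit Types (p : 'rV[R]_n) (X : 'M[R]_n).

(* p^T *m p is the tensor product p (x) p *)
Definition sigma p : 'M[R]_n := 1%:M - (enorm p ^+ 2)^-1 *: (p^T *m p).

Definition Ham (q : 'rV[R]_n * 'M[R]_n) : R :=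
  - \tr (sigma q.1 *m q.2) - enorm q.1.

Definition Ham_dom : set ('rV[R]_n * 'M[R]_n) :=
  [set q | q.1 != 0 /\ q.2^T = q.2].

Definition Ham_lower p X : R := lsc_env Ham_dom Ham (p, X).

Definition Ham_upper p X : R := usc_env Ham_dom Ham (p, X).

End hamiltonian.

Section viscosity.
Variables (R : realType) (n : nat).
Implicit Types (u v : 'rV[R]_n * R -> R) (f g : 'rV[R]_n -> R).
Implicit Types (z : 'rV[R]_n * R) (p : 'rV[R]_n) (X : 'M[R]_n) (tau : R).

(* Functions on R^n x [0, +oo[ are represented by total functions whose values
   at negative times are never used. *)
Definition spacetime : set ('rV[R]_n * R) := [set z | 0 <= z.2].

(* (p, X, tau) \in J^+ v z; dotp (y *m X) y is X y . y, as X is symmetric *)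
Definition superjet v z p X tau : Prop :=
  X^T = X /\
  forall e : R, 0 < e ->
    \forall w \near within spacetime (nbhs z),
      v w <= v z + tau * (w.2 - z.2) + dotp p (w.1 - z.1)
             + 2^-1 * dotp ((w.1 - z.1) *m X) (w.1 - z.1)
             + e * (`|w.2 - z.2| + enorm (w.1 - z.1) ^+ 2).

(* (p, X, tau) \in J^- v z, i.e. J^- v = - J^+ (- v) *)
Definition subjet v z p X tau : Prop :=
  superjet (fun w => - v w) z (- p) (- X) (- tau).

(* u_t - (div (Du / |Du|) + 1) |Du| = f in R^n x ]0, +oo[, u(., 0) = g *)
Definition visc_subsol f g u : Prop :=
  [/\ locally_bounded_on spacetime u,
      forall x, usc_env spacetime u (x, 0) <= g x
    & forall x0 t0, 0 < t0 -> forall p X tau,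
        superjet (usc_env spacetime u) (x0, t0) p X tau ->
        tau + Ham_lower p X <= usc_env setT f x0].

Definition visc_supersol f g u : Prop :=
  [/\ locally_bounded_on spacetime u,
      forall x, lsc_env spacetime u (x, 0) >= g x
    & forall x0 t0, 0 < t0 -> forall p X tau,
        subjet (lsc_env spacetime u) (x0, t0) p X tau ->
        tau + Ham_upper p X >= lsc_env setT f x0].

Definition visc_sol f g u : Prop :=
  visc_subsol f g u /\ visc_supersol f g u.

Definition compactly_supported_in_space u : Prop :=
  forall T : R, 0 < T -> exists2 r : R, 0 < r &
    forall x t, ~ eball 0 r x -> 0 <= t <= T -> u (x, t) = 0.

Definition maximal_visc_sol f g u : Prop :=
  [/\ visc_sol f g u,
      compactly_supported_in_space u
    & forall v, visc_sol f g v -> compactly_supported_in_space v ->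
        forall x t, 0 <= t -> v (x, t) <= u (x, t)].

End viscosity.
Arguments spacetime : clear implicits.

Definition square (R : realType) (d : R) : set 'rV[R]_2 :=
  [set x | forall i, `|x 0 i| <= d].

(* Main.v *)
Require Import Defs.
From HB Require Import structures.
From mathcomp Require Import all_boot all_order all_algebra.
From mathcomp Require Import all_classical all_reals all_analysis.
From mathcomp Require Import ring lra.
Set Implicit Arguments.
Unset Strict Implicit.
Unset Printing Implicit Defensive.
Import Order.TTheory GRing.Theory Num.Theory.
Import numFieldNormedType.Exports.
Local Open Scope classical_set_scope.
Local Open Scope ring_scope.

(** The superlevel sets of a solution move with normal velocity one minus their
    curvature, while the source lifts the graph at rate [c] over the square; a
    circle of radius one is stationary, smaller ones shrink and larger ones
    expand.  Everything is decided by how the square compares with such arcs.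

    All bounds on [u] except one are obtained by comparing an envelope of [u]
    with an explicit function [psi].  As [u] vanishes initially and far away,
    an envelope that exceeds [psi] somewhere touches a vertical translate of
    [psi] from below at a positive time, up to a penalty in time that only
    helps ([touching]); the jets of [psi] at the contact point are then jets
    of the envelope.  So it suffices that the equation holds for [psi] with a
    strict inequality at one jet of each point ([subsol_le], [supersol_ge]);
    in particular [psi] may have jumps in its second derivatives.

    - If [d < 1 / sqrt 2], the square lies in a disc of radius less than one,
      and a multiple of [(b^2 - |x|^2)_+^3] is a stationary barrier: its level
      circles tend to shrink, and this balances the source
      ([subsol_le_barrier]).
    - If [d > 1], a flat radial paraboloid growing at rate [c - e] is a
      subsolution: circles of radius at most one lie in the square, where the
      source pays for the small loss, and larger ones expand
      ([supersol_ge_radial]).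
    - If [1 / sqrt 2 < d < 1], a sum of two one-dimensional profiles, made of
      arcs of radius larger than one that reach slope one inside the square,
      grows at a positive rate ([supersol_ge_separable]); and a family of
      fronts that are translates of one arc of radius less than one, wide
      enough to cross the square, is slowed down there, which keeps the growth
      rate below [c] ([subsol_le_sliding]).
    - If [d = 1], the unit disc touches the boundary of the square, no strict
      test function is at hand, and maximality is used: the function equal to
      [c t] on the closed unit disc and to 0 elsewhere is a subsolution,
      because the unit circle is stationary ([disc_subsol]); by Perron's
      method the supremum of all nonnegative compactly supported subsolutions
      is a solution ([supfam_subsol], [supfam_supersol]), hence lies below
      [u]. *)

(** * Euclidean plane and semicontinuous envelopes *)

Section plane.
Variable R : realType.
Local Notation V := 'rV[R]_2.
Implicit Types (x y : V).

Lemma dotp2 x y : dotp x y = x 0 0 * y 0 0 + x 0 1 * y 0 1.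
Proof.
rewrite /dotp !big_ord_recl big_ord0 addr0; congr (_ * _ + _ * _).
  by congr (x _ _); apply: val_inj.
by congr (y _ _); apply: val_inj.
Qed.

Lemma enorm_sqr x : enorm x ^+ 2 = x 0 0 ^+ 2 + x 0 1 ^+ 2.
Proof. by rewrite /enorm sqr_sqrtr dotp2 -?expr2// addr_ge0 ?sqr_ge0. Qed.

Lemma enorm_ge0 x : 0 <= enorm x.
Proof. exact: sqrtr_ge0. Qed.

Lemma abs_le_of_sqr (a b : R) : 0 <= b -> a ^+ 2 <= b ^+ 2 -> `|a| <= b.
Proof.
move=> b0 ab; have := @ler_sqr R (`|a|) b; rewrite !nnegrE normr_ge0 b0 => /(_ erefl erefl) <-.
by rewrite real_normK ?num_real.
Qed.

Lemma le_of_sqr (a b : R) : 0 <= b -> a ^+ 2 <= b ^+ 2 -> a <= b.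
Proof. by move=> b0 ab; apply: le_trans (ler_norm a) _; exact: abs_le_of_sqr. Qed.

Lemma coord_le_enorm x (i : 'I_2) : `|x 0 i| <= enorm x.
Proof.
apply: abs_le_of_sqr; first exact: enorm_ge0.
rewrite enorm_sqr; case: i => -[|[|//]] ip.
  have -> : Ordinal ip = 0 by apply: val_inj.
  by rewrite lerDl sqr_ge0.
have -> : Ordinal ip = 1 by apply: val_inj.
by rewrite lerDr sqr_ge0.
Qed.

Lemma enorm_le_coord x : enorm x <= `|x 0 0| + `|x 0 1|.
Proof.
apply: le_of_sqr; first by rewrite addr_ge0.
rewrite enorm_sqr -(real_normK (num_real (x 0 0))) -(real_normK (num_real (x 0 1))).
have := normr_ge0 (x 0 0); have := normr_ge0 (x 0 1); nra.
Qed.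

Lemma dotp_le_enorm x y : dotp x y <= enorm x * enorm y.
Proof.
apply: le_of_sqr; first by rewrite mulr_ge0 ?enorm_ge0.
rewrite exprMn !enorm_sqr dotp2.
have := sqr_ge0 (x 0 0 * y 0 1 - x 0 1 * y 0 0); nra.
Qed.

Lemma enormN x : enorm (- x) = enorm x.
Proof. by rewrite /enorm !dotp2 !mxE; congr Num.sqrt; ring. Qed.

Lemma enorm0 : enorm (0 : V) = 0.
Proof. by rewrite /enorm dotp2 !mxE !mul0r addr0 sqrtr0. Qed.

Lemma enormD x y : enorm (x + y) <= enorm x + enorm y.
Proof.
apply: le_of_sqr; first by rewrite addr_ge0 ?enorm_ge0.
have := dotp_le_enorm x y; rewrite sqrrD !enorm_sqr dotp2 !mxE; nra.
Qed.

Lemma enorm_eq0 x : (enorm x == 0) = (x == 0).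
Proof.
apply/eqP/eqP => [x0|->]; last exact: enorm0.
apply/rowP => i; rewrite !mxE; apply/eqP; rewrite -normr_le0.
by rewrite -x0 coord_le_enorm.
Qed.

Lemma dotpN_ge0 x : 0 <= dotp x (- x) -> x = 0.
Proof.
rewrite dotp2 !mxE => h; apply/eqP; rewrite -enorm_eq0 -(@eqrXn2 _ 2%N) ?enorm_ge0//.
by rewrite expr0n/= eq_le exprn_ge0 ?enorm_ge0// andbT enorm_sqr; nra.
Qed.

Lemma rV2P x y : x 0 0 = y 0 0 -> x 0 1 = y 0 1 -> x = y.
Proof.
move=> e0 e1; apply/rowP => -[[|[|//]] ip].
  by rewrite (_ : Ordinal ip = 0)//; apply: val_inj.
by rewrite (_ : Ordinal ip = 1)//; apply: val_inj.
Qed.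

Definition vec2 (a b : R) : V := \row_i (if i == 0 then a else b).

Lemma vec2E a b : (vec2 a b 0 0 = a) * (vec2 a b 0 1 = b).
Proof. by rewrite !mxE. Qed.

Lemma ball_enormP x (P : V -> Prop) :
  (\forall y \near x, P y) <->
  exists2 r, 0 < r & forall y, enorm (y - x) < r -> P y.
Proof.
split=> [/nbhs_ballP[r /= r0 rP]|[r r0 rP]].
  exists r => // y yx; apply: rP; split=> // i j; rewrite ord1 /ball/=.
  rewrite distrC; apply: le_lt_trans yx.
  by have := coord_le_enorm (y - x) j; rewrite !mxE.
apply/nbhs_ballP; exists (r / 2); first by rewrite /= divr_gt0.
move=> y [_ yx]; apply: rP; apply: le_lt_trans (enorm_le_coord _) _.
rewrite [r]splitr; apply: ltrD; rewrite !mxE distrC; exact: yx.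
Qed.

Lemma near_spacetimeP (z : V * R) (P : V * R -> Prop) :
  (\forall w \near within (spacetime R 2) (nbhs z), P w) <->
  exists2 r, 0 < r & forall w, 0 <= w.2 ->
    enorm (w.1 - z.1) < r -> `|w.2 - z.2| < r -> P w.
Proof.
split=> [[[A B] /= [zA zB] ABP]|[r r0 rP]].
  have /ball_enormP[r1 r10 Ar] := zA.
  move/nbhs_ballP : zB => [r2 /= r20 Br].
  exists (Num.min r1 r2); first by rewrite lt_min r10.
  move=> w w0; rewrite !lt_min => /andP[wr1 _] /andP[_ wr2].
  apply: (ABP w) => //; split; first exact: Ar.
  by apply: Br; rewrite /ball/= distrC.
exists ([set y | enorm (y - z.1) < r], [set s | `|s - z.2| < r]) => /=.
  split; first by apply/ball_enormP; exists r.
  by apply/nbhs_ballP; exists r => // s; rewrite /ball/= distrC.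
by move=> w [] /= wr1 wr2 w0; exact: rP.
Qed.

Lemma near_setTP x (P : V -> Prop) :
  (\forall y \near within setT (nbhs x), P y) <->
  exists2 r, 0 < r & forall y, enorm (y - x) < r -> P y.
Proof.
rewrite -ball_enormP; split; apply: (@filterS _ (nbhs x) _) => y //=.
by move=> /(_ I).
Qed.

End plane.

Section envelopes.
Variables (R : realType) (T : topologicalType).
Implicit Types (D : set T) (h : T -> R) (z : T).

(** Boundedness along the filter keeps the limit away from both infinities, so
    that [fine] loses nothing. *)
Lemma fine_limf_esupP h (F : set_system T) : ProperFilter F ->
  bounded_near (h : T -> R^o) F ->
  limf_esup (EFin \o h) F = (fine (limf_esup (EFin \o h) F))%:E.
Proof.
move=> FF /ex_bound; case=> M FM.
rewrite fineK// fin_numE; apply/andP; split.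
  rewrite -ltNye; apply: (@lt_le_trans _ _ (- M - 1)%:E); first exact: ltNyr.
  apply: le_ereal_inf_tmp => _ [A FA <-].
  have /filter_ex[x [Ax /= hx]] : \forall x \near F, A x /\ `|h x| <= M.
    by apply: filterI.
  apply: le_ereal_sup_tmp; exists (h x)%:E; first by exists x.
  by rewrite lee_fin; move: hx; rewrite ler_norml => /andP[]; lra.
rewrite -ltey; apply: (@le_lt_trans _ _ M%:E); last exact: ltry.
apply: ge_ereal_inf; exists (ereal_sup [set (EFin \o h) x | x in [set x | `|h x| <= M]]).
  by exists [set x | `|h x| <= M].
apply: ge_ereal_sup => _ [x /= hx <-]; rewrite lee_fin.
by apply: le_trans hx; exact: ler_norm.
Qed.

Lemma fine_limf_esup_lt h (F : set_system T) a : ProperFilter F ->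
  bounded_near (h : T -> R^o) F ->
  fine (limf_esup (EFin \o h) F) < a -> \forall x \near F, h x < a.
Proof.
move=> FF bh; rewrite -lte_fin -fine_limf_esupP//.
move=> /ereal_inf_lt[_ [A FA <-] Aa]; apply: filterS FA => x Ax.
rewrite -lte_fin; apply: le_lt_trans Aa.
by apply: ereal_sup_ubound; exists x.
Qed.

Lemma fine_limf_esup_le h (F : set_system T) a : ProperFilter F ->
  bounded_near (h : T -> R^o) F ->
  (\forall x \near F, h x <= a) -> fine (limf_esup (EFin \o h) F) <= a.
Proof.
move=> FF bh ha; rewrite -lee_fin -fine_limf_esupP//.
apply: ge_ereal_inf; exists (ereal_sup [set (EFin \o h) x | x in [set x | h x <= a]]).
  by exists [set x | h x <= a].
by apply: ge_ereal_sup => _ [x /= hx <-]; rewrite lee_fin.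
Qed.

Lemma lsc_envE D h z : lsc_env D h z = - usc_env D (fun w => - h w) z.
Proof. by rewrite /lsc_env /usc_env /limf_einf fineN. Qed.

Lemma bounded_nearN h (F : set_system T) : Filter F ->
  bounded_near (h : T -> R^o) F -> bounded_near ((fun w => - h w) : T -> R^o) F.
Proof.
by move=> FF; rewrite /bounded_near; apply: filterS => M; apply: filterS => x; rewrite /= normrN.
Qed.

End envelopes.

Section spacetime_envelopes.
Variable R : realType.
Local Notation V := 'rV[R]_2.
Local Notation Q := (spacetime R 2).
Implicit Types (u : V * R -> R) (f : V -> R) (x : V) (z w : V * R).

Lemma spacetime_proper z : 0 <= z.2 -> ProperFilter (within Q (nbhs z)).
Proof.
move=> z0; apply: Build_ProperFilter_ex => P /near_spacetimeP[r r0 rP].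
by exists z; apply: rP; rewrite ?subrr ?normr0 ?enorm0.
Qed.

Lemma nbhs_setT_proper x : ProperFilter (within setT (nbhs x)).
Proof.
apply: Build_ProperFilter_ex => P /near_setTP[r r0 rP].
by exists x; apply: rP; rewrite subrr enorm0.
Qed.

Lemma usc_le u z a : locally_bounded_on Q u -> 0 <= z.2 ->
  (exists2 r, 0 < r & forall w, 0 <= w.2 -> enorm (w.1 - z.1) < r ->
    `|w.2 - z.2| < r -> u w <= a) -> usc_env Q u z <= a.
Proof.
move=> bu z0 ua; apply: fine_limf_esup_le; first exact: spacetime_proper.
  exact: bu.
by apply/near_spacetimeP.
Qed.

Lemma usc_lt0 u z a : locally_bounded_on Q u -> 0 <= z.2 -> usc_env Q u z < a ->
  exists2 r, 0 < r & forall w, 0 <= w.2 -> enorm (w.1 - z.1) < r ->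
    `|w.2 - z.2| < r -> u w < a.
Proof.
move=> bu z0 ua; have := @fine_limf_esup_lt R _ u (within Q (nbhs z)) a.
move=> /(_ (spacetime_proper z0) (bu _ z0) ua).
by move/near_spacetimeP.
Qed.

Lemma usc_ge u z : locally_bounded_on Q u -> 0 <= z.2 -> u z <= usc_env Q u z.
Proof.
move=> bu z0; rewrite leNgt; apply/negP => /(usc_lt0 bu z0)[r r0 /(_ z z0)].
by rewrite !subrr normr0 enorm0 ltxx => /(_ r0 r0).
Qed.

Lemma usc_lt u z a : locally_bounded_on Q u -> 0 <= z.2 -> usc_env Q u z < a ->
  exists2 r, 0 < r & forall w, 0 <= w.2 -> enorm (w.1 - z.1) < r ->
    `|w.2 - z.2| < r -> usc_env Q u w < a.
Proof.
move=> bu z0 ua; pose b := (usc_env Q u z + a) / 2.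
have [r r0 ru] : exists2 r, 0 < r & forall w, 0 <= w.2 -> enorm (w.1 - z.1) < r ->
    `|w.2 - z.2| < r -> u w < b.
  by apply: usc_lt0 => //; rewrite /b; lra.
exists (r / 2); first lra.
move=> w w0 wr1 wr2; apply: (@le_lt_trans _ _ b); last by rewrite /b; lra.
apply: usc_le => //; exists (r / 2); first lra.
move=> w' w'0 wr1' wr2'; apply/ltW/ru => //.
  rewrite -(subrK w.1 w'.1) -addrA; apply: le_lt_trans (enormD _ _) _; lra.
by rewrite -(subrK w.2 w'.2) -addrA; apply: le_lt_trans (ler_normD _ _) _; lra.
Qed.

Lemma usc_mono u v z : locally_bounded_on Q u -> locally_bounded_on Q v ->
  0 <= z.2 ->
  (exists2 r, 0 < r & forall w, 0 <= w.2 -> enorm (w.1 - z.1) < r ->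
    `|w.2 - z.2| < r -> u w <= v w) -> usc_env Q u z <= usc_env Q v z.
Proof.
move=> bu bv z0 [r r0 uv]; apply/ler_addgt0Pr => e e0.
have [r1 r10 rv] : exists2 r, 0 < r & forall w, 0 <= w.2 -> enorm (w.1 - z.1) < r ->
    `|w.2 - z.2| < r -> v w < usc_env Q v z + e by apply: usc_lt0 => //; lra.
apply: usc_le => //; exists (Num.min r r1); first by rewrite lt_min r0.
move=> w w0; rewrite !lt_min => /andP[wr1 wr2] /andP[wr3 wr4].
by apply: le_trans (uv w w0 wr1 wr3) _; apply/ltW/rv.
Qed.

Lemma locally_boundedP u : locally_bounded_on Q u <->
  forall z, 0 <= z.2 -> exists M, exists2 r, 0 < r &
    forall w, 0 <= w.2 -> enorm (w.1 - z.1) < r -> `|w.2 - z.2| < r -> `|u w| <= M.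
Proof.
split=> bu z z0.
  have FF := spacetime_proper z0.
  by have /ex_bound[M /near_spacetimeP uM] := bu z z0; exists M.
have FF := spacetime_proper z0.
by apply/ex_bound; have [M uM] := bu z z0; exists M; apply/near_spacetimeP.
Qed.

Lemma locally_boundedN u : locally_bounded_on Q u ->
  locally_bounded_on Q (fun w => - u w).
Proof.
move=> /locally_boundedP bu; apply/locally_boundedP => z /bu[M [r r0 rM]].
by exists M, r => // w *; rewrite normrN rM.
Qed.

Lemma usc_setT_lt f x a : bounded_near (f : V -> R^o) (within setT (nbhs x)) ->
  usc_env setT f x < a -> exists2 r, 0 < r & forall y, enorm (y - x) < r -> f y < a.
Proof.
move=> bf fa; have := @fine_limf_esup_lt R _ f (within setT (nbhs x)) a.
by move=> /(_ (nbhs_setT_proper x) bf fa) /near_setTP.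
Qed.

Lemma usc_setT_le f x a : bounded_near (f : V -> R^o) (within setT (nbhs x)) ->
  (exists2 r, 0 < r & forall y, enorm (y - x) < r -> f y <= a) ->
  usc_env setT f x <= a.
Proof.
move=> bf fa; apply: fine_limf_esup_le; first exact: nbhs_setT_proper.
  exact: bf.
by apply/near_setTP.
Qed.

Lemma usc_setT_ge f x : bounded_near (f : V -> R^o) (within setT (nbhs x)) ->
  f x <= usc_env setT f x.
Proof.
move=> bf; rewrite leNgt; apply/negP => /(usc_setT_lt bf)[r r0 /(_ x)].
by rewrite !subrr enorm0 ltxx => /(_ r0).
Qed.

Lemma superjetP v z (p : V) X tau : superjet v z p X tau <->
  X^T = X /\ forall e, 0 < e -> exists2 r, 0 < r & forall w, 0 <= w.2 ->
    enorm (w.1 - z.1) < r -> `|w.2 - z.2| < r ->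
      v w <= v z + tau * (w.2 - z.2) + dotp p (w.1 - z.1)
             + 2^-1 * dotp ((w.1 - z.1) *m X) (w.1 - z.1)
             + e * (`|w.2 - z.2| + enorm (w.1 - z.1) ^+ 2).
Proof.
by split=> -[sX vX]; split=> // e /vX /near_spacetimeP.
Qed.

End spacetime_envelopes.

(** * The curvature Hamiltonian in the plane *)

Section hamiltonian.
Variable R : realType.
Local Notation V := 'rV[R]_2.
Local Notation M2 := 'M[R]_2.
Implicit Types (p q y : V) (X Y Z : M2) (a b e r s l : R).

Lemma ord2 (P : 'I_2 -> Prop) : P 0 -> P 1 -> forall i, P i.
Proof.
move=> P0 P1 [[|[|//]] ip].
  by rewrite (_ : Ordinal ip = 0)//; apply: val_inj.
by rewrite (_ : Ordinal ip = 1)//; apply: val_inj.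
Qed.

Lemma sum2 (F : 'I_2 -> R) : \sum_(i < 2) F i = F 0 + F 1.
Proof.
rewrite !big_ord_recl big_ord0 addr0; congr (F _ + F _); exact: val_inj.
Qed.

Definition mat2 (a b c : R) : M2 :=
  \matrix_(i, j) (if i == j then (if i == 0 then a else c) else b).

Lemma mat2E a b c : (mat2 a b c 0 0 = a) * (mat2 a b c 0 1 = b)
  * (mat2 a b c 1 0 = b) * (mat2 a b c 1 1 = c).
Proof. by rewrite !mxE. Qed.

Lemma mat2_sym a b c : (mat2 a b c)^T = mat2 a b c.
Proof.
by apply/matrixP => i j; rewrite !mxE; elim/ord2 : i; elim/ord2 : j; rewrite ?eqxx.
Qed.

Lemma sym2 X : X^T = X -> X 1 0 = X 0 1.
Proof. by move=> sX; rewrite -{1}sX mxE. Qed.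

Lemma quad2 X y : dotp (y *m X) y =
  X 0 0 * y 0 0 ^+ 2 + (X 0 1 + X 1 0) * (y 0 0 * y 0 1) + X 1 1 * y 0 1 ^+ 2.
Proof. by rewrite dotp2 !mxE !sum2; ring. Qed.

Lemma enorm_gt0 p : p != 0 -> 0 < p 0 0 ^+ 2 + p 0 1 ^+ 2.
Proof. by move=> p0; rewrite -enorm_sqr exprn_gt0// lt_def enorm_eq0 p0 enorm_ge0. Qed.

(** The trace only sees [X] along the unit vector orthogonal to [p]. *)
Lemma trsigma2 p X : p != 0 -> \tr (sigma p *m X) =
  (p 0 1 ^+ 2 * X 0 0 - p 0 0 * p 0 1 * (X 0 1 + X 1 0) + p 0 0 ^+ 2 * X 1 1) /
  (p 0 0 ^+ 2 + p 0 1 ^+ 2).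
Proof.
move=> p0; have /lt0r_neq0 s0 := enorm_gt0 p0.
rewrite /mxtrace sum2 !mxE !sum2 /sigma !mxE !big_ord1 !mxE !enorm_sqr /=.
by field.
Qed.

Lemma trsigma2_le p X : p != 0 -> `|\tr (sigma p *m X)| <=
  `|X 0 0| + `|X 0 1| + `|X 1 0| + `|X 1 1|.
Proof.
move=> p0; have s0 := enorm_gt0 p0; rewrite trsigma2//.
rewrite normrM normfV (gtr0_norm s0) ler_pdivrMr//.
set a := p 0 0 in s0 *; set b := p 0 1 in s0 *.
have h1 : `|a * b| <= a ^+ 2 + b ^+ 2.
  have := sqr_ge0 (a - b); have := sqr_ge0 (a + b); rewrite ler_norml; nra.
have := normr_ge0 (X 0 0); have := normr_ge0 (X 0 1).
have := normr_ge0 (X 1 0); have := normr_ge0 (X 1 1).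
move=> x3 x2 x1 x0.
apply: le_trans (ler_normD _ _) _; apply: le_trans (lerD (ler_normB _ _) (lexx _)) _.
rewrite [`|b ^+ 2 * _|]normrM [`|a ^+ 2 * _|]normrM [`|a * b * _|]normrM.
have h2 : `|X 0 1 + X 1 0| <= `|X 0 1| + `|X 1 0| := ler_normD _ _.
rewrite (ger0_norm (sqr_ge0 a)) (ger0_norm (sqr_ge0 b)).
have h3 : `|a * b| * `|X 0 1 + X 1 0| <= (a ^+ 2 + b ^+ 2) * (`|X 0 1| + `|X 1 0|).
  by apply: ler_pM.
have h4 : b ^+ 2 * `|X 0 0| <= (a ^+ 2 + b ^+ 2) * `|X 0 0|.
  by apply: ler_wpM2r => //; rewrite lerDr sqr_ge0.
have h5 : a ^+ 2 * `|X 1 1| <= (a ^+ 2 + b ^+ 2) * `|X 1 1|.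
  by apply: ler_wpM2r => //; rewrite lerDl sqr_ge0.
lra.
Qed.

Definition mxclose (r : R) X Y := forall i j, `|Y i j - X i j| < r.

Lemma mxcloseW r s X Y : r <= s -> mxclose r X Y -> mxclose s X Y.
Proof. by move=> rs XY i j; exact: lt_le_trans rs. Qed.

Lemma near_Ham_domP p X (P : V * M2 -> Prop) :
  (\forall q \near within (@Ham_dom R 2) (nbhs (p, X)), P q) <->
  exists2 r, 0 < r & forall q Y, q != 0 -> Y^T = Y -> enorm (q - p) < r ->
    mxclose r X Y -> P (q, Y).
Proof.
split=> [[[A B] /= [zA zB] ABP]|[r r0 rP]].
  have /ball_enormP[r1 r10 Ar] := zA.
  move/nbhs_ballP : zB => [r2 /= r20 Br].
  exists (Num.min r1 r2); first by rewrite lt_min r10.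
  move=> q Y q0 sY; rewrite lt_min => /andP[wr1 _] XY.
  apply: (ABP (q, Y)) => //; split; first exact: Ar.
  apply: Br; split=> // i j; rewrite /ball/= distrC.
  by apply: lt_le_trans (XY i j) _; rewrite ge_min lexx orbT.
exists ([set y | enorm (y - p) < r], [set Y | mxclose r X Y]) => /=.
  split; first by apply/ball_enormP; exists r.
  apply/nbhs_ballP; exists r => // Y [_ XY] i j; rewrite distrC; exact: XY.
by move=> [q Y] [] /= wr1 wr2 [/= q0 sY]; exact: rP.
Qed.

Lemma mxclose_refl r X : 0 < r -> mxclose r X X.
Proof. by move=> r0 i j; rewrite subrr normr0. Qed.

Lemma mxclose_trans r s X Y Z :
  mxclose r X Y -> mxclose s Y Z -> mxclose (r + s) X Z.
Proof.
move=> XY YZ i j; have := XY i j; have := YZ i j => h1 h2.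
rewrite -(subrK (Y i j) (Z i j)) -addrA.
by apply: le_lt_trans (ler_normD _ _) _; lra.
Qed.

Lemma Ham_dom_proper p X : X^T = X -> ProperFilter (within (@Ham_dom R 2) (nbhs (p, X))).
Proof.
move=> sX; apply: Build_ProperFilter_ex => P /near_Ham_domP[r r0 rP].
have [p0|p0] := eqVneq p 0; last first.
  by exists (p, X); apply: rP => //; [rewrite subrr enorm0|exact: mxclose_refl].
exists (vec2 (r / 2) 0, X); apply: rP => //; last exact: mxclose_refl.
  apply/eqP => /rowP/(_ 0); rewrite !mxE/=; lra.
rewrite p0 subr0; apply: le_lt_trans (enorm_le_coord _) _.
by rewrite !vec2E normr0 addr0 gtr0_norm; lra.
Qed.

Lemma Ham_bounded p X :
  bounded_near (@Ham R 2 : V * M2 -> R^o) (within (@Ham_dom R 2) (nbhs (p, X))).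
Proof.
pose S := `|X 0 0| + `|X 0 1| + `|X 1 0| + `|X 1 1|.
pose B := S + 4 + (enorm p + 1).
exists B; split; first exact: num_real.
move=> M BM; apply/near_Ham_domP; exists 1 => // q Y q0 sY qp XY /=.
apply/ltW/(le_lt_trans _ BM); rewrite /Ham/=.
apply: le_trans (ler_normB _ _) _; rewrite normrN (ger0_norm (enorm_ge0 _)).
apply: lerD; last first.
  by rewrite -(subrK p q); apply: le_trans (enormD _ _) _; lra.
apply: le_trans (trsigma2_le _ q0) _.
have h i j : `|Y i j| <= `|X i j| + 1.
  by rewrite -(subrK (X i j) (Y i j)); apply: le_trans (ler_normD _ _) _;
    have := XY i j; lra.
have := h 0 0; have := h 0 1; have := h 1 0; have := h 1 1; rewrite /S; lra.
Qed.

Lemma Ham_upper_lt0 p X a : X^T = X -> Ham_upper p X < a ->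
  exists2 r, 0 < r & forall q Y, q != 0 -> Y^T = Y -> enorm (q - p) < r ->
    mxclose r X Y -> Ham (q, Y) < a.
Proof.
move=> sX h; have := fine_limf_esup_lt (Ham_dom_proper p sX) (@Ham_bounded p X) h.
by move/near_Ham_domP.
Qed.

Lemma Ham_upper_le p X a : X^T = X ->
  (exists2 r, 0 < r & forall q Y, q != 0 -> Y^T = Y -> enorm (q - p) < r ->
    mxclose r X Y -> Ham (q, Y) <= a) -> Ham_upper p X <= a.
Proof.
move=> sX h; apply: fine_limf_esup_le; first exact: Ham_dom_proper.
  exact: Ham_bounded.
exact/near_Ham_domP.
Qed.

Lemma Ham_lower_gt0 p X a : X^T = X -> a < Ham_lower p X ->
  exists2 r, 0 < r & forall q Y, q != 0 -> Y^T = Y -> enorm (q - p) < r ->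
    mxclose r X Y -> a < Ham (q, Y).
Proof.
move=> sX; rewrite /Ham_lower lsc_envE ltrNr => h.
have FF := Ham_dom_proper p sX.
have bn : bounded_near ((fun w => - Ham w) : V * M2 -> R^o)
    (within (@Ham_dom R 2) (nbhs (p, X))).
  by apply: bounded_nearN; exact: Ham_bounded.
have := fine_limf_esup_lt FF bn h.
by move/near_Ham_domP => [r r0 rP]; exists r => // q Y *; rewrite -ltrN2 rP.
Qed.

Lemma Ham_lower_ge p X a : X^T = X ->
  (exists2 r, 0 < r & forall q Y, q != 0 -> Y^T = Y -> enorm (q - p) < r ->
    mxclose r X Y -> a <= Ham (q, Y)) -> a <= Ham_lower p X.
Proof.
move=> sX [r r0 rP]; rewrite /Ham_lower lsc_envE lerNr.
have FF := Ham_dom_proper p sX.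
apply: fine_limf_esup_le => //; first exact/bounded_nearN/Ham_bounded.
by apply/near_Ham_domP; exists r => // q Y *; rewrite lerN2 rP.
Qed.

Lemma Ham_upper_lt p X a : X^T = X -> Ham_upper p X < a ->
  exists2 r, 0 < r & forall q Y, Y^T = Y -> enorm (q - p) < r ->
    mxclose r X Y -> Ham_upper q Y < a.
Proof.
move=> sX h; pose b := (Ham_upper p X + a) / 2.
have [r r0 rP] : exists2 r, 0 < r & forall q Y, q != 0 -> Y^T = Y ->
    enorm (q - p) < r -> mxclose r X Y -> Ham (q, Y) < b.
  by apply: Ham_upper_lt0 => //; rewrite /b; lra.
exists (r / 2); first lra.
move=> q Y sY qp XY; apply: (@le_lt_trans _ _ b); last by rewrite /b; lra.
apply: Ham_upper_le => //; exists (r / 2); first lra.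
move=> q' Y' q'0 sY' q'q YY'; apply/ltW/rP => //.
  rewrite -(subrK q q') -addrA; apply: le_lt_trans (enormD _ _) _; lra.
by rewrite [r]splitr; exact: mxclose_trans YY'.
Qed.

Lemma Ham_lower_gt p X a : X^T = X -> a < Ham_lower p X ->
  exists2 r, 0 < r & forall q Y, Y^T = Y -> enorm (q - p) < r ->
    mxclose r X Y -> a < Ham_lower q Y.
Proof.
move=> sX h; pose b := (Ham_lower p X + a) / 2.
have [r r0 rP] : exists2 r, 0 < r & forall q Y, q != 0 -> Y^T = Y ->
    enorm (q - p) < r -> mxclose r X Y -> b < Ham (q, Y).
  by apply: Ham_lower_gt0 => //; rewrite /b; lra.
exists (r / 2); first lra.
move=> q Y sY qp XY; apply: (@lt_le_trans _ _ b); first by rewrite /b; lra.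
apply: Ham_lower_ge => //; exists (r / 2); first lra.
move=> q' Y' q'0 sY' q'q YY'; apply/ltW/rP => //.
  rewrite -(subrK q q') -addrA; apply: le_lt_trans (enormD _ _) _; lra.
by rewrite [r]splitr; exact: mxclose_trans YY'.
Qed.

Lemma Ham_lower_upper p X : X^T = X -> Ham_lower p X <= Ham_upper p X.
Proof.
move=> sX; rewrite leNgt; apply/negP => h.
pose a := (Ham_lower p X + Ham_upper p X) / 2.
have ha : a < Ham_lower p X by rewrite /a; lra.
have hb : Ham_upper p X < a by rewrite /a; lra.
have [r r0 rP] := Ham_lower_gt0 sX ha; have [s s0 sP] := Ham_upper_lt0 sX hb.
have FF := Ham_dom_proper p sX.
have : \forall q \near within (@Ham_dom R 2) (nbhs (p, X)), Ham q < a /\ a < Ham q.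
  apply/near_Ham_domP; exists (Num.min r s); first by rewrite lt_min r0.
  move=> q Y q0 sY; rewrite lt_min => /andP[q1 q2] XY.
  have c1 : mxclose r X Y by apply: mxcloseW XY; rewrite ge_min lexx.
  have c2 : mxclose s X Y by apply: mxcloseW XY; rewrite ge_min lexx orbT.
  by split; [exact: sP|exact: rP].
by move/filter_ex => [q []] /lt_trans h1 /h1; rewrite ltxx.
Qed.

Lemma Ham_lower_le_Ham p X : X^T = X -> p != 0 -> Ham_lower p X <= Ham (p, X).
Proof.
move=> sX p0; rewrite leNgt; apply/negP => /(Ham_lower_gt0 sX)[r r0 rP].
have := rP p X p0 sX; rewrite subrr enorm0 ltxx => /(_ r0) h.
by have := h (mxclose_refl _ r0).
Qed.

(** Degenerate ellipticity: up to the factor [|p|^2], the trace is a value of the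
    quadratic form of [Z]. *)
Lemma trsigma2_ge0 p Z : p != 0 -> (forall y, 0 <= dotp (y *m Z) y) ->
  0 <= \tr (sigma p *m Z).
Proof.
move=> p0 Z0; rewrite trsigma2//; apply: divr_ge0; last exact/ltW/enorm_gt0.
by have := Z0 (vec2 (p 0 1) (- p 0 0)); rewrite quad2 !vec2E sqrrN; lra.
Qed.

(** Adding [Y - X] to the matrix maps the neighbourhoods of [(p, X)] onto those of
    [(p, Y)]; so ellipticity of [Ham] passes to its envelope, also at [p = 0],
    where the envelope has no closed form. *)
Lemma Ham_lower_mono p X Y : X^T = X -> Y^T = Y ->
  (forall y, dotp (y *m X) y <= dotp (y *m Y) y) ->
  Ham_lower p Y <= Ham_lower p X.
Proof.
move=> sX sY XY; apply/ler_addgt0Pr => e e0; rewrite -lerBlDr.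
have [r r0 rP] : exists2 r, 0 < r & forall q Z, q != 0 -> Z^T = Z ->
    enorm (q - p) < r -> mxclose r Y Z -> Ham_lower p Y - e < Ham (q, Z).
  by apply: Ham_lower_gt0 => //; lra.
apply: Ham_lower_ge => //; exists r => // q Z q0 sZ qp XZ.
apply: (@le_trans _ _ (Ham (q, Z + (Y - X)))).
  apply/ltW/rP => //.
    by rewrite !linearD/= linearN/= sZ sY sX.
  by move=> i j; have := XZ i j; rewrite !mxE; congr (`|_| < _); ring.
rewrite /Ham/= lerD2r lerN2 mulmxDr linearD/= lerDl.
apply: trsigma2_ge0 => // y; have := XY y; rewrite !quad2 !mxE; lra.
Qed.

Lemma Ham_mxclose q X Y r : q != 0 -> mxclose r X Y ->
  `|\tr (sigma q *m Y) - \tr (sigma q *m X)| <= 4 * r.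
Proof.
move=> q0 XY; rewrite -linearB/= -mulmxBr.
apply: le_trans (trsigma2_le _ q0) _; rewrite !mxE.
have := XY 0 0; have := XY 0 1; have := XY 1 0; have := XY 1 1; lra.
Qed.

Lemma trsigma2_cont p X e : p != 0 -> 0 < e -> exists2 r, 0 < r &
  forall q, q != 0 -> enorm (q - p) < r ->
  `|\tr (sigma q *m X) - \tr (sigma p *m X)| < e.
Proof.
move=> p0 e0.
pose F q := (q 0 1 ^+ 2 * X 0 0 - q 0 0 * q 0 1 * (X 0 1 + X 1 0) + q 0 0 ^+ 2 * X 1 1) /
  (q 0 0 ^+ 2 + q 0 1 ^+ 2) : R.
have cc (i : 'I_2) : {for p, continuous (fun q : V => q 0 i : R)}.
  exact: coord_continuous.
have cF : {for p, continuous F}.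
  have c0 := cc 0; have c1 := cc 1.
  have cs : {for p, continuous (fun q : V => q 0 0 ^+ 2 + q 0 1 ^+ 2 : R)}.
    exact: continuousD (continuousM c0 c0) (continuousM c1 c1).
  apply: (@continuousM _ _ (fun q : V => q 0 1 ^+ 2 * X 0 0 - q 0 0 * q 0 1 * (X 0 1 + X 1 0)
      + q 0 0 ^+ 2 * X 1 1) (fun q : V => (q 0 0 ^+ 2 + q 0 1 ^+ 2)^-1)); last first.
    apply: (@continuousV _ _ (fun q : V => q 0 0 ^+ 2 + q 0 1 ^+ 2)) => //.
    by rewrite gt_eqF//; exact: enorm_gt0.
  have cc2 l : {for p, continuous (fun _ : V => l)} by exact: cst_continuous.
  apply: continuousD (continuousM (continuousM c0 c0) (cc2 _)).
  exact: continuousB (continuousM (continuousM c1 c1) (cc2 _))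
    (continuousM (continuousM c0 c1) (cc2 _)).
have /cvgrPdist_lt/(_ e e0)/ball_enormP[r r0 rP] := cF.
exists r => // q q0 /rP; rewrite distrC.
by rewrite /F -!trsigma2.
Qed.

(** Away from [p = 0] the Hamiltonian is continuous, hence equal to both of its
    envelopes. *)
Lemma Ham_cont p X e : p != 0 -> 0 < e -> exists2 r, 0 < r &
  forall q Y, q != 0 -> enorm (q - p) < r -> mxclose r X Y ->
  `|Ham (q, Y) - Ham (p, X)| <= e.
Proof.
move=> p0 e0; have e40 : 0 < e / 4 by lra.
have [r r0 rP] := trsigma2_cont X p0 e40.
exists (Num.min r (e / 16)); first by rewrite lt_min r0; lra.
move=> q Y q0; rewrite lt_min => /andP[qr qe] XY.
have XYe : mxclose (e / 16) X Y by apply: mxcloseW XY; rewrite ge_min lexx orbT.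
have := Ham_mxclose q0 XYe; have := rP q q0 qr; rewrite /Ham/=.
have : enorm q <= enorm (q - p) + enorm p.
  by have := enormD (q - p) p; rewrite subrK.
have : enorm p <= enorm (q - p) + enorm q.
  by have := enormD (p - q) q; rewrite subrK -(enormN (p - q)) opprB.
rewrite !ler_norml ltr_norml; lra.
Qed.

Lemma Ham_lower_ge_Ham p X : X^T = X -> p != 0 -> Ham (p, X) <= Ham_lower p X.
Proof.
move=> sX p0; apply/ler_addgt0Pr => e e0; rewrite -lerBlDr.
have [r r0 rP] := Ham_cont X p0 e0.
apply: Ham_lower_ge => //; exists r => // q Y q0 sY qp XY.
have := rP q Y q0 qp XY; rewrite ler_norml; lra.
Qed.

Lemma Ham_upper_le_Ham p X : X^T = X -> p != 0 -> Ham_upper p X <= Ham (p, X).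
Proof.
move=> sX p0; apply/ler_addgt0Pr => e e0.
have [r r0 rP] := Ham_cont X p0 e0.
apply: Ham_upper_le => //; exists r => // q Y q0 sY qp XY.
have := rP q Y q0 qp XY; rewrite ler_norml; lra.
Qed.

Lemma trsigma2_scalar q (l : R) : q != 0 -> \tr (sigma q *m l%:M) = l.
Proof.
move=> q0; rewrite trsigma2// !mxE/=.
by have /lt0r_neq0 := enorm_gt0 q0; rewrite !mulr1n !mulr0n => h; field.
Qed.

(** On scalar matrices the trace is independent of the direction of the gradient,
    so that the singularity at [p = 0] disappears.  This gives access to the
    critical points of the test functions, where the Hessian is always scalar. *)
Lemma Ham_scalar (l : R) e : 0 < e -> exists2 r, 0 < r &
  forall q Y, q != 0 -> enorm (q - 0) < r -> mxclose r l%:M Y ->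
  `|Ham (q, Y) + l| <= e.
Proof.
move=> e0; exists (e / 8); first lra.
move=> q Y q0; rewrite subr0 => qe XY.
have := Ham_mxclose q0 XY; rewrite trsigma2_scalar// /Ham/=.
have := enorm_ge0 q; rewrite !ler_norml; lra.
Qed.

Lemma Ham_lower_scalar (l : R) : - l <= Ham_lower 0 (l%:M : M2).
Proof.
have sX : (l%:M : M2)^T = l%:M by rewrite tr_scalar_mx.
apply/ler_addgt0Pr => e e0; rewrite -lerBlDr.
have [r r0 rP] := Ham_scalar l e0.
apply: Ham_lower_ge => //; exists r => // q Y q0 sY qp XY.
have := rP q Y q0 qp XY; rewrite ler_norml; lra.
Qed.

Lemma Ham_upper_scalar (l : R) : Ham_upper 0 (l%:M : M2) <= - l.
Proof.
have sX : (l%:M : M2)^T = l%:M by rewrite tr_scalar_mx.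
apply/ler_addgt0Pr => e e0.
have [r r0 rP] := Ham_scalar l e0.
apply: Ham_upper_le => //; exists r => // q Y q0 sY qp XY.
have := rP q Y q0 qp XY; rewrite ler_norml; lra.
Qed.

End hamiltonian.

(** * Touching a semicontinuous envelope by a test function *)

Section test_functions.
Variable R : realType.
Local Notation V := 'rV[R]_2.
Local Notation M2 := 'M[R]_2.
Local Notation Q := (spacetime R 2).
Implicit Types (p q x y : V) (X Y Z : M2) (a b c d e r s l m t C K M tau : R).
Implicit Types (g u v psi : V * R -> R) (z w : V * R) (f : V -> R).

Definition cylinder x r a b : set (V * R) :=
  [set w | enorm (w.1 - x) <= r /\ a <= w.2 <= b].

Lemma cylinder_compact x r a b : compact (cylinder x r a b).
Proof.
have -> : cylinder x r a b = [set y | enorm (y - x) <= r] `*` `[a, b].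
  by apply/seteqP; split=> w /=; rewrite in_itv.
apply: compact_setX; last exact: segment_compact.
apply: bounded_closed_compact.
  exists (enorm x + r); split; first exact: num_real.
  move=> M rM y /= yr; apply/ltW.
  apply: le_lt_trans rM; rewrite -[`|y|]/(mx_norm y).
  have [->|/mx_norm_neq0[[i j]]] := eqVneq (mx_norm y) 0.
    by rewrite addr_ge0 ?enorm_ge0// (le_trans _ yr)// enorm_ge0.
  rewrite ord1 => ->/=; apply: le_trans (coord_le_enorm _ _) _.
  by rewrite -(subrK x y) addrC; apply: le_trans (enormD _ _) _; rewrite lerD2l.
move=> y cy /=; rewrite leNgt; apply/negP => ry.
have : nbhs y [set y' | enorm (y' - y) < enorm (y - x) - r].
  by apply/ball_enormP; exists (enorm (y - x) - r) => //; rewrite subr_gt0.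
move=> /cy[y' []] /= h1 h2.
have := enormD (y - y') (y' - x); rewrite subrKA -(enormN (y - y')) opprB; lra.
Qed.

(** The superlevel sets through points of the cylinder form a filter basis, and a
    cluster point of that filter is a maximum point. *)
Lemma usc_attains_max g x r a b : 0 <= r -> a <= b ->
  (forall w, cylinder x r a b w -> forall l, g w < l -> exists2 s, 0 < s &
     forall w', cylinder x r a b w' -> enorm (w'.1 - w.1) < s ->
       `|w'.2 - w.2| < s -> g w' < l) ->
  exists2 w, cylinder x r a b w &
    forall w', cylinder x r a b w' -> g w' <= g w.
Proof.
move=> r0 ab gusc; set K := cylinder x r a b in gusc *.
have K0 : K (x, a) by split; rewrite /= ?subrr ?enorm0// lexx.
pose F := filter_from K (fun i => [set w | K w /\ g i <= g w]).
have FF : ProperFilter F.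
  apply: filter_from_proper; last by move=> i Ki; exists i; split.
  apply: filter_from_filter; first by exists (x, a).
  move=> i j Ki Kj; have [gij|/ltW gij] := leP (g i) (g j).
    by exists j => // w [Kw gw]; split; split=> //; apply: le_trans gw.
  by exists i => // w [Kw gw]; split; split=> //; apply: le_trans gw.
have FK : F K by exists (x, a) => // w [].
have [w [Kw cw]] := cylinder_compact FF FK.
exists w => // i Ki; rewrite leNgt; apply/negP => /(gusc w Kw)[s s0 sP].
have Fi : F [set w | K w /\ g i <= g w] by exists i.
have nw : nbhs w [set w' | enorm (w'.1 - w.1) < s /\ `|w'.2 - w.2| < s].
  exists ([set y | enorm (y - w.1) < s], [set t | `|t - w.2| < s]) => //=.
  split; first by apply/ball_enormP; exists s.
  by apply/nbhs_ballP; exists s => // t; rewrite /ball/= distrC.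
have [w' [[Kw' gw'] [h1 h2]]] := cw _ _ Fi nw.
by have := sP w' Kw' h1 h2; rewrite ltNge gw'.
Qed.

(** Squared parabolic distance, the size of the error in a parabolic jet. *)
Definition gauge (w z : V * R) : R := `|w.2 - z.2| + enorm (w.1 - z.1) ^+ 2.

Definition quadratic z p X tau w : R := tau * (w.2 - z.2) + dotp p (w.1 - z.1)
  + 2^-1 * dotp ((w.1 - z.1) *m X) (w.1 - z.1).

Lemma gauge_ge0 w z : 0 <= gauge w z.
Proof. by rewrite addr_ge0// exprn_ge0// enorm_ge0. Qed.

(** Errors of third order are negligible against the gauge. *)
Lemma superjet_intro v z p X tau r C : X^T = X -> 0 < r -> 0 <= C ->
  (forall w, 0 <= w.2 -> enorm (w.1 - z.1) < r -> `|w.2 - z.2| < r ->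
    v w <= v z + quadratic z p X tau w
           + C * ((`|w.2 - z.2| + enorm (w.1 - z.1)) * gauge w z)) ->
  superjet v z p X tau.
Proof.
move=> sX r0 C0 vP; apply/superjetP; split=> // e e0.
have C1 : 0 < 2 * (C + 1) by lra.
exists (Num.min r (e / (2 * (C + 1)))); first by rewrite lt_min r0 divr_gt0.
move=> w w0; rewrite !lt_min => /andP[w1 w2] /andP[w3 w4].
apply: le_trans (vP w w0 w1 w3) _; rewrite /quadratic !addrA lerD2l mulrA.
rewrite -/(gauge w z); apply: ler_wpM2r; first exact: gauge_ge0.
move: w2 w4; rewrite !ltr_pdivlMr// => w2 w4.
have := enorm_ge0 (w.1 - z.1); have := normr_ge0 (w.2 - z.2).
set A := enorm _ in w2 *; set B := `|_| in w4 *; nra.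
Qed.

(** A jet passes from [psi] to every function that grows no faster near the
    contact point; a difference linear in time shifts the time derivative, and a
    quadratic one is invisible. *)
Lemma superjet_transfer v psi z p X tau tau' r C : 0 < r -> 0 <= C ->
  (forall w, 0 <= w.2 -> enorm (w.1 - z.1) < r -> `|w.2 - z.2| < r ->
    v w - v z <= psi w - psi z + (tau' - tau) * (w.2 - z.2)
                 + C * (w.2 - z.2) ^+ 2) ->
  superjet psi z p X tau -> superjet v z p X tau'.
Proof.
move=> r0 C0 vP /superjetP[sX psiP]; apply/superjetP; split=> // e e0.
have C1 : 0 < 2 * (C + 1) by lra.
have e20 : 0 < e / 2 by lra.
have [r1 r10 r1P] := psiP _ e20.
exists (Num.min r (Num.min r1 (e / (2 * (C + 1))))).
  by rewrite !lt_min r0 r10 divr_gt0.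
move=> w w0; rewrite !lt_min => /and3P[w1 w2 _] /and3P[w3 w4 w5].
have h1 := vP w w0 w1 w3; have h2 := r1P w w0 w2 w4.
have h3 : C * (w.2 - z.2) ^+ 2 <= e / 2 * `|w.2 - z.2|.
  rewrite -(real_normK (num_real (w.2 - z.2))).
  move: w5; rewrite ltr_pdivlMr//.
  have := normr_ge0 (w.2 - z.2); set B := `|_|; nra.
have := exprn_ge0 2 (enorm_ge0 (w.1 - z.1)).
set E := enorm _ ^+ 2 in h2 *; move=> E0.
have : 0 <= e / 2 * E by rewrite mulr_ge0// ltW.
rewrite mulrDr; rewrite mulrDr in h2; lra.
Qed.

Lemma superjet_le v psi z p X tau r : 0 < r ->
  (forall w, 0 <= w.2 -> enorm (w.1 - z.1) < r -> `|w.2 - z.2| < r ->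
    v w - v z <= psi w - psi z) -> superjet psi z p X tau -> superjet v z p X tau.
Proof.
move=> r0 vP; apply: (superjet_transfer r0 (lexx 0)) => w w0 w1 w2.
by rewrite subrr !mul0r !addr0 vP.
Qed.

Lemma superjet_ge v psi z p X tau r : 0 < r -> v z = psi z ->
  (forall w, 0 <= w.2 -> enorm (w.1 - z.1) < r -> `|w.2 - z.2| < r -> v w <= psi w) ->
  superjet psi z p X tau -> superjet v z p X tau.
Proof.
by move=> r0 vz vP; apply: (superjet_le r0) => w w0 w1 w2; rewrite vz lerD2r vP.
Qed.

Definition lsc_at psi z := forall e, 0 < e -> exists2 r, 0 < r & forall w,
  0 <= w.2 -> enorm (w.1 - z.1) < r -> `|w.2 - z.2| < r -> psi z - e < psi w.

Definition nonneg_far psi := forall T, 0 < T -> exists r, forall x t,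
  r <= enorm x -> 0 <= t <= T -> 0 <= psi (x, t).

(** Second order behaviour of the time penalty in [touching]; being of class
    C^1 with bounded second derivative, it shifts jets in time only. *)
Lemma pos_part_sqr a s :
  Num.max 0 (a + s) ^+ 2 <= Num.max 0 a ^+ 2 + 2 * Num.max 0 a * s + s ^+ 2.
Proof. by case: (lerP 0 (a + s)); case: (lerP 0 a) => ? ?; rewrite ?mul0r; nra. Qed.

Lemma pos_part_sqr_mono a b : a <= b -> Num.max 0 a ^+ 2 <= Num.max 0 b ^+ 2.
Proof.
move=> ab; rewrite ler_pXn2r// ?nnegrE ?le_max ?lexx//.
by case: (lerP 0 a); case: (lerP 0 b) => *; lra.
Qed.

Lemma pos_part_sqr_lip a b : a <= b ->
  Num.max 0 b ^+ 2 - Num.max 0 a ^+ 2 <= 2 * Num.max 0 b * (b - a).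
Proof.
move=> ab; case: (lerP 0 b) => b0; last first.
  by have := sqr_ge0 (Num.max 0 a); rewrite expr0n/=; lra.
case: (lerP 0 a) => a0; last by rewrite expr0n/=; nra.
by have := sqr_ge0 (b - a); nra.
Qed.

Lemma usc_env_far g T r x t : locally_bounded_on Q g ->
  (forall x t, ~ eball 0 r x -> 0 <= t <= T -> g (x, t) = 0) ->
  r < enorm x -> 0 <= t < T -> usc_env Q g (x, t) <= 0.
Proof.
move=> bg gP rx /andP[t0 tT]; apply: usc_le => //.
exists (Num.min (enorm x - r) (T - t)); first by rewrite lt_min !subr_gt0 rx.
move=> [x' t']/= t'0; rewrite !lt_min => /andP[w1 _] /andP[_ w2].
rewrite gP// /eball/=.
  rewrite subr0; have := enormD (x - x') x'; rewrite subrK -(enormN (x - x')) opprB; lra.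
by rewrite t'0/=; move: w2; rewrite ltr_norml; lra.
Qed.

(** Maximise the envelope minus [psi] minus a penalty [P (t - t1)_+^2] over a large
    cylinder that ends at time [t1 + 1].  The penalty vanishes at [(x1, t1)], where
    the difference is positive, while [P] exceeds the maximum of the difference,
    which excludes the final time; the hypotheses on [psi] exclude the initial
    time and the lateral boundary.  At the interior maximum the penalty has a
    nonnegative time derivative, so that it can only increase [tau]. *)
Lemma touching g psi x1 t1 :
  locally_bounded_on Q g -> compactly_supported_in_space g ->
  (forall z, 0 <= z.2 -> lsc_at psi z) ->
  (forall x, usc_env Q g (x, 0) <= psi (x, 0)) -> nonneg_far psi ->
  0 <= t1 -> psi (x1, t1) < usc_env Q g (x1, t1) ->
  exists z, 0 < z.2 /\ forall p X tau, superjet psi z p X tau ->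
    exists2 tau', tau <= tau' & superjet (usc_env Q g) z p X tau'.
Proof.
move=> bg cg lpsi psi0 psif t10 psi1; set gs := usc_env Q g in psi0 psi1 *.
pose T := t1 + 1; have T0 : 0 < T by rewrite /T; lra.
have [r2 r20 r2P] := cg (T + 1) ltac:(rewrite /T; lra).
have [r3 r3P] := psif T T0.
pose r := Num.max (enorm x1) (Num.max r2 r3) + 1.
have rx1 : enorm x1 < r.
  by apply: (@le_lt_trans _ _ (r - 1)); [rewrite addrK le_max lexx|lra].
have rr2 : r2 < r.
  by apply: (@le_lt_trans _ _ (r - 1)); [rewrite addrK !le_max lexx orbT|lra].
have rr3 : r3 < r.
  by apply: (@le_lt_trans _ _ (r - 1)); [rewrite addrK !le_max lexx !orbT|lra].
have r0 : 0 <= r by apply: le_trans (ltW rx1); exact: enorm_ge0.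
have far x t : r2 < enorm x -> 0 <= t <= T -> gs (x, t) <= 0.
  move=> rx /andP[t0 tT]; apply: (usc_env_far bg r2P rx).
  by rewrite t0/=; lra.
have uscP (P : R) : 0 <= P -> forall w, cylinder 0 r 0 T w -> forall l,
    gs w - psi w - P * Num.max 0 (w.2 - t1) ^+ 2 < l -> exists2 s, 0 < s &
     forall w', cylinder 0 r 0 T w' -> enorm (w'.1 - w.1) < s ->
       `|w'.2 - w.2| < s -> gs w' - psi w' - P * Num.max 0 (w'.2 - t1) ^+ 2 < l.
  move=> P0 w [_ /andP[w0 wT]] l gl.
  have [e e0 le] : exists2 e : R, 0 < e &
      l = gs w - psi w - P * Num.max 0 (w.2 - t1) ^+ 2 + 3 * e.
    exists ((l - (gs w - psi w - P * Num.max 0 (w.2 - t1) ^+ 2)) / 3).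
      by rewrite divr_gt0// subr_gt0.
    by field.
  have ge : gs w < gs w + e by rewrite ltrDl.
  have [s1 s10 s1P] := usc_lt bg w0 ge.
  have [s2 s20 s2P] := lpsi w w0 e e0.
  pose m := Num.max 0 (w.2 - t1); have m0 : 0 <= m by rewrite le_max lexx.
  have den0 : 0 < 2 * P * m + 1 by rewrite ltr_wpDl// !mulr_ge0.
  pose s3 := e / (2 * P * m + 1).
  have s30 : 0 < s3 by rewrite divr_gt0.
  exists (Num.min s1 (Num.min s2 s3)); first by rewrite !lt_min s10 s20.
  move=> w' [_ /andP[w'0 w'T]]; rewrite !lt_min => /and3P[w1 w2 _] /and3P[w3 w4 w5].
  have h1 : gs w' < gs w + e by exact: s1P.
  have h2 := s2P w' w'0 w2 w4.
  suff h4 : P * Num.max 0 (w.2 - t1) ^+ 2 - P * Num.max 0 (w'.2 - t1) ^+ 2 <= e.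
    rewrite le; move: h1 h2 h4; clear.
    move: (gs w) (gs w') (psi w) (psi w') => a1 a2 a3 a4.
    move: (P * _) (P * _) => a5 a6; lra.
  have [ww'|ww'] := leP w.2 w'.2.
    suff h4 : Num.max 0 (w.2 - t1) ^+ 2 <= Num.max 0 (w'.2 - t1) ^+ 2.
      by apply: le_trans (ltW e0); rewrite subr_le0; exact: ler_wpM2l.
    by apply: pos_part_sqr_mono; rewrite lerD2r.
  have h5 : m ^+ 2 - Num.max 0 (w'.2 - t1) ^+ 2 <= 2 * m * (w.2 - w'.2).
    have -> : w.2 - w'.2 = (w.2 - t1) - (w'.2 - t1) by ring.
    by apply: pos_part_sqr_lip; rewrite lerD2r ltW.
  have h6 : (2 * P * m + 1) * (w.2 - w'.2) <= e.
    rewrite mulrC -ler_pdivlMr//; apply/ltW/(le_lt_trans _ w5).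
    by rewrite distrC ler_norm.
  rewrite -/m -mulrBr; apply: le_trans (ler_wpM2l P0 h5) _.
  by apply: le_trans h6; move: ww'; clear; lra.
have [w0 [_ w0K] w0max] := usc_attains_max r0 (ltW T0) (uscP 0 (lexx 0)).
pose P := Num.max 0 (gs w0 - psi w0) + 1.
have P0 : 0 <= P by rewrite /P addr_ge0// le_max lexx.
have [z [zr /andP[z0 zT]] zmax] := usc_attains_max r0 (ltW T0) (uscP P P0).
have K1 : cylinder 0 r 0 T (x1, t1).
  by split=> /=; [rewrite subr0 ltW|rewrite t10 lerDl ler01].
have pos : P * Num.max 0 (z.2 - t1) ^+ 2 < gs z - psi z.
  rewrite -subr_gt0; apply: lt_le_trans (zmax _ K1).
  by rewrite subrr /= (max_idPl (lexx 0)) expr0n/= mulr0 subr0 subr_gt0.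
have pos0 : psi z < gs z.
  by rewrite -subr_gt0; apply: le_lt_trans pos; rewrite mulr_ge0// sqr_ge0.
have zT' : z.2 < T.
  rewrite lt_neqAle zT andbT; apply/eqP => zTe.
  have Kz : cylinder 0 r 0 T z by split=> //; rewrite z0 zT.
  have := w0max z Kz; rewrite !mul0r !subr0.
  have m1 : Num.max 0 (z.2 - t1) = 1.
    by rewrite zTe /T addrC addKr; apply/max_idPr.
  have h1 : gs w0 - psi w0 <= P - 1 by rewrite addrK le_max lexx orbT.
  move: pos; rewrite m1 expr1n mulr1 => pos h2.
  have := lt_le_trans pos (le_trans h2 h1); rewrite ltrDl ltr0N1//.
have z0' : 0 < z.2.
  rewrite lt_def z0 andbT; apply/eqP => ze.
  by move: pos0 (psi0 z.1); rewrite -ze -surjective_pairing => /lt_le_trans h /h; rewrite ltxx.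
have zr' : enorm z.1 < r.
  rewrite ltNge; apply/negP => rz.
  have h1 : gs (z.1, z.2) <= 0 by apply: far; [exact: lt_le_trans rz|rewrite z0].
  have h2 : 0 <= psi (z.1, z.2) by apply: r3P; [apply/ltW/(lt_le_trans rr3)|rewrite z0].
  move: h1 h2; rewrite -surjective_pairing => h1 h2.
  by have := lt_le_trans pos0 (le_trans h1 h2); rewrite ltxx.
exists z; split=> // p X tau jpsi.
pose m := Num.max 0 (z.2 - t1); have m0 : 0 <= m by rewrite le_max lexx.
exists (tau + 2 * P * m); first by rewrite lerDl !mulr_ge0.
have rad0 : 0 < Num.min (r - enorm z.1) (T - z.2).
  by rewrite lt_min !subr_gt0 zr' zT'.
apply: (superjet_transfer rad0 P0 _ jpsi) => w wt0.
rewrite !lt_min => /andP[w1 _] /andP[_ w2].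
have Kw : cylinder 0 r 0 T w.
  split; last first.
    rewrite wt0/= -(subrK z.2 w.2) -lerBrDr.
    by apply: le_trans (ltW w2); exact: ler_norm.
  rewrite subr0 -(subrK z.1 w.1); apply: le_trans (enormD _ _) _.
  by rewrite -lerBrDr; exact: ltW.
have := zmax w Kw; have := pos_part_sqr (z.2 - t1) (w.2 - z.2).
rewrite addrC subrKA -/m => h1 h2.
have := ler_wpM2l P0 h1; move: h2; clear.
move: (gs z) (gs w) (psi z) (psi w) => a1 a2 a3 a4.
move: m (w.2 - z.2) (Num.max 0 _ ^+ 2) P => a5 a6 a7 a8; lra.
Qed.

(** * Calculus of jets *)

Lemma superjetD u v z p q X Y tau l : superjet u z p X tau -> superjet v z q Y l ->
  superjet (fun w => u w + v w) z (p + q) (X + Y) (tau + l).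
Proof.
move=> /superjetP[sX uP] /superjetP[sY vP]; apply/superjetP.
split=> [|e e0]; first by rewrite linearD/= sX sY.
have e20 : 0 < e / 2 by lra.
have [r r0 rP] := uP _ e20; have [r' r'0 r'P] := vP _ e20.
exists (Num.min r r'); first by rewrite lt_min r0.
move=> w w0; rewrite !lt_min => /andP[w1 w2] /andP[w3 w4].
have := rP w w0 w1 w3; have := r'P w w0 w2 w4; rewrite !quad2 !dotp2 !mxE.
move: (u w) (u z) (v w) (v z) (_ + _ ^+ 2) => a1 a2 a3 a4 a5; lra.
Qed.

Lemma superjetZ u z p X tau m : 0 <= m -> superjet u z p X tau ->
  superjet (fun w => m * u w) z (m *: p) (m *: X) (m * tau).
Proof.
move=> m0 /superjetP[sX uP]; apply/superjetP.
split=> [|e e0]; first by rewrite linearZ/= sX.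
have e20 : 0 < e / (m + 1) by rewrite divr_gt0//; lra.
have [r r0 rP] := uP _ e20.
exists r => // w w0 w1 w3; have := ler_wpM2l m0 (rP w w0 w1 w3).
rewrite !quad2 !dotp2 !mxE -/(gauge w z) => h.
have : m * (e / (m + 1) * gauge w z) <= e * gauge w z.
  rewrite mulrA; apply: ler_wpM2r; first exact: gauge_ge0.
  by rewrite mulrA ler_pdivrMr; [nra|lra].
move: h; rewrite !mulrDr.
move: (u w) (u z) (gauge w z) (e / (m + 1)) => a1 a2 a3 a4; lra.
Qed.

(** Two-sided expansion of second order with a cubic error.  Unlike a superjet, it
    can be composed with functions that are not monotone. *)
Definition expands g z p X tau := X^T = X /\ exists C r, [/\ 0 <= C, 0 < r &
  forall w, 0 <= w.2 -> enorm (w.1 - z.1) < r -> `|w.2 - z.2| < r ->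
    `|g w - g z - quadratic z p X tau w|
      <= C * ((`|w.2 - z.2| + enorm (w.1 - z.1)) * gauge w z)].

Lemma expands_superjet g z p X tau : expands g z p X tau -> superjet g z p X tau.
Proof.
move=> [sX [C [r [C0 r0 gP]]]]; apply: (superjet_intro sX r0 C0) => w w0 w1 w2.
have := gP w w0 w1 w2; rewrite ler_norml => /andP[_]; lra.
Qed.

Lemma abs_quad_le X : exists2 C, 0 <= C & forall y,
  `|2^-1 * dotp (y *m X) y| <= C * enorm y ^+ 2.
Proof.
exists (`|X 0 0| + `|X 0 1| + `|X 1 0| + `|X 1 1|) => [|y].
  by rewrite !addr_ge0.
have -> : 2^-1 * dotp (y *m X) y = 2^-1 * (X 0 0 * y 0 0 ^+ 2) +
  2^-1 * (X 0 1 * (y 0 0 * y 0 1)) + 2^-1 * (X 1 0 * (y 0 0 * y 0 1)) +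
  2^-1 * (X 1 1 * y 0 1 ^+ 2) by rewrite quad2; ring.
have h (m c : R) : `|c| <= enorm y ^+ 2 -> `|2^-1 * (m * c)| <= `|m| * enorm y ^+ 2.
  move=> cy; rewrite !normrM ger0_norm ?invr_ge0//.
  have := ler_wpM2l (normr_ge0 m) cy; have := mulr_ge0 (normr_ge0 m) (normr_ge0 c); lra.
have h2 : `|y 0 0 * y 0 1| <= enorm y ^+ 2.
  rewrite enorm_sqr; have := sqr_ge0 (y 0 0 - y 0 1); have := sqr_ge0 (y 0 0 + y 0 1).
  rewrite ler_norml; nra.
have h1 : `|y 0 0 ^+ 2| <= enorm y ^+ 2 by rewrite enorm_sqr ger0_norm ?sqr_ge0// lerDl sqr_ge0.
have h3 : `|y 0 1 ^+ 2| <= enorm y ^+ 2 by rewrite enorm_sqr ger0_norm ?sqr_ge0// lerDr sqr_ge0.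
rewrite !mulrDl; apply: le_trans (ler_normD _ _) _; apply: lerD; last exact: h.
apply: le_trans (ler_normD _ _) _; apply: lerD; last exact: h.
by apply: le_trans (ler_normD _ _) _; apply: lerD; exact: h.
Qed.

Lemma abs_dotp_le x y : `|dotp x y| <= enorm x * enorm y.
Proof.
rewrite ler_norml dotp_le_enorm andbT lerNl.
have -> : - dotp x y = dotp (- x) y by rewrite !dotp2 !mxE; ring.
by rewrite -(enormN x); exact: dotp_le_enorm.
Qed.

Lemma quad_tensor p y : dotp (y *m (p^T *m p)) y = dotp p y ^+ 2.
Proof. by rewrite quad2 dotp2 !mxE !big_ord1 !mxE; ring. Qed.

(** With [L] the linear part and [h] the remainder of an increment, the terms
    [L h], [h^2] and the cubic one are all of the size of a negligible error. *)
Lemma chain_estimate (F1 F2 K P C E Y d L h : R) :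
  0 <= K -> 0 <= P -> 0 <= C -> 0 <= E <= 1 -> 0 <= Y <= 1 ->
  d = L + h -> `|L| <= P * Y -> `|h| <= C * (E + Y ^+ 2) ->
  2^-1 * F2 * d ^+ 2 + K * `|d| ^+ 3 <=
  2^-1 * F2 * L ^+ 2 +
   (`|F2| * (P * C + C ^+ 2) + K * (P + C) * (2 * P ^+ 2 + 4 * C ^+ 2)) *
   ((E + Y) * (E + Y ^+ 2)).
Proof.
move=> K0 P0 C0 /andP[E0 E1] /andP[Y0 Y1] -> Lb hb.
set G := E + Y ^+ 2; set D := E + Y.
have YY : Y ^+ 2 <= Y by rewrite expr2 ler_piMr.
have YG : Y ^+ 2 <= G by rewrite /G lerDr.
have G0 : 0 <= G by rewrite /G addr_ge0// sqr_ge0.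
have GD : G <= D by rewrite /G /D lerD2l.
have YD : Y <= D by rewrite /D lerDr.
have D0 : 0 <= D by apply: le_trans YD.
have D2 : D <= 2 by rewrite /D; lra.
have h0 : 0 <= `|h| by [].
have L0 : 0 <= `|L| by [].
have hG : h ^+ 2 <= C ^+ 2 * (D * G).
  rewrite -(real_normK (num_real h)).
  apply: (@le_trans _ _ ((C * G) ^+ 2)); first by rewrite ler_pXn2r// ?nnegrE// mulr_ge0.
  by rewrite exprMn ler_wpM2l ?sqr_ge0// expr2 ler_wpM2r.
have LhG : `|L * h| <= P * C * (D * G).
  rewrite normrM; apply: (@le_trans _ _ ((P * Y) * (C * G))); first exact: ler_pM.
  rewrite mulrACA ler_wpM2l ?mulr_ge0// ler_wpM2r//.
have L2G : L ^+ 2 <= P ^+ 2 * G.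
  rewrite -(real_normK (num_real L)).
  apply: (@le_trans _ _ ((P * Y) ^+ 2)); first by rewrite ler_pXn2r// ?nnegrE// mulr_ge0.
  by rewrite exprMn ler_wpM2l ?sqr_ge0.
have d1 : `|L + h| <= (P + C) * D.
  apply: le_trans (ler_normD _ _) _; rewrite mulrDl; apply: lerD.
    by apply: le_trans Lb _; rewrite ler_wpM2l.
  by apply: le_trans hb _; rewrite ler_wpM2l.
have hG2 : h ^+ 2 <= 2 * C ^+ 2 * G.
  apply: le_trans hG _; rewrite (_ : 2 * C ^+ 2 * G = C ^+ 2 * (2 * G)); last by ring.
  by apply: ler_wpM2l; [exact: sqr_ge0|exact: ler_wpM2r].
have d2 : (L + h) ^+ 2 <= (2 * P ^+ 2 + 4 * C ^+ 2) * G.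
  have := sqr_ge0 (L - h); rewrite mulrDl; move: L2G hG2; clear; nra.
have d3 : `|L + h| ^+ 3 <= (P + C) * (2 * P ^+ 2 + 4 * C ^+ 2) * (D * G).
  rewrite exprS mulrACA; apply: ler_pM => //; rewrite ?exprn_ge0//.
  by rewrite real_normK ?num_real.
have f1 : F2 * (L * h) <= `|F2| * (P * C * (D * G)).
  by apply: le_trans (ler_norm _) _; rewrite normrM ler_wpM2l.
have f2 : F2 * h ^+ 2 <= `|F2| * (C ^+ 2 * (D * G)).
  apply: le_trans (ler_norm _) _; rewrite normrM ler_wpM2l//.
  by rewrite ger0_norm ?sqr_ge0.
have f20 : 0 <= `|F2| * (C ^+ 2 * (D * G)) by rewrite !mulr_ge0 ?sqr_ge0.
have f3 := ler_wpM2l K0 d3.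
move: f1 f2 f20 f3; clear.
move: (`|F2|) (D * G) (`|L + h| ^+ 3) => a1 a2 a3; nra.
Qed.

(** Chain rule.  As [g] is expanded from both sides, an upper expansion of [F] is
    enough; the tensor product of the gradient by itself comes from the square of
    the linear part. *)
Lemma superjet_comp (F : R -> R) g z p X tau F1 F2 K r :
  expands g z p X tau -> 0 < r -> 0 <= K ->
  (forall d, `|d| < r -> F (g z + d) <= F (g z) + F1 * d + 2^-1 * F2 * d ^+ 2 + K * `|d| ^+ 3) ->
  superjet (fun w => F (g w)) z (F1 *: p) (F1 *: X + F2 *: (p^T *m p)) (F1 * tau).
Proof.
move=> [sX [C [s [C0 s0 gP]]]] r0 K0 FP.
have [CX CX0 CXP] := abs_quad_le X.
pose P := enorm p; have P0 : 0 <= P := enorm_ge0 p.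
pose A := `|tau| + CX + 2 * C.
have A0 : 0 <= A by rewrite /A !addr_ge0// mulr_ge0.
have PA0 : 0 < P + 2 * A + 1 by rewrite ltr_wpDl// addr_ge0// mulr_ge0.
pose s' := Num.min s (Num.min 1 (r / (P + 2 * A + 1))).
have s'0 : 0 < s' by rewrite !lt_min s0 ltr01 divr_gt0.
pose B := `|F1| * C + (`|F2| * (P * A + A ^+ 2) + K * (P + A) * (2 * P ^+ 2 + 4 * A ^+ 2)).
have B0 : 0 <= B.
  by rewrite /B !addr_ge0// !mulr_ge0// !addr_ge0// ?mulr_ge0 ?sqr_ge0.
apply: (superjet_intro _ s'0 B0).
  by rewrite linearD/= !linearZ/= sX trmx_mul trmxK.
move=> w w0; rewrite !lt_min => /and3P[w1 w2 w3] /and3P[w4 w5 w6].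
have := gP w w0 w1 w4.
set y := w.1 - z.1 in w1 w2 w3 *; set dt := w.2 - z.2 in w4 w5 w6 *.
have Y0 : 0 <= enorm y := enorm_ge0 y.
have G0 : 0 <= gauge w z := gauge_ge0 w z.
set err := g w - _ - _ => errP.
pose d := g w - g z.
pose h := tau * dt + 2^-1 * dotp (y *m X) y + err.
have dE : d = dotp p y + h.
  by rewrite /h /err /d /quadratic -/y -/dt; ring.
have Lb : `|dotp p y| <= P * enorm y := abs_dotp_le p y.
have GE : gauge w z = `|dt| + enorm y ^+ 2 by [].
have YY : enorm y ^+ 2 <= enorm y by rewrite expr2 ler_piMr// ltW.
have hb : `|h| <= A * gauge w z.
  rewrite /h /A mulrDl; apply: le_trans (ler_normD _ _) _; apply: lerD.
    rewrite mulrDl; apply: le_trans (ler_normD _ _) _; apply: lerD.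
      by rewrite normrM GE ler_wpM2l// lerDl sqr_ge0.
    by apply: le_trans (CXP y) _; rewrite GE ler_wpM2l// lerDr.
  apply: le_trans errP _; rewrite (_ : 2 * C * gauge w z = C * (2 * gauge w z)); last by ring.
  apply: ler_wpM2l => //; apply: ler_wpM2r => //; lra.
have G2 : gauge w z <= `|dt| + enorm y by rewrite GE lerD2l.
have dr : `|d| < r.
  have t0 : 0 < r / (P + 2 * A + 1) by rewrite divr_gt0.
  have : `|d| <= (P + 2 * A) * (r / (P + 2 * A + 1)).
    rewrite dE (mulrDl P); apply: le_trans (ler_normD _ _) _; apply: lerD.
      by apply: le_trans Lb _; rewrite ler_wpM2l// ltW.
    set c := r / _ in t0 w3 w6 *.
    apply: le_trans hb _; rewrite (_ : 2 * A * c = A * (2 * c)); last by ring.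
    by apply: ler_wpM2l => //; apply: le_trans G2 _; move: w3 w6; clear; lra.
  move=> /le_lt_trans; apply.
  by rewrite mulrA ltr_pdivrMr// mulrC ltr_pM2l// ltrDl.
have := FP d dr; rewrite /d addrC subrK -/d => Fw.
have dt1 : 0 <= `|dt| <= 1 by rewrite normr_ge0/= ltW.
have y1 : 0 <= enorm y <= 1 by rewrite Y0/= ltW.
have key := @chain_estimate F1 F2 K P A _ _ d (dotp p y) h K0 P0 A0 dt1 y1 dE Lb hb.
have F1e : F1 * err <= `|F1| * C * ((`|dt| + enorm y) * gauge w z).
  apply: le_trans (ler_norm _) _; rewrite normrM -mulrA; exact: ler_wpM2l.
rewrite /quadratic -/y -/dt.
have -> : dotp (y *m (F1 *: X + F2 *: (p^T *m p))) y =
    F1 * dotp (y *m X) y + F2 * dotp p y ^+ 2.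
  by rewrite -quad_tensor !quad2 !mxE; ring.
have -> : dotp (F1 *: p) y = F1 * dotp p y by rewrite !dotp2 !mxE; ring.
have F1d : F1 * d = F1 * tau * dt + F1 * dotp p y + F1 * (2^-1 * dotp (y *m X) y) + F1 * err.
  by rewrite dE /h; ring.
rewrite GE -/y -/dt /B in key F1e Fw *.
move: Fw; rewrite F1d mulrDl.
move: key F1e; rewrite -/dt -/y.
clear.
move: (`|F1| * C) (`|F2| * _ + _) (_ * (`|dt| + _)) => a1 a2 a3.
move: (2^-1 * F2 * d ^+ 2) (K * `|d| ^+ 3) (dotp p y) (dotp _ y) => a4 a5 a6 a7.
move: (F (g w)) (F (g z)) => a8 a9; lra.
Qed.

Lemma superjet_time l z : superjet (fun w : V * R => l * w.2) z 0 0 l.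
Proof.
apply: (superjet_intro _ ltr01 (lexx 0)); first by rewrite trmx0.
move=> w _ _ _; rewrite /quadratic dotp2 quad2 !mxE; lra.
Qed.

Lemma expands_coord i z : expands (fun w : V * R => w.1 0 i) z (delta_mx 0 i) 0 0.
Proof.
split; first by rewrite trmx0.
exists 0, 1; split=> // w _ _ _; rewrite /quadratic dotp2 quad2 !mxE !mul0r normr_le0.
by elim/ord2 : i; rewrite /= !(mul0r, mulr0, mul1r, add0r, addr0) subrr.
Qed.

Lemma expands_sqnorm z :
  expands (fun w : V * R => enorm w.1 ^+ 2) z (2 *: z.1) (2 *: 1%:M) 0.
Proof.
split; first by rewrite linearZ/= trmx1.
exists 0, 1; split=> // w _ _ _; rewrite /quadratic dotp2 quad2 !enorm_sqr !mxE /= !mul0r.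
by rewrite normr_le0; apply/eqP; field.
Qed.

(** * Comparison with test functions, and the source *)

Lemma lsc_atD u v z : lsc_at u z -> lsc_at v z -> lsc_at (fun w => u w + v w) z.
Proof.
move=> uz vz e e0; have e20 : 0 < e / 2 by lra.
have [r r0 rP] := uz _ e20; have [s s0 sP] := vz _ e20.
exists (Num.min r s); first by rewrite lt_min r0.
move=> w w0; rewrite !lt_min => /andP[w1 w2] /andP[w3 w4].
have := rP w w0 w1 w3; have := sP w w0 w2 w4.
move: (u w) (v w) (u z) (v z) => a1 a2 a3 a4; lra.
Qed.

Lemma lsc_atZ u z m : 0 <= m -> lsc_at u z -> lsc_at (fun w => m * u w) z.
Proof.
move=> m0 uz e e0; have e20 : 0 < e / (m + 1) by rewrite divr_gt0//; lra.
have [r r0 rP] := uz _ e20; exists r => // w w0 w1 w2.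
have h : m * (e / (m + 1)) < e by rewrite mulrA ltr_pdivrMr; [nra|lra].
have := ler_wpM2l m0 (ltW (rP w w0 w1 w2)); rewrite mulrBr.
move: h; move: (u w) (u z) (e / _) => a1 a2 a3; lra.
Qed.

Lemma lsc_at_time l z : lsc_at (fun w => l * w.2) z.
Proof.
move=> e e0; exists (e / (`|l| + 1)); first by rewrite divr_gt0// ltr_wpDl.
move=> w w0 _; rewrite ltr_pdivlMr ?ltr_wpDl// => h.
have h1 : `|l * (w.2 - z.2)| <= `|w.2 - z.2| * (`|l| + 1).
  by rewrite normrM mulrC ler_wpM2l// lerDl.
have := le_lt_trans h1 h; rewrite ltr_norml => /andP[+ _]; rewrite mulrBr; lra.
Qed.

Lemma lsc_at_comp (F : R -> R) g z p X tau L r : expands g z p X tau ->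
  0 < r -> 0 <= L -> (forall a, `|a| < r -> F (g z) - L * `|a| <= F (g z + a)) ->
  lsc_at (fun w => F (g w)) z.
Proof.
move=> [sX [C [s [C0 s0 gP]]]] r0 L0 FP e e0.
have [CX CX0 CXP] := abs_quad_le X.
pose A := `|tau| + enorm p + CX + 2 * C.
have A0 : 0 <= A by rewrite /A !addr_ge0 ?enorm_ge0// mulr_ge0.
pose k := Num.min r (e / (L + 1)).
have L1 : 0 < L + 1 by rewrite ltr_wpDl.
have k0 : 0 < k by rewrite lt_min r0 divr_gt0.
have A1 : 0 < 2 * A + 1 by rewrite ltr_wpDl// mulr_ge0.
exists (Num.min s (Num.min 1 (k / (2 * A + 1)))).
  by rewrite !lt_min s0 ltr01 divr_gt0.
move=> w w0; rewrite !lt_min => /and3P[w1 w2 w3] /and3P[w4 w5 w6].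
have := gP w w0 w1 w4; set y := w.1 - z.1 in w1 w2 w3 *.
set dt := w.2 - z.2 in w4 w5 w6 * => h.
have Y0 := enorm_ge0 y.
have Y2 : enorm y ^+ 2 <= enorm y by rewrite expr2 ler_piMr// ltW.
have D0 : 0 <= `|dt| + enorm y by rewrite addr_ge0.
have G1 : gauge w z <= `|dt| + enorm y by rewrite lerD2l.
have DG : (`|dt| + enorm y) * gauge w z <= 2 * (`|dt| + enorm y).
  rewrite mulrC; apply: ler_wpM2r => //; apply: le_trans G1 _.
  by move: w2 w5; clear; lra.
have dk : `|g w - g z| < k.
  apply: (@le_lt_trans _ _ (A * (`|dt| + enorm y))); last first.
    have : `|dt| + enorm y < 2 * (k / (2 * A + 1)).
      by move: w3 w6; move: (k / _) => kk; lra.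
    move=> /ltW/(ler_wpM2l A0)/le_lt_trans; apply.
    rewrite (_ : A * (2 * _) = (2 * A) * k / (2 * A + 1)); last by ring.
    by rewrite ltr_pdivrMr// mulrC ltr_pM2l// ltrDl.
  rewrite -(subrK (quadratic z p X tau w) (g w - g z)).
  apply: le_trans (ler_normD _ _) _.
  have h1 : `|quadratic z p X tau w| <= (`|tau| + enorm p + CX) * (`|dt| + enorm y).
    rewrite /quadratic -/y -/dt 2!mulrDl; apply: le_trans (ler_normD _ _) _; apply: lerD.
      apply: le_trans (ler_normD _ _) _; apply: lerD.
        by rewrite normrM ler_wpM2l// lerDl.
      by apply: le_trans (abs_dotp_le _ _) _; rewrite ler_wpM2l ?enorm_ge0// lerDr.
    apply: le_trans (CXP y) _; rewrite ler_wpM2l//.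
    by apply: le_trans Y2 _; rewrite lerDr.
  have h2 := le_trans h (ler_wpM2l C0 DG).
  rewrite addrC /A; apply: le_trans (lerD h1 h2) _.
  by rewrite (mulrDl _ (2 * C)) lerD2l mulrA (mulrC C).
move: dk; rewrite lt_min => /andP[dr de].
have := FP _ dr; rewrite (_ : g z + (g w - g z) = g w); last by ring.
move=> hF.
have : L * `|g w - g z| < e.
  move: de; rewrite ltr_pdivlMr//; move: (normr_ge0 (g w - g z)).
  by move: (`|_|) => n0; nra.
move: hF; move: (F (g w)) (F (g z)) (L * _) => a1 a2 a3; lra.
Qed.

(** If the envelope exceeded [psi] somewhere, [touching] would give it a jet of
    [psi], up to a larger time derivative, in contradiction with the strict
    inequality at that jet. *)
Lemma subsol_le f u psi : visc_subsol f (fun=> 0) u ->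
  compactly_supported_in_space u ->
  (forall z, 0 <= z.2 -> lsc_at psi z) -> (forall x, 0 <= psi (x, 0)) ->
  nonneg_far psi ->
  (forall z, 0 < z.2 -> exists p X tau, superjet psi z p X tau /\
      usc_env setT f z.1 < tau + Ham_lower p X) ->
  forall x t, 0 <= t -> usc_env Q u (x, t) <= psi (x, t).
Proof.
move=> [bu u0 uP] cu lpsi psi0 psif psiP x t t0; rewrite leNgt; apply/negP => lt.
have [z [z0 zP]] := touching bu cu lpsi (fun x => le_trans (u0 x) (psi0 x)) psif t0 lt.
have [p [X [tau [jpsi strict]]]] := psiP z z0.
have [tau' tt jz] := zP _ _ _ jpsi.
case: z z0 jz strict {zP jpsi} => zx zt /= z0 jz strict.
have := uP _ _ z0 _ _ _ jz.
move: strict tt; move: (Ham_lower _ _) (usc_env _ _ _) => a1 a2; lra.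
Qed.

Lemma compactly_supportedN u : compactly_supported_in_space u ->
  compactly_supported_in_space (fun w => - u w).
Proof.
by move=> cu T /cu[r r0 rP]; exists r => // x t xr tT; rewrite rP ?oppr0.
Qed.

(** The argument of [subsol_le] for [- u], with [- psi] as the lower bound. *)
Lemma supersol_ge f u psi : visc_supersol f (fun=> 0) u ->
  compactly_supported_in_space u ->
  (forall z, 0 <= z.2 -> lsc_at psi z) -> (forall x, 0 <= psi (x, 0)) ->
  nonneg_far psi ->
  (forall z, 0 < z.2 -> exists p X tau, superjet psi z p X tau /\
      - tau + Ham_upper (- p) (- X) < lsc_env setT f z.1) ->
  forall x t, 0 <= t -> - psi (x, t) <= lsc_env Q u (x, t).
Proof.
move=> [bu u0 uP] cu lpsi psi0 psif psiP x t t0; rewrite lsc_envE lerN2.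
rewrite leNgt; apply/negP => lt.
have bNu := locally_boundedN bu.
have init y : usc_env Q (fun w => - u w) (y, 0) <= psi (y, 0).
  by apply: le_trans (psi0 y); have := u0 y; rewrite lsc_envE oppr_ge0.
have [z [z0 zP]] := touching bNu (compactly_supportedN cu) lpsi init psif t0 lt.
have [p [X [tau [jpsi strict]]]] := psiP z z0.
have [tau' tt jz] := zP _ _ _ jpsi.
case: z z0 jz strict {zP jpsi} => zx zt /= z0 jz strict.
have jz' : subjet (lsc_env Q u) (zx, zt) (- p) (- X) (- tau').
  rewrite /subjet !opprK.
  have -> : (fun w => - lsc_env Q u w) = usc_env Q (fun w => - u w).
    by apply/funext => w; rewrite lsc_envE opprK.
  exact: jz.
have := uP _ _ z0 _ _ _ jz'; move: strict tt.
by move: (Ham_upper _ _) (lsc_env _ _ _) => a1 a2; lra.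
Qed.

Definition source c d : V -> R := fun x => c * \1_(square d) x.

Lemma source_in c d x : (forall i, `|x 0 i| <= d) -> source c d x = c.
Proof. by move=> xd; rewrite /source indicE mem_set// mulr1. Qed.

Lemma source_out c d x i : d < `|x 0 i| -> source c d x = 0.
Proof.
move=> xd; rewrite /source indicE memNset ?mulr0// => /(_ i).
by rewrite leNgt xd.
Qed.

Lemma source_ge0 c d x : 0 <= c -> 0 <= source c d x.
Proof. by move=> c0; rewrite mulr_ge0. Qed.

Lemma source_le c d x : 0 <= c -> source c d x <= c.
Proof. by move=> c0; rewrite /source ler_piMr// indicE; case: (_ \in _). Qed.

Lemma source_bounded c d x : 0 <= c ->
  bounded_near (source c d : V -> R^o) (within setT (nbhs x)).
Proof.
move=> c0; have FF := nbhs_setT_proper x; apply/ex_bound.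
exists c; apply/near_setTP; exists 1 => // y _ /=.
by rewrite ger0_norm ?source_ge0// source_le.
Qed.

Lemma source_usc_le c d x : 0 <= c -> usc_env setT (source c d) x <= c.
Proof.
move=> c0; apply: usc_setT_le; first exact: source_bounded.
by exists 1 => // y _; exact: source_le.
Qed.

Lemma source_usc_out c d x i : 0 <= c -> d < `|x 0 i| ->
  usc_env setT (source c d) x <= 0.
Proof.
move=> c0 xd; apply: usc_setT_le; first exact: source_bounded.
exists (`|x 0 i| - d); first by rewrite subr_gt0.
move=> y yx; rewrite (@source_out c d y i)//.
have := coord_le_enorm (y - x) i; rewrite !mxE => h.
have := ler_normB (y 0 i) (y 0 i - x 0 i); rewrite opprB addrC subrK.
move: h yx; move: (`|_|) (`|_|) (`|_|) (enorm _) => a1 a2 a3 a4; lra.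
Qed.

Lemma source_lsc_ge0 c d x : 0 <= c -> 0 <= lsc_env setT (source c d) x.
Proof.
move=> c0; rewrite lsc_envE oppr_ge0; have FF := nbhs_setT_proper x.
apply: usc_setT_le; first by apply: bounded_nearN; exact: source_bounded.
by exists 1 => // y _; rewrite oppr_le0 source_ge0.
Qed.

Lemma source_lsc_in c d x : 0 <= c -> (forall i, `|x 0 i| < d) ->
  c <= lsc_env setT (source c d) x.
Proof.
move=> c0 xd; rewrite lsc_envE lerNr; have FF := nbhs_setT_proper x.
apply: usc_setT_le; first by apply: bounded_nearN; exact: source_bounded.
exists (Num.min (d - `|x 0 0|) (d - `|x 0 1|)).
  by rewrite lt_min !subr_gt0 !xd.
move=> y; rewrite lt_min => /andP[y0 y1]; rewrite source_in// => i.
have h (j : 'I_2) : enorm (y - x) < d - `|x 0 j| -> `|y 0 j| <= d.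
  move=> yj; rewrite -(subrK (x 0 j) (y 0 j)); apply: le_trans (ler_normD _ _) _.
  have := coord_le_enorm (y - x) j; rewrite !mxE.
  by move: yj; move: (`|_|) (`|_|) (enorm _) => a1 a2 a3; lra.
by elim/ord2 : i; exact: h.
Qed.

Lemma source_lsc_usc c d x : 0 <= c -> source c d x <= usc_env setT (source c d) x.
Proof. by move=> c0; apply: usc_setT_ge; exact: source_bounded. Qed.

(** * Radial test functions *)

Lemma le_sqr a b : 0 <= a -> a <= b -> a ^+ 2 <= b ^+ 2.
Proof. by move=> a0 ab; rewrite !expr2 ler_pM. Qed.

Lemma Ham_lower00 : 0 <= Ham_lower (0 : V) 0.
Proof.
have e0 : (0 : R)%:M = 0 :> M2 by apply/matrixP => i j; rewrite !mxE mul0rn.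
by have := Ham_lower_scalar (0 : R); rewrite e0 oppr0.
Qed.

Lemma Ham_upper00 : Ham_upper (0 : V) 0 <= 0.
Proof.
have e0 : (0 : R)%:M = 0 :> M2 by apply/matrixP => i j; rewrite !mxE mul0rn.
by have := Ham_upper_scalar (0 : R); rewrite e0 oppr0.
Qed.

Lemma subsol_le_time c d u : 0 < c -> visc_subsol (source c d) (fun=> 0) u ->
  compactly_supported_in_space u ->
  forall x t, 0 <= t -> usc_env Q u (x, t) <= c * t.
Proof.
move=> c0 su cu x t t0; apply/ler_addgt0Pr => e e0.
have t10 : 0 < t + 1 by rewrite ltr_wpDl.
apply: (@le_trans _ _ ((c + e / (t + 1)) * t)); last first.
  by rewrite mulrDl lerD2l mulrAC ler_pdivrMr// ler_pM2l// lerDl.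
have e10 : 0 < e / (t + 1) by rewrite divr_gt0.
apply: (subsol_le (psi := fun w => (c + e / (t + 1)) * w.2) su cu) => //.
- by move=> z _; exact: lsc_at_time.
- by move=> y /=; rewrite mulr0.
- move=> T T0; exists 0 => y s _ /andP[s0 _] /=; rewrite mulr_ge0// addr_ge0 ?ltW//.
move=> z z0; exists 0, 0, (c + e / (t + 1)); split; first exact: superjet_time.
apply: le_lt_trans (source_usc_le d z.1 (ltW c0)) _.
have := Ham_lower00; move: (Ham_lower _ _) => h; lra.
Qed.

Lemma supersol_ge0 c d u : 0 < c -> visc_supersol (source c d) (fun=> 0) u ->
  compactly_supported_in_space u ->
  forall x t, 0 <= t -> 0 <= lsc_env Q u (x, t).
Proof.
move=> c0 su cu x t t0; apply/ler_addgt0Pr => e e0; rewrite -lerBlDr sub0r.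
have t10 : 0 < t + 1 by rewrite ltr_wpDl.
apply: (@le_trans _ _ (- (e / (t + 1) * t))).
  by rewrite lerN2 mulrAC ler_pdivrMr// ler_pM2l// lerDl.
have e10 : 0 < e / (t + 1) by rewrite divr_gt0.
apply: (supersol_ge (psi := fun w => e / (t + 1) * w.2) su cu) => //.
- by move=> z _; exact: lsc_at_time.
- by move=> y /=; rewrite mulr0.
- move=> T T0; exists 0 => y s _ /andP[s0 _] /=; by apply: mulr_ge0 => //; exact: ltW.
move=> z z0; exists 0, 0, (e / (t + 1)); split; first exact: superjet_time.
apply: lt_le_trans (source_lsc_ge0 d z.1 (ltW c0)).
rewrite !oppr0; have := Ham_upper00; move: (Ham_upper _ _) => h; lra.
Qed.

Lemma tensor_sym q X m l : X^T = X ->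
  (m *: X + l *: (q^T *m q))^T = m *: X + l *: (q^T *m q).
Proof. by move=> sX; rewrite linearD/= !linearZ/= sX trmx_mul trmxK. Qed.

(** The equation is geometric: a change of the values of a function adds to its
    Hessian a multiple of the tensor square of the gradient, which the projection
    [sigma] annihilates. *)
Lemma trsigma_comp q X m l : q != 0 -> m != 0 ->
  \tr (sigma (m *: q) *m (m *: X + l *: (q^T *m q))) = m * \tr (sigma q *m X).
Proof.
move=> q0 m0; have mq0 : m *: q != 0 by rewrite scaler_eq0 negb_or m0.
rewrite !trsigma2// !mxE !big_ord1 !mxE.
have /lt0r_neq0 := enorm_gt0 q0; have /lt0r_neq0 := enorm_gt0 mq0.
rewrite !mxE => h1 h2; field; rewrite h2/=; exact: h1.
Qed.

Lemma enormZ m q : 0 <= m -> enorm (m *: q) = m * enorm q.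
Proof.
move=> m0; rewrite /enorm !dotp2 !mxE.
rewrite (_ : _ + _ = m ^+ 2 * (q 0 0 * q 0 0 + q 0 1 * q 0 1)); last by ring.
by rewrite sqrtrM ?sqr_ge0// sqrtr_sqr ger0_norm.
Qed.

(** The cube makes the barrier of class C^2 across the boundary of its support. *)
Definition cube_pos s := Num.max 0 s ^+ 3.

Lemma cube_pos_expand s d : cube_pos (s + d) <=
  cube_pos s + 3 * Num.max 0 s ^+ 2 * d + 2^-1 * (6 * Num.max 0 s) * d ^+ 2
  + 1 * `|d| ^+ 3.
Proof.
rewrite /cube_pos.
have d3 : d ^+ 3 <= `|d| ^+ 3 by rewrite -normrX ler_norm.
have nd3 : - d ^+ 3 <= `|d| ^+ 3 by rewrite -normrX -normrN ler_norm.
case: (lerP 0 s) => s0; case: (lerP 0 (s + d)) => sd0; rewrite ?expr0n/=.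
- by rewrite (_ : (s + d) ^+ 3 = s ^+ 3 + 3 * s ^+ 2 * d + 3 * s * d ^+ 2 + d ^+ 3);
    [lra|ring].
- have ds : 0 <= - s - d by lra.
  have nd : d < 0 by lra.
  rewrite (ltr0_norm nd); have : 0 <= s * (s + d) ^+ 2 by rewrite mulr_ge0// sqr_ge0.
  have h1 : 0 <= - d * (s ^+ 2) by rewrite mulr_ge0 ?sqr_ge0//; lra.
  have h2 : s ^+ 3 <= (- d) ^+ 3 by rewrite ler_pXn2r ?nnegrE//; lra.
  have h3 : 0 <= s ^+ 3 by rewrite exprn_ge0.
  have h4 : - (s + d) ^+ 3 <= (- d) ^+ 3.
    rewrite (_ : - (s + d) ^+ 3 = (- s - d) ^+ 3); last by ring.
    by rewrite ler_pXn2r ?nnegrE//; lra.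
  by move=> _; move: h4; rewrite (_ : - (s + d) ^+ 3 =
    - s ^+ 3 - 3 * s ^+ 2 * d - 3 * s * d ^+ 2 + (- d) ^+ 3); [lra|ring].
- have d0 : 0 <= d by lra.
  rewrite (ger0_norm d0); have : (s + d) ^+ 3 <= d ^+ 3.
    by rewrite ler_pXn2r ?nnegrE//; lra.
  lra.
- have : 0 <= `|d| ^+ 3 by rewrite exprn_ge0.
  lra.
Qed.

Lemma cube_pos_convex s d : cube_pos s + 3 * Num.max 0 s ^+ 2 * d <= cube_pos (s + d).
Proof.
rewrite /cube_pos.
case: (lerP 0 s) => s0; case: (lerP 0 (s + d)) => sd0; rewrite ?expr0n/=.
- have : 0 <= (3 * s + d) * d ^+ 2 by rewrite mulr_ge0 ?sqr_ge0//; lra.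
  rewrite (_ : (s + d) ^+ 3 = s ^+ 3 + 3 * s ^+ 2 * d + (3 * s + d) * d ^+ 2); last by ring.
  lra.
- have : s ^+ 2 * (s + d) <= 0 by rewrite mulr_ge0_le0 ?sqr_ge0// ltW.
  have : 0 <= s ^+ 3 by rewrite exprn_ge0.
  rewrite (_ : s ^+ 2 * (s + d) = s ^+ 3 + s ^+ 2 * d); last by ring.
  lra.
- by rewrite mulr0 mul0r add0r exprn_ge0.
- by rewrite mulr0 mul0r addr0.
Qed.

Lemma expands_paraboloid b s z : expands (fun w => (b + s * w.2) ^+ 2 - enorm w.1 ^+ 2) z
  (- 2 *: z.1) (- 2 *: 1%:M) (2 * s * (b + s * z.2)).
Proof.
split; first by rewrite linearZ/= trmx1.
exists (s ^+ 2), 1; split; [exact: sqr_ge0|exact: ltr01|] => w _ _ _.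
rewrite /quadratic dotp2 quad2 !enorm_sqr !mxE /=.
set h := (X in `|X|); have -> : h = s ^+ 2 * `|w.2 - z.2| ^+ 2.
  by rewrite real_normK ?num_real// /h; field.
rewrite ger0_norm; last by apply: mulr_ge0; [exact: sqr_ge0|exact: exprn_ge0].
apply: ler_wpM2l; first exact: sqr_ge0.
by rewrite expr2; apply: ler_pM => //; rewrite lerDl ?enorm_ge0// sqr_ge0.
Qed.

Lemma square_sqnorm d x : (forall i, `|x 0 i| <= d) -> enorm x ^+ 2 <= 2 * d ^+ 2.
Proof.
move=> xd; rewrite enorm_sqr -(real_normK (num_real (x 0 0))) -(real_normK (num_real (x 0 1))).
have h i : `|x 0 i| ^+ 2 <= d ^+ 2 by exact: le_sqr.
by have := h 0; have := h 1; move: (_ ^+ 2) (_ ^+ 2) (d ^+ 2) => a1 a2 a3; lra.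
Qed.

(** At radius [r = |x|] the barrier satisfies the equation with the margin
    [s (b + s t) + 1 - r] times a positive factor: the first term is the expansion
    of its support, the others come from circles moving with velocity [1 - 1/r].
    On the support this margin is at least [k], and since the square is strictly
    inside the support, a large [M] makes it beat the source.  With [s = 0] and
    [b < 1] the barrier is stationary; with [s = 1] every [b] is allowed, and the
    barrier confines all subsolutions to the same expanding ball. *)
Lemma subsol_le_barrier c d b s k u : 0 < c -> 0 < k -> 0 < b -> 0 <= s -> 0 < d ->
  2 * d ^+ 2 < b ^+ 2 ->
  (forall t, 0 <= t -> k <= s * (b + s * t) + 1 - (b + s * t)) ->
  visc_subsol (source c d) (fun=> 0) u -> compactly_supported_in_space u ->
  exists2 M, 0 <= M & forall x t, 0 <= t ->
    usc_env Q u (x, t) <= M * cube_pos ((b + s * t) ^+ 2 - enorm x ^+ 2).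
Proof.
move=> c0 k0 b0 s0 d0 db kP su cu.
have g0 : 0 < b ^+ 2 - 2 * d ^+ 2 by rewrite subr_gt0.
have [M M0 ME] : exists2 M, 0 < M & 6 * M * (b ^+ 2 - 2 * d ^+ 2) ^+ 2 * k = c.
  have den0 : 0 < 6 * (b ^+ 2 - 2 * d ^+ 2) ^+ 2 * k.
    by rewrite mulr_gt0// mulr_gt0// exprn_gt0.
  exists (c / (6 * (b ^+ 2 - 2 * d ^+ 2) ^+ 2 * k)); first by rewrite divr_gt0.
  by field; rewrite !gt_eqF.
exists M; first exact: ltW.
move=> x t t0; apply/ler_addgt0Pr => e e0.
have t10 : 0 < t + 1 by rewrite ltr_wpDl.
(* the term of slope e1 in time makes the inequality strict off the support *)
have e10 : 0 < e / (t + 1) by rewrite divr_gt0.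
set e1 := e / (t + 1) in e10.
pose B w : R := (b + s * w.2) ^+ 2 - enorm w.1 ^+ 2.
apply: (@le_trans _ _ (e1 * t + M * cube_pos (B (x, t)))); last first.
  by rewrite addrC lerD2l /e1 mulrAC ler_pdivrMr// ler_pM2l// lerDl.
have cp0 a : 0 <= cube_pos a by rewrite exprn_ge0// le_max lexx.
apply: (subsol_le (psi := fun w => e1 * w.2 + M * cube_pos (B w)) su cu) => //.
- move=> z _; apply: lsc_atD; first exact: lsc_at_time.
  apply: lsc_atZ; first exact: ltW.
  apply: (lsc_at_comp (L := 3 * Num.max 0 (B z) ^+ 2) (expands_paraboloid b s z) ltr01).
    by rewrite mulr_ge0// sqr_ge0.
  move=> a _; apply: le_trans (cube_pos_convex _ _); rewrite lerD2l -mulrN.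
  apply: ler_wpM2l; first by rewrite mulr_ge0// sqr_ge0.
  by rewrite lerNl -normrN ler_norm.
- by move=> y /=; rewrite mulr0 add0r mulr_ge0// ltW.
- by move=> T T0; exists 0 => y r _ /andP[r0 _] /=; rewrite addr_ge0// mulr_ge0// ltW.
move=> z z0.
pose G := Num.max 0 (B z).
have jc := superjet_comp (expands_paraboloid b s z) ltr01 ler01
  (fun d _ => cube_pos_expand _ d).
have jt := superjetD (superjet_time e1 z) (superjetZ (ltW M0) jc).
do 3 eexists; split; first exact: jt.
rewrite !add0r scalerDr !(scalerA M) -/(B z) -/G {jc jt}.
have G0 : 0 <= G by rewrite le_max lexx.
set F1 := M * (3 * G ^+ 2).
have F10 : 0 <= F1 by rewrite !mulr_ge0 ?sqr_ge0// ltW.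
have bt0 : 0 < b + s * z.2 by rewrite ltr_wpDr// mulr_ge0// ltW.
have Hl : 2 * F1 * (1 - enorm z.1) <= Ham_lower (F1 *: (- 2 *: z.1))
   (F1 *: (- 2 *: 1%:M) + (M * (6 * G)) *: ((- 2 *: z.1)^T *m (- 2 *: z.1))).
  have sX : (F1 *: (- 2 *: 1%:M) + (M * (6 * G)) *: ((- 2 *: z.1)^T *m (- 2 *: z.1)))^T =
    F1 *: (- 2 *: 1%:M) + (M * (6 * G)) *: ((- 2 *: z.1)^T *m (- 2 *: z.1)) :> M2.
    by apply: tensor_sym; rewrite linearZ/= trmx1.
  have [x0|x0] := eqVneq z.1 0.
    rewrite x0 !scaler0 mulmx0 scaler0 addr0 enorm0 subr0 mulr1 scalerA scalemx1.
    by apply: le_trans (Ham_lower_scalar _); rewrite mulrN opprK mulrC.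
  have [F1e|F1n] := eqVneq F1 0.
    have Ge : G = 0.
      apply/eqP; rewrite -sqrf_eq0; move/eqP: F1e.
      by rewrite /F1 2!mulf_eq0 (gt_eqF M0) pnatr_eq0.
    rewrite F1e Ge !mulr0 !scale0r addr0 mul0r; exact: Ham_lower00.
  apply: le_trans (Ham_lower_ge_Ham sX _).
    have q0 : - 2 *: z.1 != 0 by rewrite scaler_eq0 negb_or x0 oppr_eq0 pnatr_eq0.
    rewrite /Ham/= trsigma_comp// scalemx1 trsigma2_scalar//.
    rewrite enormZ// scaleNr enormN enormZ//.
    by rewrite mulrN opprK; lra.
  by rewrite scaler_eq0 negb_or F1n/= scaler_eq0 negb_or x0 oppr_eq0 pnatr_eq0.
set H := Ham_lower _ _ in Hl *.
suff key : usc_env setT (source c d) z.1 < e1 + 2 * F1 * (s * (b + s * z.2) + 1 - enorm z.1).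
  apply: lt_le_trans key _; rewrite -[leRHS]addrA lerD2l.
  apply: le_trans (lerD (lexx _) Hl); rewrite /F1 le_eqVlt; apply/orP; left.
  by apply/eqP; ring.
have [zB|zB] := leP (enorm z.1) (b + s * z.2).
  have kz := kP _ (ltW z0).
  have h1 : F1 * k <= F1 * (s * (b + s * z.2) + 1 - enorm z.1).
    by apply: ler_wpM2l => //; apply: le_trans kz _; rewrite lerD2l lerN2.
  have [ins|/existsNP[i /negP]] := pselect (forall i, `|z.1 0 i| <= d); last first.
    rewrite -ltNge => out; apply: le_lt_trans (source_usc_out (ltW c0) out) _.
    rewrite ltr_pwDl// -mulrA mulr_ge0//; apply: le_trans h1.
    by rewrite mulr_ge0// ltW.
  apply: le_lt_trans (source_usc_le d z.1 (ltW c0)) _.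
  have zd := square_sqnorm ins.
  have Gg : b ^+ 2 - 2 * d ^+ 2 <= G.
    apply: (@le_trans _ _ (B z)); last by rewrite le_max lexx orbT.
    apply: lerB zd; apply: le_sqr; first exact: ltW.
    by rewrite lerDl mulr_ge0// ltW.
  have Gg2 : (b ^+ 2 - 2 * d ^+ 2) ^+ 2 <= G ^+ 2.
    by apply: le_sqr Gg; exact: ltW.
  have h2 : c <= 2 * (F1 * k).
    rewrite -ME /F1 (_ : 2 * _ = 6 * M * G ^+ 2 * k); last by ring.
    by apply: ler_wpM2r; [exact: ltW|apply: ler_wpM2l => //; rewrite mulr_ge0// ltW].
  rewrite -mulrA; move: h1 h2 e10; clear.
  by move: (F1 * k) (F1 * (_ - _)) => a1 a2; lra.
have Ge : G = 0.
  apply/max_idPl; rewrite subr_le0; apply: le_sqr; exact: ltW.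
have F1e : F1 = 0 by rewrite /F1 Ge expr0n/= !mulr0.
rewrite F1e mulr0 mul0r addr0; apply: le_lt_trans e10.
have [ins|/existsNP[i /negP]] := pselect (forall i, `|z.1 0 i| <= d); last first.
  by rewrite -ltNge => out; exact: (source_usc_out (ltW c0) out).
exfalso; have zd := square_sqnorm ins.
have : b ^+ 2 <= enorm z.1 ^+ 2.
  apply: le_sqr; first exact: ltW.
  by apply: le_trans (ltW zB); rewrite lerDl mulr_ge0// ltW.
by move=> /le_trans/(_ zd); rewrite leNgt db.
Qed.

(** Where [|x| < 1] the level circles shrink, which costs at most [2 k < e]; where
    [|x| > 1] they expand.  Outside the square [|x|] is at least [d > 1], and the
    steep penalty beyond the radius [sqrt s], with [1 < s < d^2], makes the gain
    from that expansion replace the missing source. *)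
Lemma supersol_ge_radial c d u e : 0 < c -> 1 < d -> 0 < e ->
  visc_supersol (source c d) (fun=> 0) u -> compactly_supported_in_space u ->
  exists k M s, [/\ 0 <= k, 0 <= M & forall x t, 0 <= t ->
    (c - e) * t - (k * enorm x ^+ 2 + M * Num.max 0 (enorm x ^+ 2 - s) ^+ 2)
      <= lsc_env Q u (x, t)].
Proof.
move=> c0 d1 e0 su cu.
have [k k0 ke] : exists2 k, 0 < k & 4 * k = e.
  by exists (e / 4); [rewrite divr_gt0|field].
have dd : 1 < d ^+ 2 by rewrite exprn_egt1.
have [s s1 sd] : exists2 s, 1 < s & s < d ^+ 2.
  by exists ((1 + d ^+ 2) / 2); lra.
rewrite -subr_gt0 in sd.
have d10 : 0 < d - 1 by rewrite subr_gt0.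
(* at |x| = d the steep penalty then gains exactly c *)
have [M M0 ME] : exists2 M, 0 < M & 4 * M * (d ^+ 2 - s) * (d - 1) = c.
  have den0 : 0 < 4 * (d ^+ 2 - s) * (d - 1) by rewrite !mulr_gt0.
  exists (c / (4 * (d ^+ 2 - s) * (d - 1))); first by rewrite divr_gt0.
  by field; rewrite !gt_eqF.
exists k, M, s; split; [exact: ltW|exact: ltW|] => x t t0.
pose F a : R := k * a + M * Num.max 0 (a - s) ^+ 2.
pose psi w : R := - (c - e) * w.2 + F (enorm w.1 ^+ 2).
have F0 a : 0 <= a -> 0 <= F a.
  by move=> a0; rewrite addr_ge0// mulr_ge0 ?sqr_ge0// ltW.
have -> : (c - e) * t - (k * enorm x ^+ 2 + M * Num.max 0 (enorm x ^+ 2 - s) ^+ 2) =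
  - psi (x, t) by rewrite /psi /F/=; ring.
apply: (supersol_ge su cu) => //.
- move=> z _; apply: lsc_atD; first exact: lsc_at_time.
  pose L := k + 2 * M * Num.max 0 (enorm z.1 ^+ 2 - s).
  have m0 : 0 <= Num.max 0 (enorm z.1 ^+ 2 - s) by rewrite le_max lexx.
  have L0 : 0 <= L by rewrite addr_ge0 ?mulr_ge0// ltW.
  apply: (lsc_at_comp (F := F) (expands_sqnorm z) ltr01 L0) => a _.
  have h : F (enorm z.1 ^+ 2) + L * a <= F (enorm z.1 ^+ 2 + a).
    rewrite /F /L; set N := enorm z.1 ^+ 2.
    have : Num.max 0 (N - s) ^+ 2 + 2 * Num.max 0 (N - s) * a <= Num.max 0 (N + a - s) ^+ 2.
      case: (lerP 0 (N - s)) => h1; case: (lerP 0 (N + a - s)) => h2; rewrite ?expr0n/=.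
      - have := sqr_ge0 a.
        by rewrite (_ : (N + a - s) ^+ 2 = (N - s) ^+ 2 + 2 * (N - s) * a + a ^+ 2); [lra|ring].
      - have : (N - s) * (N + a - s) <= 0 by rewrite mulr_ge0_le0// ltW.
        have := sqr_ge0 (N - s); rewrite (_ : (N - s) * (N + a - s) = (N - s) ^+ 2 + (N - s) * a);
          [lra|ring].
      - by rewrite mulr0 mul0r addr0 sqr_ge0.
      - by rewrite mulr0 mul0r addr0.
    move=> /(ler_wpM2l (ltW M0)); move: (Num.max _ _) (Num.max _ _) => a1 a2; lra.
  apply: le_trans h; rewrite lerD2l -mulrN; apply: ler_wpM2l => //.
  by rewrite lerNl -normrN ler_norm.
- by move=> y; rewrite /psi/= mulr0 add0r F0// exprn_ge0// enorm_ge0.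
- move=> T T0; exists (`|c - e| * T / k + 1) => y r yr /andP[r0 rT]; rewrite /psi/=.
  have h1 : `|c - e| * T / k <= enorm y ^+ 2.
    have A0 : 0 <= `|c - e| * T / k by rewrite !mulr_ge0 ?invr_ge0// ltW.
    move: A0 yr; move: (_ / k) (enorm y) => a1 a2; nra.
  have h2 : (c - e) * r <= k * enorm y ^+ 2.
    apply: (@le_trans _ _ (`|c - e| * T)).
      by apply: le_trans (ler_norm _) _; rewrite normrM (ger0_norm r0) ler_wpM2l.
    by rewrite (mulrC k) -ler_pdivrMr.
  rewrite /F mulNr addrA addr_ge0//; first by rewrite addrC subr_ge0.
  by rewrite mulr_ge0 ?sqr_ge0// ltW.
move=> z z0.
pose G := Num.max 0 (enorm z.1 ^+ 2 - s).
have G0 : 0 <= G by rewrite le_max lexx.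
pose F1 := k + 2 * M * G.
have F10 : 0 < F1 by rewrite ltr_wpDr// !mulr_ge0// ltW.
have FP a : `|a| < 1 -> F (enorm z.1 ^+ 2 + a) <=
    F (enorm z.1 ^+ 2) + F1 * a + 2^-1 * (2 * M) * a ^+ 2 + 0 * `|a| ^+ 3.
  move=> _; rewrite mul0r addr0 /F /F1 /G; set N := enorm z.1 ^+ 2.
  have := ler_wpM2l (ltW M0) (pos_part_sqr (N - s) a).
  rewrite (_ : N - s + a = N + a - s); last by ring.
  move: (Num.max _ _) (Num.max _ _) => a1 a2; lra.
have jc := superjet_comp (expands_sqnorm z) ltr01 (lexx 0) FP.
have jt := superjetD (superjet_time (- (c - e)) z) jc.
do 3 eexists; split; first exact: jt.
rewrite !add0r mulr0 addr0 opprK {jc jt}.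
have Hu : Ham_upper (- (F1 *: (2 *: z.1)))
    (- (F1 *: (2 *: 1%:M) + (2 * M) *: ((2 *: z.1)^T *m (2 *: z.1))))
    <= 2 * F1 * (1 - enorm z.1).
  have sX : (- (F1 *: (2 *: 1%:M) + (2 * M) *: ((2 *: z.1)^T *m (2 *: z.1))))^T =
    - (F1 *: (2 *: 1%:M) + (2 * M) *: ((2 *: z.1)^T *m (2 *: z.1))) :> M2.
    by rewrite linearN/= tensor_sym// linearZ/= trmx1.
  have [x0|x0] := eqVneq z.1 0.
    rewrite x0 !scaler0 mulmx0 scaler0 addr0 enorm0 subr0 mulr1 scalerA scalemx1 oppr0.
    have -> : - (F1 * 2)%:M = (- (F1 * 2))%:M :> M2.
      by apply/matrixP => i j; rewrite !mxE mulNrn.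
    have := Ham_upper_scalar (- (F1 * 2)); rewrite opprK (mulrC F1).
    exact.
  have q0 : 2 *: z.1 != 0 by rewrite scaler_eq0 negb_or x0 pnatr_eq0.
  rewrite -scaleNr opprD -!scaleNr in sX *.
  have F1n : - F1 != 0 by rewrite oppr_eq0 gt_eqF.
  apply: le_trans (Ham_upper_le_Ham sX _) _; first by rewrite scaler_eq0 negb_or F1n.
  rewrite /Ham/= trsigma_comp// scalemx1 trsigma2_scalar//.
  rewrite scaleNr enormN enormZ; last exact: ltW.
  rewrite enormZ//.
  by rewrite le_eqVlt; apply/orP; left; apply/eqP; ring.
apply: le_lt_trans (lerD (lexx (c - e)) Hu) _.
have [ins|/existsNP[i /negP]] := pselect (forall i, `|z.1 0 i| < d).
  apply: lt_le_trans (source_lsc_in (ltW c0) ins).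
  suff : 2 * F1 * (1 - enorm z.1) < e by lra.
  have [z1|z1] := leP 1 (enorm z.1).
    apply: le_lt_trans e0; rewrite mulr_ge0_le0 ?subr_le0// mulr_ge0// ltW//.
  have Ge : G = 0.
    apply/max_idPl; rewrite subr_le0; apply: le_trans (ltW s1).
    by rewrite expr_le1 ?enorm_ge0// ltW.
  rewrite /F1 Ge mulr0 addr0; have := enorm_ge0 z.1; move: k0 ke z1; clear.
  by move: (enorm _) => a1; nra.
rewrite -leNgt => out; apply: lt_le_trans (source_lsc_ge0 d z.1 (ltW c0)).
have zd : d <= enorm z.1 by apply: le_trans out _; exact: coord_le_enorm.
have zd2 : d ^+ 2 <= enorm z.1 ^+ 2 by apply: le_sqr => //; lra.
have Gd : d ^+ 2 - s <= G.
  apply: (@le_trans _ _ (enorm z.1 ^+ 2 - s)); first by rewrite lerD2r.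
  by rewrite le_max lexx orbT.
have h1 : 2 * M * (d ^+ 2 - s) <= F1.
  rewrite /F1; apply: (@le_trans _ _ (2 * M * G)); last by rewrite lerDr ltW.
  by apply: ler_wpM2l => //; rewrite mulr_ge0// ltW.
have h2 : 2 * M * (d ^+ 2 - s) * (d - 1) <= F1 * (enorm z.1 - 1).
  by apply: ler_pM => //; rewrite ?lerD2r// ?mulr_ge0 ?ltW.
move: h2; rewrite -(@ler_pM2l _ 2)// (_ : 2 * (_ * (d - 1)) = c); last by rewrite -ME; ring.
by move: e0; clear; move: (enorm _) => a1; lra.
Qed.

End test_functions.

(** * A convex profile made of an arc and its tangents *)

Section arch_profile.
Variable R : realType.
Variables rho a : R.
Hypotheses (a0 : 0 < a) (arho : a < rho).
Implicit Types (s y d K r : R).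

Definition semicircle s := Num.sqrt (rho ^+ 2 - s ^+ 2).
Definition slope s := s / semicircle s.
(** Second derivative of [- semicircle], as [slope] is its first derivative. *)
Definition curv s := rho ^+ 2 / semicircle s ^+ 3.
Definition clamp y := Num.max (- a) (Num.min a y).
(** The lower arc of the circle of radius [rho] over [[-a, a]], continued by its
    tangents at both ends. *)
Definition arch y := slope (clamp y) * (y - clamp y) - semicircle (clamp y).

Lemma rho_gt0 : 0 < rho. Proof. exact: lt_trans arho. Qed.

Lemma lt_rho s : `|s| <= a -> `|s| < rho.
Proof. by move=> sa; exact: le_lt_trans arho. Qed.

Lemma sqr_lt_rho s : `|s| < rho -> 0 < rho ^+ 2 - s ^+ 2.
Proof.
have := normr_ge0 s; rewrite -[s ^+ 2]real_normK ?num_real//.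
by move: (`|s|) => n; have := rho_gt0; nra.
Qed.

Lemma semicircle_gt0 s : `|s| < rho -> 0 < semicircle s.
Proof. by move=> /sqr_lt_rho h; rewrite sqrtr_gt0. Qed.

Lemma sqr_semicircle s : `|s| < rho -> semicircle s ^+ 2 = rho ^+ 2 - s ^+ 2.
Proof. by move=> /sqr_lt_rho/ltW h; rewrite sqr_sqrtr. Qed.

Lemma semicircle_le s : semicircle s <= rho.
Proof.
rewrite -[leRHS](gtr0_norm rho_gt0) -sqrtr_sqr.
by apply: ler_wsqrtr; rewrite gerBl sqr_ge0.
Qed.

Lemma semicircle_ge s : `|s| <= a -> semicircle a <= semicircle s.
Proof.
move=> sa; rewrite ler_sqrt ?lerD2l ?lerN2.
  by rewrite -[s ^+ 2]real_normK ?num_real//; exact: le_sqr.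
by apply/ltW/sqr_lt_rho; exact: lt_rho.
Qed.

Lemma norm_a : `|a| <= a. Proof. by rewrite gtr0_norm. Qed.

Lemma clampP y : [\/ `|y| <= a /\ clamp y = y, a < y /\ clamp y = a
  | y < - a /\ clamp y = - a].
Proof.
have Na : - a <= a by have := a0; lra.
rewrite /clamp; have [ya|ya] := leP a y.
  move: ya; rewrite le_eqVlt => /orP[/eqP<-|ya].
    by constructor 1; split; [exact: norm_a|exact/max_idPr].
  by constructor 2; split=> //; exact/max_idPr.
have [ya'|ya'] := leP (- a) y.
  by constructor 1; split=> //; rewrite ler_norml ya' ltW.
by constructor 3.
Qed.

Lemma clamp_le y : `|clamp y| <= a.
Proof. by case: (clampP y) => -[h ->]//; rewrite ?normrN norm_a. Qed.

Lemma clamp_id y : `|y| <= a -> clamp y = y.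
Proof.
move=> ya; case: (clampP y) => -[h ->]//; exfalso; move: ya; rewrite ler_norml; lra.
Qed.

Lemma semicircleN s : semicircle (- s) = semicircle s.
Proof. by rewrite /semicircle sqrrN. Qed.

Lemma slopeN s : slope (- s) = - slope s.
Proof. by rewrite /slope semicircleN mulNr. Qed.

Lemma slope_sqr s : `|s| < rho -> 1 + slope s ^+ 2 = (rho / semicircle s) ^+ 2.
Proof.
move=> sr; have h := semicircle_gt0 sr; rewrite /slope !expr_div_n sqr_semicircle//.
by field; rewrite gt_eqF//; exact: sqr_lt_rho.
Qed.

Lemma slope_norm s : `|s| < rho -> Num.sqrt (1 + slope s ^+ 2) = rho / semicircle s.
Proof.
move=> sr; rewrite slope_sqr// sqrtr_sqr ger0_norm// divr_ge0//.
  by rewrite ltW// rho_gt0.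
by rewrite ltW// semicircle_gt0.
Qed.

Lemma slope_le s : `|s| <= a -> `|slope s| <= slope a.
Proof.
move=> sa; rewrite /slope normrM normfV (gtr0_norm (semicircle_gt0 (lt_rho sa))).
apply: ler_pM => //; first by rewrite invr_ge0 ltW// semicircle_gt0// lt_rho.
rewrite lef_pV2 ?posrE; first exact: semicircle_ge.
  exact: semicircle_gt0 (lt_rho sa).
exact: semicircle_gt0 (lt_rho norm_a).
Qed.

Lemma slope_a_ge0 : 0 <= slope a.
Proof. by apply: le_trans (slope_le norm_a). Qed.

(** Cauchy-Schwarz for the vectors [(s, semicircle s)] and [(y, semicircle y)], both
    of length [rho]. *)
Lemma tangent_le_circle s y : `|s| < rho -> `|y| < rho ->
  slope s * (y - s) - semicircle s <= - semicircle y.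
Proof.
move=> sr yr; have S0 := semicircle_gt0 sr; have Y0 := semicircle_gt0 yr.
have S2 := sqr_semicircle sr; have Y2 := sqr_semicircle yr.
have -> : slope s * (y - s) - semicircle s = (s * y - rho ^+ 2) / semicircle s.
  by rewrite (_ : s * y - rho ^+ 2 = s * (y - s) - semicircle s ^+ 2);
    [rewrite /slope; field; rewrite gt_eqF|rewrite S2; ring].
rewrite ler_pdivrMr// mulNr lerNr opprB.
have sy : 0 <= rho ^+ 2 - s * y.
  have := sqr_lt_rho sr; have := sqr_lt_rho yr; have := sqr_ge0 (s - y); nra.
apply: le_of_sqr => //; rewrite exprMn S2 Y2.
by have := mulr_ge0 (sqr_ge0 rho) (sqr_ge0 (s - y)); lra.
Qed.

Lemma arch_circle y : `|y| <= a -> arch y = - semicircle y.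
Proof. by move=> ya; rewrite /arch clamp_id// subrr mulr0 add0r. Qed.

Lemma arch_le_circle y : `|y| < rho -> arch y <= - semicircle y.
Proof. by move=> yr; apply: tangent_le_circle => //; exact/lt_rho/clamp_le. Qed.

Lemma tangent_le_arch s y : `|s| <= a -> slope s * (y - s) - semicircle s <= arch y.
Proof.
move=> sa; have := slope_le sa; rewrite ler_norml => /andP[sl1 sl2].
rewrite /arch; case: (clampP y) => -[ya ->].
- by rewrite subrr mulr0 add0r; apply: tangent_le_circle; exact: lt_rho.
- have := tangent_le_circle (lt_rho sa) (lt_rho norm_a).
  have : slope s * (y - a) <= slope a * (y - a).
    by apply: ler_wpM2r => //; rewrite subr_ge0 ltW.
  by move: (semicircle s) (semicircle a) => b1 b2; lra.
- have Na : `|- a| <= a by rewrite normrN norm_a.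
  have := tangent_le_circle (lt_rho sa) (lt_rho Na).
  rewrite slopeN semicircleN.
  have : 0 <= (slope s + slope a) * (- a - y) by rewrite mulr_ge0//; lra.
  by move: (semicircle s) (semicircle a) => b1 b2; lra.
Qed.

Lemma arch_convex y z : arch y + slope (clamp y) * (z - y) <= arch z.
Proof. by have := tangent_le_arch z (clamp_le y); rewrite {2}/arch; lra. Qed.

Lemma arch_lip y z : arch y - slope a * `|z - y| <= arch z.
Proof.
apply: le_trans (arch_convex y z); rewrite lerD2l lerNl.
apply: le_trans (ler_norm _) _; rewrite normrN normrM; apply: ler_wpM2r => //.
exact: slope_le (clamp_le y).
Qed.

Lemma arch_le y : arch y <= slope a * `|y|.
Proof.
have := arch_lip y 0; rewrite sub0r normrN => h.
have : arch 0 <= 0 by rewrite arch_circle ?normr0 ?oppr_le0 ?sqrtr_ge0// ltW.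
by move: h; move: (arch _) (arch _) (_ * _) => b1 b2 b3; lra.
Qed.

Lemma arch_ge y : - rho <= arch y.
Proof.
have z0 : `|0 : R| <= a by rewrite normr0 ltW.
have := tangent_le_arch y z0; rewrite /slope mul0r mul0r add0r.
by apply: le_trans; rewrite lerN2; exact: semicircle_le.
Qed.

(** The arc has curvature [rho^-1] everywhere. *)
Lemma curvE s : `|s| < rho -> curv s =
  (1 + slope s ^+ 2) * Num.sqrt (1 + slope s ^+ 2) / rho.
Proof.
move=> sr; rewrite slope_norm// slope_sqr// /curv; field.
by rewrite !gt_eqF// ?rho_gt0// semicircle_gt0.
Qed.

Lemma curv_ge0 s : 0 <= curv s.
Proof. by rewrite divr_ge0 ?sqr_ge0// exprn_ge0// sqrtr_ge0. Qed.

Lemma curv_le s : `|s| <= a -> curv s <= curv a.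
Proof.
move=> sa; have h1 := semicircle_gt0 (lt_rho sa).
have h2 := semicircle_gt0 (lt_rho norm_a).
rewrite /curv ler_wpM2l ?sqr_ge0// lef_pV2 ?posrE ?exprn_gt0//.
by rewrite ler_pXn2r ?nnegrE ?semicircle_ge// ltW.
Qed.

Lemma semicircle_taylor y : `|y| < rho -> exists K r, [/\ 0 <= K, 0 < r &
  forall d, `|d| < r -> `|- semicircle (y + d) - (- semicircle y + slope y * d
    + 2^-1 * curv y * d ^+ 2)| <= K * `|d| ^+ 3].
Proof.
move=> yr; have S0 := semicircle_gt0 yr; have S2 := sqr_semicircle yr.
set S := semicircle y in S0 S2.
pose L := (2 * rho + 1) / S.
have L0 : 0 <= L by rewrite divr_ge0 ?ltW// addr_gt0// mulr_gt0// rho_gt0.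
pose K := (4 * rho + 1) / (8 * S ^+ 3) + L ^+ 3 / (2 * S ^+ 2) + L ^+ 4 / (8 * S ^+ 3).
exists K, (Num.min 1 (rho - `|y|)); split.
- have h1 n : 0 <= 8 * S ^+ n by rewrite mulr_ge0// exprn_ge0// ltW.
  have h2 n : 0 <= 2 * S ^+ n by rewrite mulr_ge0// exprn_ge0// ltW.
  have h3 n : 0 <= L ^+ n by exact: exprn_ge0.
  have h4 : 0 <= 4 * rho + 1 by have := rho_gt0; lra.
  by apply: addr_ge0; [apply: addr_ge0|]; exact: divr_ge0.
- by rewrite lt_min ltr01 subr_gt0.
move=> d; rewrite lt_min => /andP[d1 d2].
have ydr : `|y + d| < rho by apply: le_lt_trans (ler_normD _ _) _; lra.
have T0 := semicircle_gt0 ydr; have T2 := sqr_semicircle ydr.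
set T := semicircle (y + d) in T0 T2 *.
pose h := T - S.
have Sn0 : S != 0 by rewrite gt_eqF.
have hE : h * (T + S) = - 2 * y * d - d ^+ 2.
  by rewrite /h (_ : (T - S) * (T + S) = T ^+ 2 - S ^+ 2); [rewrite T2 S2; ring|ring].
have hL : `|h| <= L * `|d|.
  rewrite /L mulrAC ler_pdivlMr//.
  apply: (@le_trans _ _ (`|h * (T + S)|)).
    rewrite normrM ler_wpM2l// ger0_norm; last by rewrite addr_ge0// ltW.
    by rewrite lerDr ltW.
  rewrite hE (_ : - 2 * y * d - d ^+ 2 = (- 2 * y - d) * d); last by ring.
  rewrite normrM; apply: ler_wpM2r => //; apply: le_trans (ler_normB _ _) _.
  by rewrite normrM normrN normr_nat; move: yr d1; clear; lra.
have -> : - T - (- S + slope y * d + 2^-1 * curv y * d ^+ 2) =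
   (4 * y + d) / (8 * S ^+ 3) * d ^+ 3 - h ^+ 3 / (2 * S ^+ 2) - h ^+ 4 / (8 * S ^+ 3).
  have r2 : rho ^+ 2 = S ^+ 2 + y ^+ 2 by rewrite S2; ring.
  have TE : T = S + h by rewrite /h; ring.
  have WE : h ^+ 2 + 2 * S * h = - 2 * y * d - d ^+ 2 by rewrite -hE TE; ring.
  rewrite /slope /curv -/S r2 TE; clearbody h; clearbody S.
  move: WE Sn0; clear; move=> WE Sn0.
  have key : h - h ^+ 3 / (2 * S ^+ 2) - h ^+ 4 / (8 * S ^+ 3) =
    (- 2 * y * d - d ^+ 2) / (2 * S) - (- 2 * y * d - d ^+ 2) ^+ 2 / (8 * S ^+ 3).
    by rewrite -WE; field.
  apply/eqP; rewrite -subr_eq0; apply/eqP.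
  transitivity ((- 2 * y * d - d ^+ 2) / (2 * S)
    - (- 2 * y * d - d ^+ 2) ^+ 2 / (8 * S ^+ 3)
    - (h - h ^+ 3 / (2 * S ^+ 2) - h ^+ 4 / (8 * S ^+ 3))); last by rewrite key subrr.
  by field.
have S30 : 0 < 8 * S ^+ 3 by rewrite mulr_gt0// exprn_gt0.
have S20 : 0 < 2 * S ^+ 2 by rewrite mulr_gt0// exprn_gt0.
rewrite /K 2!(mulrDl _ _ (`|d| ^+ 3)); apply: le_trans (ler_normB _ _) _; apply: lerD.
  apply: le_trans (ler_normB _ _) _; apply: lerD.
    rewrite normrM [`|_ / _|]normrM normfV (gtr0_norm S30) [`|d ^+ 3|]normrX.
    rewrite -mulrA -[leRHS]mulrA.
    apply: ler_wpM2r; first by rewrite mulr_ge0 ?exprn_ge0// invr_ge0 ltW.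
    apply: le_trans (ler_normD _ _) _; rewrite normrM normr_nat.
    by move: yr d1; clear; lra.
  rewrite normrM [`|h ^+ 3|]normrX normfV (gtr0_norm S20) [leRHS]mulrAC; apply: ler_wpM2r.
    by rewrite invr_ge0 ltW.
  by rewrite -exprMn ler_pXn2r ?nnegrE// mulr_ge0.
rewrite normrM [`|h ^+ 4|]normrX normfV (gtr0_norm S30) [leRHS]mulrAC; apply: ler_wpM2r.
  by rewrite invr_ge0 ltW.
apply: (@le_trans _ _ ((L * `|d|) ^+ 4)); first by rewrite ler_pXn2r ?nnegrE// mulr_ge0.
rewrite exprMn; apply: ler_wpM2l; first exact: exprn_ge0.
by rewrite (exprS _ 3) ler_piMl ?exprn_ge0// ltW.
Qed.

Definition curv_outer y := if `|y| <= a then curv y else 0.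
Definition curv_inner y := if `|y| < a then curv y else 0.

(** At the junctions [|y| = a] the second derivative jumps from that of the arc
    to 0; the larger value serves for expansions from above. *)
Lemma arch_upper y : exists K r, [/\ 0 <= K, 0 < r & forall d, `|d| < r ->
  arch (y + d) <= arch y + slope (clamp y) * d + 2^-1 * curv_outer y * d ^+ 2
    + K * `|d| ^+ 3].
Proof.
rewrite /curv_outer; case: (leP (`|y|) a) => ya.
  have [K [r [K0 r0 rP]]] := semicircle_taylor (lt_rho ya).
  exists K, (Num.min r (rho - `|y|)); split=> //.
    by rewrite lt_min r0 subr_gt0 lt_rho.
  move=> d; rewrite lt_min => /andP[d1 d2].
  have ydr : `|y + d| < rho by apply: le_lt_trans (ler_normD _ _) _; lra.
  apply: le_trans (arch_le_circle ydr) _; rewrite clamp_id// arch_circle//.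
  have := rP d d1; rewrite ler_norml => /andP[_].
  by move: (semicircle _) (semicircle _) (K * _) => b1 b2 b3; lra.
exists 0, (`|y| - a); split=> //; first by rewrite subr_gt0.
move=> d dy; rewrite mulr0 !mul0r !addr0 /arch.
case: (clampP y) => -[ya' ->].
- by move: ya; rewrite ltNge ya'.
- case: (clampP (y + d)) => -[yd ->].
  + exfalso; have y0 : 0 <= y by apply: le_trans (ltW ya'); exact: ltW.
    move: dy yd; rewrite (ger0_norm y0) ler_norml ltr_norml; lra.
  + lra.
  + exfalso; have y0 : 0 <= y by apply: le_trans (ltW ya'); exact: ltW.
    by move: dy a0; rewrite (ger0_norm y0) ltr_norml; lra.
- have y0 : y < 0 by have := a0; lra.
  move: dy; rewrite (ltr0_norm y0) ltr_norml => /andP[dy1 dy2].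
  case: (clampP (y + d)) => -[yd ->].
  + by exfalso; move: yd; rewrite ler_norml; lra.
  + by exfalso; have := a0; lra.
  + lra.
Qed.

(** From below, the arc can be replaced near [y] by a smooth function [q] that
    touches it: the arc itself, or at the junctions the tangent line.  A two-sided
    expansion of [q] is what composition needs. *)
Lemma arch_lower_model y : exists q : R -> R, q y = arch y /\
  exists K r, [/\ 0 <= K, 0 < r & forall d, `|d| < r -> q (y + d) <= arch (y + d) /\
  `|q (y + d) - (q y + slope (clamp y) * d + 2^-1 * curv_inner y * d ^+ 2)|
     <= K * `|d| ^+ 3].
Proof.
rewrite /curv_inner; case: (ltP (`|y|) a) => ya.
  exists (fun y => - semicircle y); rewrite arch_circle 1?ltW//; split=> //.
  have [K [r [K0 r0 rP]]] := semicircle_taylor (lt_rho (ltW ya)).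
  exists K, (Num.min r (a - `|y|)); split=> //; first by rewrite lt_min r0 subr_gt0.
  move=> d; rewrite lt_min => /andP[d1 d2]; split.
    by rewrite arch_circle//; apply: le_trans (ler_normD _ _) _; lra.
  by rewrite clamp_id ?rP// ltW.
exists (fun z => arch y + slope (clamp y) * (z - y)); split; first by rewrite subrr mulr0 addr0.
exists 0, 1; split=> // d _; split; first exact: arch_convex.
rewrite mul0r normr_le0 subrr !mulr0 mul0r !addr0.
by rewrite (_ : y + d - y = d) ?subrr//; ring.
Qed.

Lemma curv_outer_le y : curv_outer y <=
  (1 + slope (clamp y) ^+ 2) * Num.sqrt (1 + slope (clamp y) ^+ 2) / rho.
Proof.
rewrite /curv_outer; case: ifPn => [ya|_]; last first.
  by rewrite divr_ge0 ?mulr_ge0 ?sqrtr_ge0 ?addr_ge0 ?sqr_ge0// ltW// rho_gt0.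
by rewrite clamp_id// curvE// lt_rho.
Qed.

Lemma curv_outer_bound y : 0 <= curv_outer y <= curv a.
Proof.
rewrite /curv_outer; case: ifPn => [ya|_]; first by rewrite curv_ge0 curv_le.
by rewrite lexx curv_ge0.
Qed.

End arch_profile.

(** * Separable and sliding test functions *)

Section evolution.
Variable R : realType.
Local Notation V := 'rV[R]_2.
Local Notation M2 := 'M[R]_2.
Local Notation Q := (spacetime R 2).
Implicit Types (p q x y : V) (X Y Z : M2) (a b c d e r s k l m t C K M tau eta : R).
Implicit Types (g u v psi : V * R -> R) (z w : V * R) (f : V -> R).

Lemma enorm_vec2 a b : enorm (vec2 a b) = Num.sqrt (a ^+ 2 + b ^+ 2).
Proof. by rewrite /enorm dotp2 !vec2E -!expr2. Qed.

Lemma vec2_neq0 a b : (vec2 a b != 0) = (a ^+ 2 + b ^+ 2 != 0).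
Proof.
rewrite -enorm_eq0 -(@eqrXn2 _ 2%N) ?enorm_ge0// enorm_sqr !vec2E expr0n//.
Qed.

Lemma Ham_vec2 a b k l : vec2 a b != 0 -> Ham (vec2 a b, mat2 k 0 l) =
  - ((b ^+ 2 * k + a ^+ 2 * l) / (a ^+ 2 + b ^+ 2)) - Num.sqrt (a ^+ 2 + b ^+ 2).
Proof.
move=> ab0; rewrite /Ham/= enorm_vec2 trsigma2// !vec2E !mat2E.
by congr (- (_ / _) - _); ring.
Qed.

Lemma expands_lincomb u v z p q X Y tau l a b : expands u z p X tau ->
  expands v z q Y l ->
  expands (fun w => a * u w + b * v w) z (a *: p + b *: q) (a *: X + b *: Y)
    (a * tau + b * l).
Proof.
move=> [sX [C [r [C0 r0 uP]]]] [sY [D [s [D0 s0 vP]]]].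
split; first by rewrite linearD/= !linearZ/= sX sY.
exists (`|a| * C + `|b| * D), (Num.min r s); split.
- by rewrite addr_ge0// mulr_ge0.
- by rewrite lt_min r0.
move=> w w0; rewrite !lt_min => /andP[w1 w2] /andP[w3 w4].
have h1 := ler_wpM2l (normr_ge0 a) (uP w w0 w1 w3).
have h2 := ler_wpM2l (normr_ge0 b) (vP w w0 w2 w4).
rewrite -normrM in h1; rewrite -normrM in h2.
rewrite mulrDl -[in leRHS]mulrA -[X in _ <= _ + X]mulrA.
apply: le_trans (lerD h1 h2); apply: le_trans (ler_normD _ _).
rewrite le_eqVlt; apply/orP; left; apply/eqP; congr (`|_|).
by rewrite /quadratic !quad2 !dotp2 !mxE; ring.
Qed.

Lemma expands_comp_coord (F : R -> R) i z F1 F2 K r : 0 <= K -> 0 < r ->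
  (forall d, `|d| < r ->
    `|F (z.1 0 i + d) - (F (z.1 0 i) + F1 * d + 2^-1 * F2 * d ^+ 2)| <= K * `|d| ^+ 3) ->
  expands (fun w => F (w.1 0 i)) z (F1 *: delta_mx 0 i)
    (F2 *: ((delta_mx 0 i : V)^T *m (delta_mx 0 i : V))) 0.
Proof.
move=> K0 r0 FP; split; first by rewrite linearZ/= trmx_mul trmxK.
exists K, r; split=> // w w0 w1 _.
have wi : `|w.1 0 i - z.1 0 i| <= enorm (w.1 - z.1).
  by have := coord_le_enorm (w.1 - z.1) i; rewrite !mxE.
have := FP _ (le_lt_trans wi w1); rewrite (addrC (z.1 0 i)) subrK => h.
have dE : dotp (delta_mx 0 i) (w.1 - z.1) = w.1 0 i - z.1 0 i.
  by rewrite dotp2 !mxE; elim/ord2 : i {r0 FP wi h} => /=; ring.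
have -> : F (w.1 0 i) - F (z.1 0 i) - quadratic z (F1 *: delta_mx 0 i)
    (F2 *: ((delta_mx 0 i : V)^T *m (delta_mx 0 i : V))) 0 w =
  F (w.1 0 i) - (F (z.1 0 i) + F1 * (w.1 0 i - z.1 0 i)
    + 2^-1 * F2 * (w.1 0 i - z.1 0 i) ^+ 2).
  rewrite /quadratic mul0r add0r -dE -scalemxAr.
  have -> : dotp (F2 *: ((w.1 - z.1) *m ((delta_mx 0 i : V)^T *m (delta_mx 0 i : V))))
    (w.1 - z.1) = F2 * dotp (delta_mx 0 i) (w.1 - z.1) ^+ 2.
    by rewrite -quad_tensor !dotp2 !mxE; ring.
  have -> : dotp (F1 *: delta_mx 0 i) (w.1 - z.1) = F1 * dotp (delta_mx 0 i) (w.1 - z.1).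
    by rewrite !dotp2 !mxE; ring.
  ring.
apply: le_trans h _; apply: ler_wpM2l => //.
have Y0 := enorm_ge0 (w.1 - z.1); have G0 := gauge_ge0 w z.
rewrite (exprS _ 2); apply: ler_pM => //.
  by apply: le_trans wi _; rewrite lerDr.
apply: (@le_trans _ _ (enorm (w.1 - z.1) ^+ 2)); last by rewrite lerDr.
exact: le_sqr.
Qed.

Lemma delta_tensor i : (delta_mx 0 i : V)^T *m (delta_mx 0 i : V) =
  if i == 0 then mat2 1 0 0 else mat2 0 0 1.
Proof.
apply/matrixP => j k; rewrite !mxE big_ord1 !mxE.
by elim/ord2 : i; rewrite /= !mxE; elim/ord2 : j; elim/ord2 : k => /=; ring.
Qed.

(** The projected trace is a weighted mean of the two diagonal entries; at a
    critical point the entries agree, and the matrix is scalar. *)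
Lemma Ham_upper_bound p k l C : 0 <= k <= C -> 0 <= l <= C ->
  (p = 0 -> k = l) -> Ham_upper (- p) (- mat2 k 0 l) <= C.
Proof.
move=> /andP[k0 kC] /andP[l0 lC] pkl.
have sX : (- mat2 k 0 l)^T = - mat2 k 0 l :> M2 by rewrite linearN/= mat2_sym.
have [p0|p0] := eqVneq p 0.
  rewrite p0 oppr0 (pkl p0).
  have -> : - mat2 l 0 l = (- l)%:M :> M2.
    by apply/matrixP => i j; rewrite !mxE; elim/ord2 : i; elim/ord2 : j => /=;
      rewrite ?mulr1n ?mulr0n ?oppr0.
  by apply: le_trans (Ham_upper_scalar _) _; rewrite opprK.
have np0 : - p != 0 by rewrite oppr_eq0.
apply: le_trans (Ham_upper_le_Ham sX np0) _.
rewrite /Ham/= mulmxN linearN/= opprK trsigma2// !mat2E.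
have s0 := enorm_gt0 np0.
apply: (@le_trans _ _ C); last by [].
rewrite lerBlDr; apply: le_trans (_ : C <= _); last by rewrite lerDl enorm_ge0.
rewrite ler_pdivrMr// addr0 mulr0 subr0.
set A := _ ^+ 2; set B := _ ^+ 2.
have A0 : 0 <= A := sqr_ge0 _; have B0 : 0 <= B := sqr_ge0 _.
have := ler_wpM2l A0 kC; have := ler_wpM2l B0 lC; rewrite mulrDr (mulrC C) (mulrC C).
lra.
Qed.

(** A curvature at most [rho^-1] costs at most the fraction [rho^-1] of the norm of
    the gradient, and [rho > 1] leaves the rest as outward speed. *)
Lemma Ham_outside m h k rho : 0 < m -> 1 < rho -> 0 <= k ->
  k <= (1 + h ^+ 2) * Num.sqrt (1 + h ^+ 2) / rho ->
  m * k / (1 + h ^+ 2) - m * Num.sqrt (1 + h ^+ 2) <= - (m * (1 - rho^-1)).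
Proof.
move=> m0 rho1 k0 kP; have r0 : 0 < rho by apply: lt_trans rho1.
set W := Num.sqrt _ in kP *.
have W0 : 0 < 1 + h ^+ 2 by rewrite ltr_pwDl// sqr_ge0.
have W1 : 1 <= W by rewrite -[1]sqrtr1 ler_sqrt// ?lerDl ?sqr_ge0// ltW.
have h1 : m * k / (1 + h ^+ 2) <= m * (W / rho).
  rewrite ler_pdivrMr// -mulrA; apply: ler_wpM2l; first exact: ltW.
  by rewrite (_ : W / rho * _ = (1 + h ^+ 2) * W / rho)//; ring.
have rr : 0 < 1 - rho^-1 by rewrite subr_gt0 invf_lt1.
apply: le_trans (lerD h1 (lexx _)) _.
have -> : m * (W / rho) - m * W = - (m * (1 - rho^-1) * W) by ring.
by rewrite lerN2; apply: ler_peMr => //; rewrite mulr_ge0// ltW.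
Qed.

Lemma Ham_upper_separable m h0 h1 k0 k1 : 0 < m -> 0 < h0 ^+ 2 + h1 ^+ 2 ->
  Ham_upper (- vec2 (m * h0) (m * h1)) (- mat2 (m * k0) 0 (m * k1)) <=
  m * ((h1 ^+ 2 * k0 + h0 ^+ 2 * k1) / (h0 ^+ 2 + h1 ^+ 2))
  - m * Num.sqrt (h0 ^+ 2 + h1 ^+ 2).
Proof.
move=> m0 h0h1.
have -> : - mat2 (m * k0) 0 (m * k1) = mat2 (- (m * k0)) 0 (- (m * k1)) :> M2.
  by apply/matrixP => i' j; elim/ord2 : i'; elim/ord2 : j; rewrite !mxE /= ?oppr0.
have -> : - vec2 (m * h0) (m * h1) = vec2 (- (m * h0)) (- (m * h1)) :> V.
  by apply: rV2P; rewrite !mxE.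
have sq : (- (m * h0)) ^+ 2 + (- (m * h1)) ^+ 2 = m ^+ 2 * (h0 ^+ 2 + h1 ^+ 2) by ring.
have v0 : vec2 (- (m * h0)) (- (m * h1)) != 0.
  by rewrite vec2_neq0 sq gt_eqF// mulr_gt0// exprn_gt0.
apply: le_trans (Ham_upper_le_Ham (mat2_sym _ _ _) v0) _.
rewrite Ham_vec2// sq sqrtrM ?sqr_ge0// sqrtr_sqr gtr0_norm//.
rewrite le_eqVlt; apply/orP; left; apply/eqP; congr (_ - _).
by field; rewrite !gt_eqF.
Qed.

(** The profile is an arc of radius [rho = a sqrt 2 > 1] that reaches slope one
    at [a], with [a] strictly between [1 / sqrt 2] and [d].  Inside the square the
    curvature terms cost at most [m C], a quarter of the source.  Outside it, one
    of the coordinates is in the range where the profile is affine of slope one,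
    so that the level curves have curvature at most [rho^-1] and expand
    ([Ham_outside]). *)
Lemma supersol_ge_separable c d u : 0 < c -> 0 < d -> 1 < 2 * d ^+ 2 ->
  visc_supersol (source c d) (fun=> 0) u -> compactly_supported_in_space u ->
  exists alpha m a rho, [/\ 0 < alpha, 0 <= m, 0 < a < rho & forall x t, 0 <= t ->
    alpha * t - m * (arch rho a (x 0 0) + arch rho a (x 0 1) + 2 * rho)
      <= lsc_env Q u (x, t)].
Proof.
move=> c0 d0 dd su cu.
have [a [a0 ad aa]] : exists a, [/\ 0 < a, a < d & 1 < 2 * a ^+ 2].
  have s0 : 0 < Num.sqrt (2^-1 : R) by rewrite sqrtr_gt0 invr_gt0.
  have s2 : Num.sqrt (2^-1 : R) ^+ 2 = 2^-1 by rewrite sqr_sqrtr// invr_ge0.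
  have sd : Num.sqrt (2^-1 : R) < d.
    by rewrite ltNge; apply/negP => /(le_sqr (ltW d0)); rewrite s2; lra.
  exists ((Num.sqrt (2^-1) + d) / 2); split; [lra|lra|].
  by move: s0 s2 sd; move: (Num.sqrt _) => s; nra.
(* the circle of this radius has slope one at a *)
pose rho := Num.sqrt (2 * a ^+ 2).
have rho2 : rho ^+ 2 = 2 * a ^+ 2 by rewrite sqr_sqrtr// mulr_ge0// sqr_ge0.
have rho1 : 1 < rho.
  have : 0 <= rho by exact: sqrtr_ge0.
  by move: rho2 aa; move: rho => r; nra.
have arho : a < rho by move: rho2 rho1 a0; clear; move: rho => r; nra.
have r0 : 0 < rho by exact: lt_trans arho.
have rootA : semicircle rho a = a.
  rewrite /semicircle rho2 (_ : 2 * a ^+ 2 - a ^+ 2 = a ^+ 2); last by ring.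
  by rewrite sqrtr_sqr gtr0_norm.
have slopeA : slope rho a = 1 by rewrite /slope rootA divff// gt_eqF.
pose C := curv rho a.
have C0 : 0 < C by rewrite divr_gt0 ?exprn_gt0// rootA.
have [m m0 mC] : exists2 m, 0 < m & 4 * (m * C) = c.
  by exists (c / (4 * C)); [rewrite divr_gt0// mulr_gt0|field; rewrite gt_eqF].
have rr : 0 < 1 - rho^-1 by rewrite subr_gt0 invf_lt1.
have [alpha [al0 al1 al2]] : exists al, [/\ 0 < al, al < c / 2 & al < m * (1 - rho^-1)].
  have c20 : 0 < c / 2 by rewrite divr_gt0.
  have mr0 : 0 < m * (1 - rho^-1) by rewrite mulr_gt0.
  have [h|h] := leP (c / 2) (m * (1 - rho^-1)).
    by exists (c / 4); split; move: c20 h; move: (m * _) => b; lra.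
  by exists (m * (1 - rho^-1) / 2); split; move: mr0 h; move: (m * _) => b; lra.
exists alpha, m, a, rho; split=> //; [exact: ltW|by rewrite a0|] => x t t0.
pose F := arch rho a.
have F0 s : 0 <= F s + rho by have := arch_ge a0 arho s; rewrite /F; lra.
pose psi w : R := - alpha * w.2 + m * ((F (w.1 0 0) + F (w.1 0 1)) + 2 * rho).
have -> : alpha * t - m * (arch rho a (x 0 0) + arch rho a (x 0 1) + 2 * rho) =
  - psi (x, t) by rewrite /psi /F/=; ring.
have lscF i z : lsc_at (fun w => F (w.1 0 i)) z.
  apply: (lsc_at_comp (L := 1) (F := F) (expands_coord i z) ltr01) => //.
  move=> b _; have := arch_lip a0 arho (z.1 0 i) (z.1 0 i + b).
  by rewrite slopeA (addrC (z.1 0 i) b) addrK.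
apply: (supersol_ge su cu) => //.
- move=> z _; apply: lsc_atD; first exact: lsc_at_time.
  apply: lsc_atZ; first exact: ltW.
  apply: lsc_atD; first exact: lsc_atD.
  by move=> e e0; exists 1 => // w _ _ _; rewrite ltrBlDr ltrDl.
- move=> y; rewrite /psi/= mulr0 add0r mulr_ge0 ?(ltW m0)//.
  by have := F0 (y 0 0); have := F0 (y 0 1); lra.
- move=> T T0; exists (2 * (a + alpha * T / m)) => y r yr /andP[s0 sT]; rewrite /psi/=.
  have grow b : `|b| - a <= F b + rho.
    have h1 := tangent_le_arch a0 arho b (norm_a a0).
    have Na : `|- a| <= a by rewrite normrN norm_a.
    have h2 := tangent_le_arch a0 arho b Na.
    move: h1 h2; rewrite slopeN semicircleN slopeA rootA -/(F b) => h1 h2.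
    by have ra := ltW arho; case: (ger0P b) => ?; lra.
  have h1 : 2 * (alpha * T / m) <= 2 * (F (y 0 0) + F (y 0 1) + 2 * rho).
    have := enorm_le_coord y; have := grow (y 0 0); have := grow (y 0 1).
    have := F0 (y 0 0); have := F0 (y 0 1); move: yr.
    move: (_ / m) (enorm y) (F _) (F _) (`|_|) (`|_|) => b1 b2 b3 b4 b5 b6; lra.
  rewrite ler_pM2l// ler_pdivrMr// in h1.
  rewrite mulNr addrC subr_ge0 (mulrC m); apply: le_trans h1.
  by apply: ler_wpM2l; first exact: ltW.
move=> z z0.
have jF i : superjet (fun w => F (w.1 0 i)) z
  (slope rho (clamp a (z.1 0 i)) *: delta_mx 0 i)
  (slope rho (clamp a (z.1 0 i)) *: 0 + curv_outer rho a (z.1 0 i) *: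
     ((delta_mx 0 i : V)^T *m (delta_mx 0 i : V)))
  (slope rho (clamp a (z.1 0 i)) * 0).
  have [K [r [K0 rp FP]]] := arch_upper a0 arho (z.1 0 i).
  exact: superjet_comp (expands_coord i z) rp K0 FP.
set h0 := slope rho (clamp a (z.1 0 0)).
set h1 := slope rho (clamp a (z.1 0 1)).
set k0 := curv_outer rho a (z.1 0 0).
set k1 := curv_outer rho a (z.1 0 1).
have jc : superjet (fun=> 2 * rho) z 0 0 0.
  by apply: (superjet_le ltr01 _ (superjet_time 0 z)) => w *; rewrite !mul0r !subrr.
have jt := superjetD (superjet_time (- alpha) z)
  (superjetZ (ltW m0) (superjetD (superjetD (jF 0) (jF 1)) jc)).
exists (vec2 (m * h0) (m * h1)), (mat2 (m * k0) 0 (m * k1)), (- alpha); split.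
  move: jt; rewrite !delta_tensor /= !mulr0 !addr0 mulr0 addr0 -/h0 -/h1 -/k0 -/k1.
  have -> : 0 + m *: (h0 *: delta_mx 0 0 + h1 *: delta_mx 0 1) = vec2 (m * h0) (m * h1) :> V.
    by apply: rV2P; rewrite !mxE /=; ring.
  have -> : 0 + m *: (h0 *: 0 + k0 *: mat2 1 0 0 + (h1 *: 0 + k1 *: mat2 0 0 1)) =
    mat2 (m * k0) 0 (m * k1) :> M2.
    by apply/matrixP => i j; elim/ord2 : i; elim/ord2 : j; rewrite !mxE /=; ring.
  exact.
rewrite opprK.
have /andP[k00 k0C] := curv_outer_bound a0 arho (z.1 0 0).
have /andP[k10 k1C] := curv_outer_bound a0 arho (z.1 0 1).
rewrite -/k0 -/C in k00 k0C; rewrite -/k1 -/C in k10 k1C.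
have slope0 s : `|s| <= a -> slope rho s = 0 -> s = 0.
  move=> sa; rewrite /slope => /eqP; rewrite mulf_eq0 invr_eq0.
  by rewrite (gt_eqF (semicircle_gt0 a0 arho (lt_rho arho sa))) orbF => /eqP.
have [ins|/existsNP[i /negP]] := pselect (forall i, `|z.1 0 i| < d).
  apply: lt_le_trans (source_lsc_in (ltW c0) ins).
  have : Ham_upper (- vec2 (m * h0) (m * h1)) (- mat2 (m * k0) 0 (m * k1)) <= m * C.
    apply: Ham_upper_bound.
    - by rewrite mulr_ge0 ?(ltW m0)//= ler_pM2l.
    - by rewrite mulr_ge0 ?(ltW m0)//= ler_pM2l.
    move=> /rowP p0.
    have e0 : h0 = 0.
      by apply/eqP; have /eqP := p0 0; rewrite !mxE/= mulf_eq0 (gt_eqF m0).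
    have e1 : h1 = 0.
      by apply/eqP; have /eqP := p0 1; rewrite !mxE/= mulf_eq0 (gt_eqF m0).
    have e0' := slope0 _ (clamp_le a0 _) e0.
    have e1' := slope0 _ (clamp_le a0 _) e1.
    have cz s : clamp a s = 0 -> s = 0.
      by case: (clampP a0 s) => -[_ ->] //; have := a0; lra.
    by rewrite /k0 /k1 (cz _ e0') (cz _ e1').
  move: (Ham_upper _ _) mC al1 c0; clear; move: (m * C) => b1 b2; lra.
rewrite -leNgt => out; apply: lt_le_trans (source_lsc_ge0 d z.1 (ltW c0)).
have flat s : d <= `|s| -> slope rho (clamp a s) ^+ 2 = 1 /\ curv_outer rho a s = 0.
  move=> ds; have as_ : a < `|s| by exact: lt_le_trans ds.
  split; last by rewrite /curv_outer leNgt as_.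
  case: (clampP a0 s) => -[sa ->]; first by exfalso; move: sa; rewrite leNgt as_.
    by rewrite slopeA expr1n.
  by rewrite slopeN slopeA sqrrN expr1n.
have b0 := curv_outer_le a0 arho (z.1 0 0).
have b1 := curv_outer_le a0 arho (z.1 0 1).
rewrite -/k0 -/h0 in b0; rewrite -/k1 -/h1 in b1.
suff : Ham_upper (- vec2 (m * h0) (m * h1)) (- mat2 (m * k0) 0 (m * k1))
    <= - (m * (1 - rho^-1)).
  by move: (Ham_upper _ _) al2; clear; move: (m * _) => b2 b3; lra.
have alt : (h0 ^+ 2 = 1 /\ k0 = 0) \/ (h1 ^+ 2 = 1 /\ k1 = 0).
  by elim/ord2 : i out => /flat[e1 e2]; [left|right].
case: alt => -[e1 e2].
  apply: le_trans (Ham_upper_separable _ _ m0 _) _; first by rewrite e1 ltr_pwDl// sqr_ge0.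
  by rewrite e1 e2 mulr0 add0r mul1r mulrA; exact: Ham_outside.
apply: le_trans (Ham_upper_separable _ _ m0 _) _; first by rewrite e1 ltr_wpDl// sqr_ge0.
rewrite e1 e2 mulr0 addr0 mul1r mulrA (addrC _ 1); exact: Ham_outside.
Qed.

Lemma lsc_at_mono (F : R -> R) S z : lsc_at S z -> {homo F : s t / s <= t} ->
  (forall s e, 0 <= e -> F s - 2 * e <= F (s - e)) -> lsc_at (fun w => F (S w)) z.
Proof.
move=> lS Fm Fl e e0; have e30 : 0 < e / 3 by rewrite divr_gt0.
have [r r0 rP] := lS _ e30; exists r => // w w0 w1 w2.
have h1 := Fm _ _ (ltW (rP w w0 w1 w2)).
have h2 := Fl (S z) _ (ltW e30).
by apply: lt_le_trans h1; apply: lt_le_trans h2; lra.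
Qed.

(** An increasing convex function, positive and of slope between 0 and 2: its
    compositions turn the position of a front into an admissible test function. *)
Definition ramp s : R := s + Num.sqrt (1 + s ^+ 2).

Lemma ramp_sqrt s : [/\ 1 <= Num.sqrt (1 + s ^+ 2),
  Num.sqrt (1 + s ^+ 2) ^+ 2 = 1 + s ^+ 2 & `|s| < Num.sqrt (1 + s ^+ 2)].
Proof.
have h : 0 <= 1 + s ^+ 2 by rewrite addr_ge0 ?sqr_ge0.
split; [by rewrite -[leLHS]sqrtr1 ler_sqrt ?lerDl ?sqr_ge0|by rewrite sqr_sqrtr|].
by rewrite -sqrtr_sqr ltr_sqrt ?ltrDr// ltr_pwDl ?sqr_ge0.
Qed.

Lemma ramp_gt0 s : 0 < ramp s.
Proof. by have [_ _] := ramp_sqrt s; rewrite ltr_norml /ramp; lra. Qed.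

Lemma sqrt_upper A s d : A = Num.sqrt (1 + s ^+ 2) ->
  Num.sqrt (1 + (s + d) ^+ 2) <= A + s / A * d + 2^-1 * A^-1 * d ^+ 2.
Proof.
move=> AE; have [A1 A2 _] := ramp_sqrt s; rewrite -AE in A1 A2.
have A0 : 0 < A by apply: lt_le_trans A1.
have e : A + s / A * d + 2^-1 * A^-1 * d ^+ 2 = (2 + s ^+ 2 + (s + d) ^+ 2) / (2 * A).
  transitivity ((2 * A ^+ 2 + 2 * s * d + d ^+ 2) / (2 * A)).
    by field; rewrite gt_eqF.
  by rewrite A2; congr (_ / _); ring.
have p : 0 <= A + s / A * d + 2^-1 * A^-1 * d ^+ 2.
  rewrite e divr_ge0 ?addr_ge0 ?sqr_ge0 ?mulr_ge0// ltW//.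
have [_ B2 _] := ramp_sqrt (s + d).
apply: le_of_sqr => //; rewrite B2.
have -> : (A + s / A * d + 2^-1 * A^-1 * d ^+ 2) ^+ 2 = A ^+ 2 + 2 * s * d + d ^+ 2
   + (s / A * d + 2^-1 * A^-1 * d ^+ 2) ^+ 2 by field; rewrite gt_eqF.
rewrite A2; have := sqr_ge0 (s / A * d + 2^-1 * A^-1 * d ^+ 2).
by move: (_ ^+ 2) => b; lra.
Qed.

Lemma ramp_upper s d : ramp (s + d) <= ramp s
  + (1 + s / Num.sqrt (1 + s ^+ 2)) * d
  + 2^-1 * (Num.sqrt (1 + s ^+ 2))^-1 * d ^+ 2 + 0 * `|d| ^+ 3.
Proof. by have := sqrt_upper d (erefl (Num.sqrt (1 + s ^+ 2))); rewrite /ramp; lra. Qed.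

Lemma sqrt_lip s t : Num.sqrt (1 + s ^+ 2) <= Num.sqrt (1 + t ^+ 2) + `|s - t|.
Proof.
have [A1 A2 A3] := ramp_sqrt s; have [B1 B2 B3] := ramp_sqrt t.
have n0 := normr_ge0 (s - t).
apply: le_of_sqr; first by rewrite addr_ge0 ?sqrtr_ge0.
rewrite A2 sqrrD B2 real_normK ?num_real//.
have : t * (s - t) <= Num.sqrt (1 + t ^+ 2) * `|s - t|.
  apply: le_trans (ler_norm _) _; rewrite normrM; apply: ler_wpM2r => //; exact: ltW.
rewrite mulr2n; move: (_ * `|_|) => b; lra.
Qed.

Lemma ramp_homo : {homo ramp : s t / s <= t}.
Proof.
move=> s t st; have := sqrt_lip s t; rewrite /ramp distrC ger0_norm ?subr_ge0//; lra.
Qed.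

Lemma ramp_lip s e : 0 <= e -> ramp s - 2 * e <= ramp (s - e).
Proof.
move=> e0; have := sqrt_lip s (s - e).
by rewrite /ramp (_ : s - (s - e) = e); [rewrite ger0_norm//; lra|ring].
Qed.

Lemma ramp_slope s : 0 <= 1 + s / Num.sqrt (1 + s ^+ 2) <= 2.
Proof.
have [A1 A2 A3] := ramp_sqrt s.
have A0 : 0 < Num.sqrt (1 + s ^+ 2) by apply: lt_le_trans A1.
have : `|s / Num.sqrt (1 + s ^+ 2)| <= 1.
  by rewrite normrM normfV (gtr0_norm A0) ler_pdivrMr// mul1r ltW.
by rewrite ler_norml; lra.
Qed.

(** The value at [- 2] is [1 - 2 / sqrt 5], slightly above [10^-1]. *)
Lemma ramp_slope_ge s : `|s| <= 2 -> 10^-1 <= 1 + s / Num.sqrt (1 + s ^+ 2).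
Proof.
move=> s2; have [A1 A2 A3] := ramp_sqrt s.
have A0 : 0 < Num.sqrt (1 + s ^+ 2) by apply: lt_le_trans A1.
suff : - s <= 9 / 10 * Num.sqrt (1 + s ^+ 2).
  by rewrite -ler_pdivrMr// mulNr; lra.
apply: le_of_sqr; first by rewrite mulr_ge0// ltW.
rewrite exprMn A2; move: s2; rewrite ler_norml => /andP[h1 h2].
have : 0 <= (2 - s) * (2 + s) by rewrite mulr_ge0; lra.
by lra.
Qed.

(** All level curves of the test function are translates of one curve, an arc of
    radius [rho] between [d] and 1 continued by its tangents.  Over the square only
    the arc is seen, and its curvature [rho^-1 > 1] makes the fronts recede, which
    subtracts [m gam] from the rate at which the source must be compensated; away
    from the square there is no source, and the rate [beta] exceeds the bounded
    outward speed of the tangent parts. *)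
Lemma subsol_le_sliding c d u : 0 < c -> 0 < d -> d < 1 ->
  visc_subsol (source c d) (fun=> 0) u -> compactly_supported_in_space u ->
  exists beta m a rho, [/\ 0 < beta < c, 0 <= m, 0 < a < rho & forall x t, 0 <= t ->
    usc_env Q u (x, t) <= beta * t + m * ramp (- x 0 1 - arch rho a (x 0 0))].
Proof.
move=> c0 d0 d1 su cu.
have [a [rho [da arho rho1]]] : exists a rho, [/\ d < a, a < rho & rho < 1].
  by exists ((2 * d + 1) / 3), ((d + 2) / 3); split; lra.
have a0 : 0 < a by exact: lt_trans da.
have r0 : 0 < rho by exact: lt_trans arho.
have rr : 0 < rho^-1 - 1 by rewrite subr_gt0 invf_gt1.
pose L := slope rho a; have L0 : 0 <= L := slope_a_ge0 a0 arho.
(* the drop of speed on the arc, times the least slope 1/10 of the ramp there *)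
have [gam gam0 gamE] : exists2 gam, 0 < gam & 10 * gam = rho^-1 - 1.
  by exists ((rho^-1 - 1) / 10); [rewrite divr_gt0|field; rewrite gt_eqF].
have den0 : 0 < gam + 4 * (1 + L) by rewrite addr_gt0// mulr_gt0// ltr_pwDl.
(* c exceeds twice the largest outward speed 2 m (1 + L) by exactly m gam *)
have [m m0 mE] : exists2 m, 0 < m & m * (gam + 4 * (1 + L)) = c.
  by exists (c / (gam + 4 * (1 + L))); [rewrite divr_gt0|rewrite divfK// gt_eqF].
have mg0 : 0 < m * gam by rewrite mulr_gt0.
have mL0 : 0 < m * (1 + L) by rewrite mulr_gt0// ltr_pwDl.
have mE' : m * gam + 4 * (m * (1 + L)) = c by rewrite -mE; ring.
pose beta := c - m * gam / 2.
have b1 : 2 * (m * (1 + L)) < beta.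
  by rewrite /beta; move: mE' mg0 mL0; move: (m * gam) (m * (1 + L)) => b1 b2; lra.
exists beta, m, a, rho; split; [|exact: ltW|by rewrite a0|].
  apply/andP; split; first by apply: lt_trans b1; rewrite mulr_gt0.
  by rewrite /beta gtrDl oppr_lt0 divr_gt0.
move=> x t t0.
pose S w : R := - w.1 0 1 - arch rho a (w.1 0 0).
pose psi w : R := beta * w.2 + m * ramp (S w).
rewrite -/(psi (x, t)).
have be0 : 0 < beta by apply: lt_trans b1; rewrite mulr_gt0.
apply: (subsol_le su cu) => //.
- move=> z _; apply: lsc_atD; first exact: lsc_at_time.
  apply: lsc_atZ; first exact: ltW.
  apply: lsc_at_mono; [|exact: ramp_homo|exact: ramp_lip].
  apply: lsc_atD.
    apply: (lsc_at_comp (L := 1) (F := fun s => - s) (expands_coord 1 z) ltr01) => //.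
    by move=> b _; rewrite mul1r opprD lerD2l lerN2 ler_norm.
  apply: (lsc_at_comp (L := L) (F := fun s => - arch rho a s) (expands_coord 0 z) ltr01) => //.
  move=> b _; have := arch_lip a0 arho (z.1 0 0 + b) (z.1 0 0).
  rewrite (_ : z.1 0 0 - (z.1 0 0 + b) = - b); last by ring.
  by rewrite normrN -/L; move: (arch _ _ _) (arch _ _ _) (L * _) => b1' b2 b3; lra.
- by move=> y; rewrite /psi/= mulr0 add0r mulr_ge0 ?(ltW m0)// ltW// ramp_gt0.
- move=> T T0; exists 0 => y r _ /andP[s0 _]; rewrite /psi/=.
  by rewrite addr_ge0 ?mulr_ge0 ?(ltW m0)// ?(ltW be0)// ltW// ramp_gt0.
move=> z z0.
have [q [qz [K [r [K0 rp qP]]]]] := arch_lower_model a0 arho (z.1 0 0).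
set h := slope rho (clamp a (z.1 0 0)) in qP.
set k := curv_inner rho a (z.1 0 0) in qP.
have eq_ := expands_comp_coord K0 rp (fun d dr => (qP d dr).2).
have eg := expands_lincomb (-1) (-1) (expands_coord 1 z) eq_.
pose g w := -1 * w.1 0 1 + -1 * q (w.1 0 0).
have gz : g z = S z by rewrite /g /S qz; ring.
pose A := Num.sqrt (1 + S z ^+ 2).
have A1 : 0 < A by rewrite sqrtr_gt0 ltr_pwDl// sqr_ge0.
pose F1 := 1 + S z / A.
have /andP[F1ge F1le] : 0 <= F1 <= 2 := ramp_slope (S z).
have F10 : 0 < F1.
  have [_ _] := ramp_sqrt (S z); rewrite -/A ltr_norml => /andP[h1 _].
  by rewrite /F1 -(ltr_pM2r A1) mul0r mulrDl mul1r divfK ?gt_eqF//; lra.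
have jg := superjet_comp (F := ramp) eg ltr01 (lexx 0) (fun d _ => ramp_upper _ d).
have E1 : ramp (S z) = ramp (g z) by rewrite gz.
have E2 w : 0 <= w.2 -> enorm (w.1 - z.1) < r -> `|w.2 - z.2| < r ->
    ramp (S w) <= ramp (g w).
  move=> w0 w1 _; apply: ramp_homo; rewrite /S /g !mulN1r lerD2l lerN2.
  have wi : `|w.1 0 0 - z.1 0 0| < r.
    by apply: le_lt_trans w1; have := coord_le_enorm (w.1 - z.1) 0; rewrite !mxE.
  by have [] := qP _ wi; rewrite (addrC (z.1 0 0)) subrK.
have jr := superjet_ge (v := fun w => ramp (S w)) rp E1 E2 jg.
have jt := superjetD (superjet_time beta z) (superjetZ (ltW m0) jr).
rewrite -/(g z) gz -/A -/F1 in jt.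
pose p0 : V := vec2 (- h) (-1); pose X0 : M2 := mat2 (- k) 0 0.
exists ((m * F1) *: p0), ((m * F1) *: X0 + (m / A) *: (p0^T *m p0)), beta; split.
  move: jt; rewrite !delta_tensor /= !(mulr0, addr0) !add0r.
  have -> : -1 *: delta_mx 0 1 + -1 *: (h *: delta_mx 0 0) = p0.
    by apply: rV2P; rewrite !mxE /=; ring.
  have -> : -1 *: 0 + -1 *: (k *: mat2 1 0 0) = X0.
    by apply/matrixP => i j; elim/ord2 : i; elim/ord2 : j; rewrite !mxE /=; ring.
  by rewrite scalerDr !scalerA.
have sX : ((m * F1) *: X0 + (m / A) *: (p0^T *m p0))^T =
   (m * F1) *: X0 + (m / A) *: (p0^T *m p0) by apply: tensor_sym; exact: mat2_sym.
have mF0 : 0 < m * F1 by rewrite mulr_gt0.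
have p00 : p0 != 0 by rewrite vec2_neq0 gt_eqF// ltr_wpDl ?sqr_ge0// sqrrN expr1n.
have mp0 : (m * F1) *: p0 != 0 by rewrite scaler_eq0 negb_or p00 gt_eqF.
apply: lt_le_trans (_ : _ < beta + Ham ((m * F1) *: p0,
    (m * F1) *: X0 + (m / A) *: (p0^T *m p0))) _; last first.
  by rewrite lerD2l; exact: Ham_lower_ge_Ham.
pose W := Num.sqrt (1 + h ^+ 2).
have W2 : 0 < 1 + h ^+ 2 by rewrite ltr_pwDl// sqr_ge0.
have HE : Ham ((m * F1) *: p0, (m * F1) *: X0 + (m / A) *: (p0^T *m p0)) =
    m * F1 * (k / (1 + h ^+ 2) - W).
  rewrite /Ham/= trsigma_comp ?gt_eqF// trsigma2// enormZ ?(ltW mF0)// enorm_vec2.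
  rewrite !vec2E !mat2E !sqrrN expr1n (addrC _ 1) -/W.
  by field; rewrite gt_eqF.
have W0 : 0 <= W := sqrtr_ge0 _.
have hL : `|h| <= L := slope_le a0 arho (clamp_le a0 _).
have WL : W <= 1 + L.
  apply: le_of_sqr; first by rewrite addr_ge0.
  rewrite sqr_sqrtr ?(ltW W2)// -(real_normK (num_real h)).
  rewrite sqrrD expr1n mul1r mulr2n.
  by have := le_sqr (normr_ge0 h) hL; move: L0; clear; move: (_ ^+ 2) (_ ^+ 2) => b2 b3; lra.
have k0 : 0 <= k by rewrite /k /curv_inner; case: ifP => // _; exact: curv_ge0.
rewrite HE.
have [ins|/existsNP[i /negP]] := pselect (forall i, `|z.1 0 i| <= d); last first.
  rewrite -ltNge => out; apply: le_lt_trans (source_usc_out (ltW c0) out) _.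
  have h1 : 0 <= m * F1 * (k / (1 + h ^+ 2)).
    by rewrite mulr_ge0 ?(ltW mF0)// divr_ge0// ltW.
  have h2 : m * F1 * W <= 2 * (m * (1 + L)).
    rewrite (_ : 2 * _ = m * 2 * (1 + L)); last by ring.
    by apply: ler_pM => //; [exact: ltW|rewrite ler_pM2l].
  rewrite mulrBr; move: h1 h2 b1; clear; move: (_ * (k / _)) (_ * W) => b2 b3; lra.
apply: le_lt_trans (source_usc_le d z.1 (ltW c0)) _.
have za : `|z.1 0 0| < a by apply: le_lt_trans da; exact: ins.
have hE : h = slope rho (z.1 0 0) by rewrite /h clamp_id// ltW.
have kE : k / (1 + h ^+ 2) = W / rho.
  rewrite /k /curv_inner za (curvE a0 arho (lt_rho arho (ltW za))) -hE -/W.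
  by field; rewrite !gt_eqF.
have F1g : 10^-1 <= F1.
  apply: ramp_slope_ge; rewrite /S arch_circle; [|exact: a0|exact: ltW].
  rewrite opprK.
  have := semicircle_le a0 arho (z.1 0 0).
  have : 0 <= semicircle rho (z.1 0 0) by exact: sqrtr_ge0.
  have := ins 1; rewrite !ler_norml => /andP[]; move: d1 rho1; clear.
  by move: (semicircle _ _) => b2 *; apply/andP; split; lra.
have W1 : 1 <= W by rewrite -[leLHS]sqrtr1 ler_sqrt ?(ltW W2)// lerDl sqr_ge0.
have fin : m * gam <= m * F1 * (k / (1 + h ^+ 2) - W).
  rewrite kE (_ : W / rho - W = W * (rho^-1 - 1)); last by ring.
  rewrite -mulrA; apply: ler_wpM2l; first exact: ltW.
  rewrite -gamE; apply: (@le_trans _ _ (10^-1 * (1 * (10 * gam)))).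
    by rewrite mul1r mulrA mulVf// mul1r.
  apply: ler_pM => //; first by rewrite mulr_ge0// mulr_ge0// ltW.
  by apply: ler_wpM2r => //; rewrite mulr_ge0// ltW.
by apply: lt_le_trans (lerD (lexx _) fin); rewrite /beta; move: mg0; clear;
  move: (m * gam) => b2; lra.
Qed.

(** * Jets along curves, and bump functions *)

(** A jet controls a function to second order along parabolas, and not only
    along lines; this detects the curvature of the boundary of a disc. *)
Lemma superjet_curve v z p X tau y q : 0 <= z.2 -> superjet v z p X tau ->
  forall e, 0 < e -> exists2 r, 0 < r & forall h, 0 < h < r ->
    v (z.1 + h *: y + h ^+ 2 *: q, z.2) <=
      v z + h * dotp p y + h ^+ 2 * (dotp p q + 2^-1 * dotp (y *m X) y + e).
Proof.
move=> z0 /superjetP[sX jP] e e0.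
have [N N0 NE] : exists2 N, 0 <= N & N = enorm y + enorm q.
  by exists (enorm y + enorm q) => //; rewrite addr_ge0 ?enorm_ge0.
have [B B0 BE] : exists2 B, 0 <= B & `|2^-1 * (dotp (y *m X) q + dotp (q *m X) y)|
    + `|2^-1 * dotp (q *m X) q| = B.
  by eexists; [|reflexivity]; rewrite addr_ge0.
have e'0 : 0 < e / 2 / (N ^+ 2 + 1).
  by rewrite !divr_gt0// ltr_wpDl// exprn_ge0.
have [r r0 rP] := jP _ e'0.
have N1 : 0 < N + 1 by rewrite ltr_wpDl.
have B1 : 0 < B + 1 by rewrite ltr_wpDl.
exists (Num.min 1 (Num.min (r / (N + 1)) (e / 2 / (B + 1)))).
  by rewrite !lt_min ltr01 !divr_gt0.
move=> h /andP[h0]; rewrite !lt_min => /and3P[h1].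
rewrite ltr_pdivlMr// ltr_pdivlMr// => hr hB.
have dE : z.1 + h *: y + h ^+ 2 *: q - z.1 = h *: y + h ^+ 2 *: q.
  by rewrite addrAC [z.1 + _]addrC addrK.
have hN : enorm (h *: y + h ^+ 2 *: q) <= h * N.
  apply: le_trans (enormD _ _) _; rewrite NE !enormZ ?sqr_ge0 ?(ltW h0)// mulrDr lerD2l.
  by apply: ler_wpM2r; [exact: enorm_ge0|rewrite expr2 ler_piMl// ltW].
have := rP (z.1 + h *: y + h ^+ 2 *: q, z.2).
rewrite /= dE subrr normr0 mulr0 addr0 add0r => /(_ z0 _ r0) h2.
have {}h2 := h2 (le_lt_trans hN _).
apply: le_trans (h2 _) _.
  by apply: le_lt_trans hr; rewrite mulrDr lerDl mulr1 ltW.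
rewrite (_ : dotp p _ = h * dotp p y + h ^+ 2 * dotp p q); last by rewrite !dotp2 !mxE; ring.
have -> : 2^-1 * dotp ((h *: y + h ^+ 2 *: q) *m X) (h *: y + h ^+ 2 *: q) =
   h ^+ 2 * (2^-1 * dotp (y *m X) y)
   + h ^+ 2 * (h * (2^-1 * (dotp (y *m X) q + dotp (q *m X) y))
     + h ^+ 2 * (2^-1 * dotp (q *m X) q)).
  by rewrite !dotp2 !mxE !sum2 !mxE; ring.
have h3 : e / 2 / (N ^+ 2 + 1) * enorm (h *: y + h ^+ 2 *: q) ^+ 2 <= h ^+ 2 * (e / 2).
  rewrite mulrAC ler_pdivrMr; last by rewrite ltr_wpDl// exprn_ge0.
  have h4 := le_sqr (enorm_ge0 _) hN.
  rewrite [h ^+ 2 * _]mulrC -[leRHS]mulrA; apply: ler_wpM2l; first by rewrite divr_ge0// ltW.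
  apply: le_trans h4 _; rewrite exprMn; apply: ler_wpM2l; first exact: sqr_ge0.
  by rewrite lerDl.
have h5 : h * (2^-1 * (dotp (y *m X) q + dotp (q *m X) y))
     + h ^+ 2 * (2^-1 * dotp (q *m X) q) <= e / 2.
  apply: le_trans (ler_norm _) _; apply: le_trans (ler_normD _ _) _.
  rewrite [`|h * _|]normrM [`|h ^+ 2 * _|]normrM (gtr0_norm h0) (ger0_norm (sqr_ge0 h)).
  have h6 : h ^+ 2 <= h by rewrite expr2 ler_piMl// ltW.
  apply: le_trans (ltW hB); apply: (@le_trans _ _ (h * B)); last first.
    by rewrite mulrDr lerDl mulr1 ltW.
  by rewrite -BE [leRHS]mulrDr lerD2l; apply: ler_wpM2r.
have {}h5 := ler_wpM2l (sqr_ge0 h) h5.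
move: h3 h5; clear; move: (_ * enorm _ ^+ 2) => b1.
move: (h * (2^-1 * _) + _) => b2.
move: (2^-1 * _) (dotp p y) (dotp p q) (v z) => b3 b4 b5 b6.
by rewrite !mulrDr; move: (h ^+ 2 * b2) => b7; lra.
Qed.

(** First divide by [h], then, if the linear term vanishes, by [h^2]. *)
Lemma second_order_sign a b : (forall e, 0 < e -> exists2 r, 0 < r &
    forall h, 0 < h < r -> 0 <= h * a + h ^+ 2 * (b + e)) ->
  0 <= a /\ (a = 0 -> 0 <= b).
Proof.
move=> ab; split.
  apply/ler_addgt0Pr => e e0; have [r r0 rP] := ab 1 ltr01.
  have [G G0 GE] : exists2 G, 0 < G & G = `|b + 1| + 1.
    by exists (`|b + 1| + 1) => //; rewrite ltr_wpDl.
  have [h [h0 hr he]] : exists h, [/\ 0 < h, h < r & h * G <= e].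
    exists (Num.min (r / 2) (e / G)); split.
    - by rewrite lt_min !divr_gt0.
    - by apply: (@le_lt_trans _ _ (r / 2)); [rewrite ge_min lexx|lra].
    - by rewrite -ler_pdivlMr// ge_min lexx orbT.
  have : 0 <= h * a + h ^+ 2 * (b + 1) by apply: rP; rewrite h0.
  rewrite expr2 -mulrA -mulrDr pmulr_rge0// => h1.
  apply: le_trans h1 _; rewrite lerD2l; apply: le_trans he.
  by apply: ler_wpM2l; [exact: ltW|rewrite GE; apply: le_trans (ler_norm _) _; rewrite lerDl].
move=> a0; apply/ler_addgt0Pr => e e0; have [r r0 rP] := ab e e0.
have : 0 <= (r / 2) * a + (r / 2) ^+ 2 * (b + e).
  by apply: rP; apply/andP; split; lra.
by rewrite a0 mulr0 add0r pmulr_rge0// exprn_gt0 ?divr_gt0.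
Qed.

Lemma superjet_flat_curve v z p X tau y q r : 0 <= z.2 -> superjet v z p X tau -> 0 < r ->
  (forall h, 0 < h < r -> v z <= v (z.1 + h *: y + h ^+ 2 *: q, z.2)) ->
  0 <= dotp p y /\ (dotp p y = 0 -> 0 <= dotp p q + 2^-1 * dotp (y *m X) y).
Proof.
move=> z0 jv r0 flat; apply: second_order_sign => e e0.
have [s s0 sP] := superjet_curve y q z0 jv e0.
exists (Num.min r s); first by rewrite lt_min r0.
move=> h; rewrite lt_min => /and3P[h0 hr hs].
have /flat h1 : 0 < h < r by rewrite h0.
have /sP h2 : 0 < h < s by rewrite h0.
by have := le_trans h1 h2; rewrite -addrA lerDl.
Qed.

Lemma superjet_const0 z p X tau : 0 < z.2 -> superjet (fun=> 0) z p X tau ->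
  [/\ p = 0, tau = 0 & forall y, 0 <= dotp (y *m X) y].
Proof.
move=> z0 jv; have /superjetP[sX jP] := jv.
have tau0 e : 0 < e -> `|tau| <= e.
  move=> e0; have [r r0 rP] := jP e e0.
  pose h := Num.min r z.2 / 2.
  have m0 : 0 < Num.min r z.2 by rewrite lt_min r0.
  have h0 : 0 < h by rewrite divr_gt0.
  have hr : h < r.
    have : Num.min r z.2 <= r by rewrite ge_min lexx.
    by move: m0; rewrite /h; move: (Num.min _ _) => b; lra.
  have hz : h < z.2.
    have : Num.min r z.2 <= z.2 by rewrite ge_min lexx orbT.
    by move: m0; rewrite /h; move: (Num.min _ _) => b; lra.
  have h1 := rP (z.1, z.2 + h); have h2 := rP (z.1, z.2 - h).
  move: h1 h2; rewrite /= !subrr !enorm0 !quad2 !dotp2 !mxE !(mulr0, mul0r, addr0, expr0n)/=.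
  rewrite (addrC z.2) (addrC z.2) !addrK normrN (gtr0_norm h0) => h1 h2.
  have {}h1 := h1 (ltW (addr_gt0 h0 z0)) r0 hr.
  have {}h2 := h2 _ r0 hr.
  have {}h2 : 0 <= 0 + tau * - h + e * h by apply: h2; rewrite addrC subr_ge0 ltW.
  move: h1 h2; rewrite !add0r mulrN -mulNr -!mulrDl !pmulr_lge0// ler_norml => h1 h2.
  by apply/andP; split; lra.
have t0 : tau = 0.
  apply/eqP; rewrite -normr_eq0 eq_le normr_ge0 andbT.
  by apply/ler_addgt0Pr => e e0; rewrite add0r tau0.
have flat y : 0 <= dotp p y /\ (dotp p y = 0 -> 0 <= dotp (y *m X) y).
  have [h1 h2] := superjet_flat_curve (y := y) (q := 0) (ltW z0) jv ltr01 (fun _ _ => lexx 0).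
  split=> // /h2; rewrite (_ : dotp p 0 = 0) ?add0r ?pmulr_rge0 ?invr_gt0//.
  by rewrite dotp2 !mxE; ring.
have p0 : p = 0 by apply: dotpN_ge0; have [] := flat (- p).
by split=> // y; have [_] := flat y; apply; rewrite p0 dotp2 !mxE; ring.
Qed.

(** The sum of the two functions is 0, whose jets are known. *)
Lemma superjet_opposite v z p q X Y tau l : 0 < z.2 ->
  superjet v z p X tau -> superjet (fun w => - v w) z q Y l ->
  [/\ p = - q, tau = - l & forall y, dotp (y *m (- Y)) y <= dotp (y *m X) y].
Proof.
move=> z0 jv jN; have := superjetD jv jN.
rewrite (_ : (fun w => v w + - v w) = (fun=> 0)); last by apply/funext => w; rewrite subrr.
move=> /(superjet_const0 z0)[/eqP + /eqP + XY]; rewrite !addr_eq0 => /eqP pq /eqP tl.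
by split=> // y; have := XY y; rewrite !quad2 !mxE; lra.
Qed.

(** The quadratic jet plus a smooth substitute for [2 e gauge], in which the
    absolute value of the time increment is rounded off at scale [eta]. *)
Definition jet_bump z0 p X tau e eta w : R := quadratic z0 p X tau w
  + 2 * e * (eta * Num.sqrt (1 + ((w.2 - z0.2) / eta) ^+ 2) + enorm (w.1 - z0.1) ^+ 2).

Lemma bump_ge z0 p X tau e eta w : 0 <= e -> 0 < eta ->
  quadratic z0 p X tau w + 2 * e * gauge w z0 <= jet_bump z0 p X tau e eta w.
Proof.
move=> e0 eta0; rewrite lerD2l; apply: ler_wpM2l; first by rewrite mulr_ge0.
rewrite lerD2r; have [_ _] := ramp_sqrt ((w.2 - z0.2) / eta).
by rewrite normrM normfV (gtr0_norm eta0) ltr_pdivrMr// mulrC => /ltW.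
Qed.

Lemma bump_center z0 p X tau e eta : jet_bump z0 p X tau e eta z0 = 2 * e * eta.
Proof.
rewrite /jet_bump /quadratic !subrr enorm0 dotp2 quad2 !mxE.
rewrite (_ : 1 + (0 / eta) ^+ 2 = 1); last by rewrite mul0r expr0n/= addr0.
by rewrite sqrtr1; ring.
Qed.

Lemma expands_quadratic z0 z p X tau : X^T = X ->
  expands (quadratic z0 p X tau) z (p + (z.1 - z0.1) *m X) X tau.
Proof.
move=> sX; split=> //; exists 0, 1; split=> // w _ _ _.
rewrite mul0r normr_le0 /quadratic !quad2 !dotp2 !mxE !sum2 !mxE (sym2 sX).
by apply/eqP; field.
Qed.

Lemma expands_sqdist z0 z : expands (fun w => enorm (w.1 - z0.1) ^+ 2) z
  (2 *: (z.1 - z0.1)) (2 *: 1%:M) 0.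
Proof.
split; first by rewrite linearZ/= trmx1.
exists 0, 1; split=> // w _ _ _; rewrite /quadratic dotp2 quad2 !enorm_sqr !mxE /= !mul0r.
by rewrite normr_le0; apply/eqP; field.
Qed.

Lemma expands_time k b z : expands (fun w : V * R => (w.2 - b) / k) z 0 0 k^-1.
Proof.
split; first by rewrite trmx0.
exists 0, 1; split=> // w _ _ _; rewrite /quadratic dotp2 quad2 !mxE !mul0r normr_le0.
by apply/eqP; ring.
Qed.

Lemma superjet_bump z0 z p X tau e eta : X^T = X -> 0 <= e -> 0 < eta ->
  exists2 tau', `|tau' - tau| <= 2 * e &
  superjet (jet_bump z0 p X tau e eta) z
    (p + (z.1 - z0.1) *m X + (4 * e) *: (z.1 - z0.1)) (X + (4 * e)%:M) tau'.
Proof.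
move=> sX e0 eta0.
pose s := (z.2 - z0.2) / eta; pose A := Num.sqrt (1 + s ^+ 2).
have [A1 A2 A3] := ramp_sqrt s; rewrite -/A in A1 A2 A3.
have A0 : 0 < A by apply: lt_le_trans A1.
have F d : `|d| < 1 -> Num.sqrt (1 + (s + d) ^+ 2) <=
    Num.sqrt (1 + s ^+ 2) + s / A * d + 2^-1 * A^-1 * d ^+ 2 + 0 * `|d| ^+ 3.
  by move=> _; rewrite mul0r addr0; exact: sqrt_upper.
have js := superjet_comp (F := fun a => Num.sqrt (1 + a ^+ 2))
  (expands_time eta z0.2 z) ltr01 (lexx 0) F.
have e20 : 0 <= 2 * e by rewrite mulr_ge0.
have jt := superjetD (expands_superjet (expands_quadratic z0 z p tau sX))
  (superjetZ e20 (superjetD (superjetZ (ltW eta0) js)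
    (expands_superjet (expands_sqdist z0 z)))).
exists (tau + 2 * e * (s / A)).
  rewrite addrAC subrr add0r normrM (ger0_norm e20) ler_piMr//.
  by rewrite normrM normfV (gtr0_norm A0) ler_pdivrMr// mul1r ltW.
move: jt; rewrite !scaler0 mulmx0 scaler0 !add0r addr0 !scalerA.
have -> : eta * (s / A * eta^-1) = s / A by field; rewrite !gt_eqF.
have -> : 2 * e * 2 = 4 * e by ring.
by rewrite scaler0 add0r scalerA scalemx1 (_ : 2 * e * 2 = 4 * e)//; ring.
Qed.

Lemma lsc_at_expands g z p X tau : expands g z p X tau -> lsc_at g z.
Proof.
move=> eg; apply: (lsc_at_comp (F := id) (L := 1) eg ltr01) => // a _.
by rewrite mul1r lerD2l lerNl -normrN ler_norm.
Qed.

Lemma lsc_at_bump z0 z p X tau e eta : X^T = X -> 0 <= e -> 0 < eta ->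
  lsc_at (jet_bump z0 p X tau e eta) z /\ lsc_at (fun w => - jet_bump z0 p X tau e eta w) z.
Proof.
move=> sX e0 eta0; have e20 : 0 <= 2 * e by rewrite mulr_ge0.
have neg g q Y l : expands g z q Y l -> lsc_at (fun w => - g w) z.
  move=> eg; apply: (lsc_at_comp (F := fun a => - a) (L := 1) eg ltr01) => // a _.
  by rewrite mul1r opprD lerD2l lerN2 ler_norm.
split.
  apply: lsc_atD; first exact: lsc_at_expands (expands_quadratic z0 z p tau sX).
  apply: lsc_atZ => //; apply: lsc_atD; last exact: lsc_at_expands (expands_sqdist z0 z).
  apply: lsc_atZ; first exact: ltW.
  apply: (lsc_at_comp (F := fun a => Num.sqrt (1 + a ^+ 2)) (L := 1)
    (expands_time eta z0.2 z) ltr01) => // a _.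
  have := sqrt_lip ((z.2 - z0.2) / eta) ((z.2 - z0.2) / eta + a).
  rewrite (_ : _ - (_ + a) = - a); last by ring.
  by rewrite normrN mul1r lerBlDr.
have -> : (fun w => - jet_bump z0 p X tau e eta w) = (fun w =>
   - quadratic z0 p X tau w + 2 * e * (eta * (- Num.sqrt (1 + ((w.2 - z0.2) / eta) ^+ 2))
     + - enorm (w.1 - z0.1) ^+ 2)) by apply/funext => w; rewrite /jet_bump; ring.
apply: lsc_atD; first exact: neg (expands_quadratic z0 z p tau sX).
apply: lsc_atZ => //; apply: lsc_atD; last exact: neg (expands_sqdist z0 z).
apply: lsc_atZ; first exact: ltW.
apply: (lsc_at_comp (F := fun a => - Num.sqrt (1 + a ^+ 2)) (L := 1)
  (expands_time eta z0.2 z) ltr01) => // a _.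
have := sqrt_lip ((z.2 - z0.2) / eta + a) ((z.2 - z0.2) / eta).
rewrite (_ : _ + a - _ = a); last by ring.
by rewrite mul1r; move: (Num.sqrt _) (Num.sqrt _) (`|a|) => b1 b2 b3; lra.
Qed.

Lemma enorm_mulmx X : exists2 C, 0 <= C & forall y, enorm (y *m X) <= C * enorm y.
Proof.
exists (`|X 0 0| + `|X 0 1| + `|X 1 0| + `|X 1 1|) => [|y]; first by rewrite !addr_ge0.
apply: le_trans (enorm_le_coord _) _; rewrite !mxE !sum2.
have h i j : `|y 0 i * X i j| <= `|X i j| * enorm y.
  by rewrite normrM mulrC ler_wpM2l// coord_le_enorm.
have h2 (i j k l : 'I_2) : `|y 0 i * X i j + y 0 k * X k l| <=
    `|X i j| * enorm y + `|X k l| * enorm y.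
  by apply: le_trans (ler_normD _ _) _; apply: lerD.
have := h2 0 0 1 0; have := h2 0 1 1 1.
rewrite !mulrDl; move: (`|X 0 0| * _) (`|X 0 1| * _) (`|X 1 0| * _) (`|X 1 1| * _).
by move: (`|_ + _|) (`|_ + _|) => b1 b2 b3 b4 b5 b6; lra.
Qed.

(** Since the bump is smooth and [e] is small, its jets near the centre are close
    to the given jet, uniformly in [eta]; a strict inequality at the centre thus
    survives at nearby contact points. *)
Lemma bump_jets_close z0 p X tau del : X^T = X -> 0 < del ->
  exists e r, [/\ 0 < e, 0 < r < 1 & forall eta z, 0 < eta ->
    enorm (z.1 - z0.1) <= r -> exists q Y l,
    [/\ superjet (jet_bump z0 p X tau e eta) z q Y l, Y^T = Y, enorm (q - p) < del,
        mxclose del X Y & `|l - tau| < del]].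
Proof.
move=> sX del0; have [C C0 CP] := enorm_mulmx X.
pose e := del / 8; have e0 : 0 < e by rewrite divr_gt0.
pose r := Num.min 2^-1 (del / (2 * (C + 4 * e + 1))).
have den0 : 0 < 2 * (C + 4 * e + 1).
  by rewrite mulr_gt0// ltr_wpDl// addr_ge0// mulr_ge0// ltW.
exists e, r; split=> //.
  apply/andP; split; first by rewrite lt_min invr_gt0 ltr0n divr_gt0.
  by apply: (@le_lt_trans _ _ 2^-1); [rewrite ge_min lexx|lra].
move=> eta z eta0 zr.
have [l lt jb] := superjet_bump z0 z p tau sX (ltW e0) eta0.
exists (p + (z.1 - z0.1) *m X + (4 * e) *: (z.1 - z0.1)), (X + (4 * e)%:M), l; split=> //.
- by rewrite linearD/= sX tr_scalar_mx.
- rewrite -[p + _ + _]addrA [_ - p]addrC addKr; apply: le_lt_trans (enormD _ _) _.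
  rewrite enormZ; last by rewrite mulr_ge0// ltW.
  have h1 : enorm (z.1 - z0.1) <= del / (2 * (C + 4 * e + 1)).
    by apply: le_trans zr _; rewrite ge_min lexx orbT.
  rewrite ler_pdivlMr// in h1.
  have h2 := CP (z.1 - z0.1); have := enorm_ge0 (z.1 - z0.1).
  move: h1 h2 del0; rewrite !mulrDr; move: (enorm _) (enorm _) => b1 b2; nra.
- move=> i j; rewrite !mxE addrAC subrr add0r.
  by case: (i == j); rewrite ?mulr1n ?mulr0n ?normr0// gtr0_norm; rewrite /e; lra.
- by apply: le_lt_trans lt _; rewrite /e; lra.
Qed.

Lemma usc_setT_lt_near f x a :
  (forall x, bounded_near (f : V -> R^o) (within setT (nbhs x))) ->
  usc_env setT f x < a ->
  exists2 r, 0 < r & forall y, enorm (y - x) < r -> usc_env setT f y < a.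
Proof.
move=> bf fa; pose b := (usc_env setT f x + a) / 2.
have fb : usc_env setT f x < b by rewrite /b; lra.
have [r r0 rP] := usc_setT_lt (bf x) fb.
exists (r / 2); first by rewrite divr_gt0.
move=> y yx; apply: (@le_lt_trans _ _ b); last by rewrite /b; lra.
apply: usc_setT_le => //; exists (r / 2); first by rewrite divr_gt0.
move=> y' y'y; apply/ltW/rP; rewrite -(subrK y y') -addrA.
by apply: le_lt_trans (enormD _ _) _; lra.
Qed.

Lemma strict_super_near f x p X tau :
  (forall x, bounded_near (f : V -> R^o) (within setT (nbhs x))) -> X^T = X ->
  usc_env setT f x < tau + Ham_lower p X ->
  exists2 del, 0 < del & forall y q Y l, enorm (y - x) < del -> Y^T = Y ->
    enorm (q - p) < del -> mxclose del X Y -> `|l - tau| < del ->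
    usc_env setT f y < l + Ham_lower q Y.
Proof.
move=> bf sX strict.
pose gap := tau + Ham_lower p X - usc_env setT f x.
have gap0 : 0 < gap by rewrite subr_gt0.
have [r1 r10 r1P] : exists2 r, 0 < r & forall y, enorm (y - x) < r ->
    usc_env setT f y < usc_env setT f x + gap / 3.
  by apply: usc_setT_lt_near => //; rewrite ltrDl divr_gt0.
have [r2 r20 r2P] : exists2 r, 0 < r & forall q Y, Y^T = Y -> enorm (q - p) < r ->
    mxclose r X Y -> Ham_lower p X - gap / 3 < Ham_lower q Y.
  by apply: Ham_lower_gt => //; rewrite ltrBlDr ltrDl divr_gt0.
exists (Num.min r1 (Num.min r2 (gap / 3))).
  by rewrite !lt_min r10 r20 divr_gt0.
move=> y q Y l; rewrite !lt_min => /and3P[y1 _ _] sY /and3P[_ q2 _] XY /and3P[_ _ l3].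
have XY2 : mxclose r2 X Y by apply: mxcloseW XY; rewrite !ge_min lexx orbT.
have h1 := r1P y y1; have h2 := r2P q Y sY q2 XY2.
move: h1 h2 l3; rewrite ltr_norml /gap.
by move: (usc_env _ _ _) (usc_env _ _ _) (Ham_lower _ _) (Ham_lower _ _) => b1 b2 b3 b4; lra.
Qed.

Lemma strict_sub_near f x p X tau :
  (forall x, bounded_near (f : V -> R^o) (within setT (nbhs x))) -> X^T = X ->
  tau + Ham_upper p X < lsc_env setT f x ->
  exists2 del, 0 < del & forall y q Y l, enorm (y - x) < del -> Y^T = Y ->
    enorm (q - p) < del -> mxclose del X Y -> `|l - tau| < del ->
    l + Ham_upper q Y < lsc_env setT f y.
Proof.
move=> bf sX; rewrite lsc_envE => strict.
have bNf y : bounded_near ((fun y => - f y) : V -> R^o) (within setT (nbhs y)).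
  by have FF := nbhs_setT_proper y; exact: bounded_nearN.
pose gap := - usc_env setT (fun y => - f y) x - (tau + Ham_upper p X).
have gap0 : 0 < gap by rewrite subr_gt0.
have [r1 r10 r1P] : exists2 r, 0 < r & forall y, enorm (y - x) < r ->
    usc_env setT (fun y => - f y) y < usc_env setT (fun y => - f y) x + gap / 3.
  by apply: usc_setT_lt_near => //; rewrite ltrDl divr_gt0.
have [r2 r20 r2P] : exists2 r, 0 < r & forall q Y, Y^T = Y -> enorm (q - p) < r ->
    mxclose r X Y -> Ham_upper q Y < Ham_upper p X + gap / 3.
  by apply: Ham_upper_lt => //; rewrite ltrDl divr_gt0.
exists (Num.min r1 (Num.min r2 (gap / 3))).
  by rewrite !lt_min r10 r20 divr_gt0.
move=> y q Y l; rewrite !lt_min => /and3P[y1 _ _] sY /and3P[_ q2 _] XY /and3P[_ _ l3].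
have XY2 : mxclose r2 X Y by apply: mxcloseW XY; rewrite !ge_min lexx orbT.
have h1 := r1P y y1; have h2 := r2P q Y sY q2 XY2.
move: h1 h2 l3; rewrite lsc_envE ltr_norml /gap.
by move: (usc_env _ _ _) (usc_env _ _ _) (Ham_upper _ _) (Ham_upper _ _) => b1 b2 b3 b4; lra.
Qed.

(** * Perron's method *)

Implicit Type S : (V * R -> R) -> Prop.

(** The bound on the members makes the supremum finite, and continuous at time 0. *)
Record perron_family f c S : Prop := PerronFamily {
  perron_source : forall x, bounded_near (f : V -> R^o) (within setT (nbhs x));
  perron_subsol : forall v, S v -> visc_subsol f (fun=> 0) v;
  perron_bound : forall v z, S v -> 0 <= z.2 -> 0 <= v z <= c * z.2;
  perron_nonempty : exists v, S v }.

Definition supfam S z : R := sup [set v z | v in S].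

Lemma supfam_has_sup f c S z : perron_family f c S -> 0 <= z.2 -> has_sup [set v z | v in S].
Proof.
move=> [_ _ Sle [w0 Sw0]] z0; split; first by exists (w0 z); exists w0.
by exists (c * z.2) => _ [v Sv <-]; have /andP[] := Sle _ _ Sv z0.
Qed.

Lemma supfam_ge f c S v z : perron_family f c S -> S v -> 0 <= z.2 -> v z <= supfam S z.
Proof. by move=> F Sv z0; apply: (sup_upper_bound (supfam_has_sup F z0)); exists v. Qed.

Lemma supfam_lt f c S z a : perron_family f c S -> 0 <= z.2 -> a < supfam S z ->
  exists2 v, S v & a < v z.
Proof.
move=> F z0 az; have e0 : 0 < supfam S z - a by rewrite subr_gt0.
have [_ [v Sv <-]] := sup_adherent e0 (supfam_has_sup F z0).
by rewrite -/(supfam S z) subKr; exists v.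
Qed.

Lemma supfam_le f c S z : perron_family f c S -> 0 <= z.2 ->
  0 <= supfam S z <= c * z.2.
Proof.
move=> F z0; have [_ _ Sle [w0 Sw0]] := F; apply/andP; split.
  by apply: le_trans (supfam_ge F Sw0 z0); have /andP[] := Sle _ _ Sw0 z0.
apply: ge_sup; first by exists (w0 z); exists w0.
by move=> _ [v Sv <-]; have /andP[] := Sle _ _ Sv z0.
Qed.

Lemma supfam_locally_bounded f c S : perron_family f c S ->
  locally_bounded_on Q (supfam S).
Proof.
move=> F; apply/locally_boundedP => z z0; exists (`|c| * (z.2 + 1)), 1 => // w wt0 _ wz.
have /andP[h1 h2] := supfam_le F wt0; rewrite ger0_norm//.
apply: le_trans h2 _; apply: (@le_trans _ _ (`|c| * w.2)).
  by apply: ler_wpM2r => //; exact: ler_norm.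
apply: ler_wpM2l => //; move: wz; rewrite ltr_norml => /andP[_]; lra.
Qed.

Lemma small_radius r s t d : 0 < r -> r < 1 -> 0 < s -> 0 < t -> 0 < d ->
  exists k, [/\ 0 < k, k < 1, k <= r, k < s & k < t /\ k < d].
Proof.
move=> r0 r1 s0 t0 d0; pose m := Num.min r (Num.min s (Num.min t d)).
have m0 : 0 < m by rewrite !lt_min r0 s0 t0.
have /and4P[mr ms mt md] : [&& m <= r, m <= s, m <= t & m <= d].
  by rewrite !ge_min !lexx !orbT.
by exists (m / 2); move: m m0 mr ms mt md r1 => m *; split; [..|split]; lra.
Qed.

(** Suppose that the inequality fails at a jet at [z0].  Subtract a thin bump with
    that jet, so that the supremum has a strict maximum near [z0]; some member of the
    family almost reaches the supremum there, and its own maximum, after subtraction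
    of the bump, is attained in a small cylinder around [z0].  At that point the
    member has a jet close to the given one, where the inequality fails as well. *)
Lemma supfam_subsol_ineq f c S z0 p X tau : perron_family f c S -> 0 < z0.2 ->
  superjet (usc_env Q (supfam S)) z0 p X tau ->
  tau + Ham_lower p X <= usc_env setT f z0.1.
Proof.
move=> F t0 jU; have [bf Ssub _ _] := F; rewrite leNgt; apply/negP => strict.
have /superjetP[sX jUP] := jU.
have [del del0 delP] := strict_super_near bf sX strict.
have [e [r1 [e0 /andP[r10 r11] bumpP]]] := bump_jets_close z0 p tau sX del0.
have [r2 r20 r2P] := jUP e e0.
have [r [r0 rlt1 rr1 rr2 [rt rdel]]] := small_radius r10 r11 r20 t0 del0.
pose kap := e * r ^+ 2 / 8.
have r20' : 0 < r ^+ 2 by rewrite exprn_gt0.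
have kap0 : 0 < kap by rewrite divr_gt0// mulr_gt0.
pose eta := r ^+ 2 / 16; have eta0 : 0 < eta by rewrite divr_gt0.
have etaE : 2 * e * eta = kap by rewrite /eta /kap; field.
pose B := jet_bump z0 p X tau e eta.
pose Us := usc_env Q (supfam S).
have bU := supfam_locally_bounded F.
have [lB lNB] := lsc_at_bump z0 z0 p tau sX (ltW e0) eta0.
have [s s0 sP] := lNB _ kap0.
(* a point close to z0 where the supremum almost reaches the envelope *)
have [z1 [z1t z1r z1s] Uz1] : exists2 z1, [/\ 0 <= z1.2, enorm (z1.1 - z0.1) < Num.min s r &
    `|z1.2 - z0.2| < Num.min s r] & Us z0 - kap < supfam S z1.
  apply: contrapT => /forall2NP nex.
  have : Us z0 <= Us z0 - kap.
    apply: usc_le => //; first exact: ltW.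
    exists (Num.min s r); first by rewrite lt_min s0.
    move=> w wt w1 w2; rewrite leNgt; apply/negP => Uw.
    by case: (nex w) => // /not_and3P[].
  by rewrite leNgt gtrBl kap0.
have [v Sv vz1] := supfam_lt F z1t Uz1.
rewrite !lt_min in z1r z1s; case/andP: z1r => z1a z1b; case/andP: z1s => z1c z1d.
have Bz1 : B z1 < 2 * kap.
  have := sP z1 z1t z1a z1c; rewrite bump_center etaE -/B.
  by move: (B z1) => b; lra.
pose vs := usc_env Q v; have bv : locally_bounded_on Q v by have [] := Ssub _ Sv.
have vU w : 0 <= w.2 -> vs w <= Us w.
  move=> wt; apply: usc_mono => //; exists 1 => // w' wt' _ _.
  exact: supfam_ge F _ _.
have cylt w : cylinder z0.1 r (z0.2 - r) (z0.2 + r) w -> 0 <= w.2.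
  by move=> [_ /andP[h _]]; apply: le_trans h; rewrite subr_ge0 ltW.
have [z2 Cz2 z2max] : exists2 w, cylinder z0.1 r (z0.2 - r) (z0.2 + r) w &
    forall w', cylinder z0.1 r (z0.2 - r) (z0.2 + r) w' -> vs w' - B w' <= vs w - B w.
  apply: usc_attains_max; [exact: ltW|by rewrite lerD2l; move: r0; clear; lra|].
  move=> w Cw l wl; pose gap := (l - (vs w - B w)) / 2.
  have gap0 : 0 < gap by rewrite divr_gt0// subr_gt0.
  have vg : vs w < vs w + gap by rewrite ltrDl.
  have [s1 s10 s1P] := usc_lt bv (cylt w Cw) vg.
  have [lBw _] := lsc_at_bump z0 w p tau sX (ltW e0) eta0.
  have [s2 s20 s2P] := lBw _ gap0.
  exists (Num.min s1 s2); first by rewrite lt_min s10.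
  move=> w' Cw'; rewrite !lt_min => /andP[h1 h2] /andP[h3 h4].
  have h5 : vs w' < vs w + gap by exact: s1P (cylt w' Cw') h1 h3.
  have h6 : B w - gap < B w' by exact: s2P (cylt w' Cw') h2 h4.
  move: h5 h6; rewrite /gap; clear.
  by move: (vs w) (vs w') (B w) (B w') => b1 b2 b3 b4; lra.
have Cz1 : cylinder z0.1 r (z0.2 - r) (z0.2 + r) z1.
  split; first exact: ltW.
  by rewrite -ler_distl ltW.
have z2t := cylt z2 Cz2.
case: (Cz2) => z2r /andP[z2a z2b].
have z2s : `|z2.2 - z0.2| <= r by rewrite ler_distl z2a.
have low : Us z0 - 3 * kap < vs z2 - B z2.
  apply: lt_le_trans (z2max z1 Cz1).
  have := usc_ge bv z1t; rewrite -/vs; move: vz1 Bz1; clear.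
  by move: (Us z0) (v z1) (vs z1) (B z1) => b1 b2 b3 b4; lra.
have up : vs z2 - B z2 <= Us z0 - e * gauge z2 z0.
  have h1 := vU z2 z2t.
  have h2 := r2P z2 z2t (le_lt_trans z2r rr2) (le_lt_trans z2s rr2).
  have h3 := bump_ge z0 p X tau z2 (ltW e0) eta0; rewrite -/B in h3.
  move: h1 h2 h3; rewrite /quadratic -/(gauge z2 z0) -/Us; clear.
  move: (Us z0) (Us z2) (vs z2) (B z2) (gauge _ _) (2^-1 * _) (dotp _ _) => b1 b2 b3 b4 b5 b6 b7.
  lra.
have gz2 : gauge z2 z0 < r ^+ 2.
  rewrite -(ltr_pM2l e0); move: low up kap0; rewrite /kap; clear.
  by move: (e * _) (e * _) (Us z0) (vs z2 - _) => b1 b2 b3 b4; lra.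
have z2r' : enorm (z2.1 - z0.1) < r.
  rewrite ltNge; apply/negP => /(le_sqr (ltW r0)) h.
  by have := lt_le_trans gz2 h; rewrite ltNge /gauge lerDr normr_ge0.
have z2s' : `|z2.2 - z0.2| < r.
  apply: (@lt_le_trans _ _ (r ^+ 2)); last by rewrite expr2 ler_piMr// ltW.
  by apply: le_lt_trans gz2; rewrite /gauge lerDl exprn_ge0// enorm_ge0.
have z2t' : 0 < z2.2 by apply: lt_le_trans z2a; rewrite subr_gt0.
have [q [Y [l [jB sY qp XY lt]]]] := bumpP eta z2 eta0 (le_trans z2r rr1).
have jv : superjet vs z2 q Y l.
  have rad0 : 0 < Num.min (r - enorm (z2.1 - z0.1)) (r - `|z2.2 - z0.2|).
    by rewrite lt_min !subr_gt0 z2r'.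
  apply: (superjet_le rad0 _ jB) => w wt.
  rewrite !lt_min => /andP[h1 _] /andP[_ h2].
  have Cw : cylinder z0.1 r (z0.2 - r) (z0.2 + r) w.
    split.
      rewrite -(subrKA z2.1); apply: le_trans (enormD _ _) _.
      by move: h1; clear; move: (enorm _) (enorm _) => b1 b2; lra.
    have : `|w.2 - z0.2| <= r.
      rewrite -(subrKA z2.2); apply: le_trans (ler_normD _ _) _.
      by move: h2; clear; move: (`|_|) (`|_|) => b1 b2; lra.
    by rewrite ler_distl.
  have := z2max w Cw; rewrite -/B.
  by move: (vs w) (vs z2) (B w) (B z2) => b1 b2 b3 b4; lra.
have z2del : enorm (z2.1 - z0.1) < del by exact: lt_trans rdel.
have := delP _ _ _ _ z2del sY qp XY lt.
have [_ _ vP] := Ssub _ Sv.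
have jv' : superjet (usc_env Q v) (z2.1, z2.2) q Y l by rewrite -surjective_pairing.
by have := vP _ _ z2t' _ _ _ jv'; rewrite leNgt => /negP.
Qed.

Lemma supfam_initial f c S x : perron_family f c S -> 0 <= c ->
  usc_env Q (supfam S) (x, 0) <= 0.
Proof.
move=> F c0; have bU := supfam_locally_bounded F.
apply/ler_addgt0Pr => e e0; rewrite add0r; apply: usc_le => //.
have c1 : 0 < c + 1 by rewrite ltr_wpDl.
exists (e / (c + 1)); first by rewrite divr_gt0.
move=> w wt _; rewrite /= subr0 (ger0_norm wt) ltr_pdivlMr// => h.
have /andP[_ h2] := supfam_le F wt; apply: le_trans h2 _.
by apply: le_trans (ltW h); rewrite mulrC; apply: ler_wpM2l => //; rewrite lerDl.
Qed.

Lemma supfam_subsol f c S : perron_family f c S -> 0 <= c ->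
  visc_subsol f (fun=> 0) (supfam S).
Proof.
move=> F c0; split; [exact: supfam_locally_bounded F|by move=> x; exact: supfam_initial F c0|].
by move=> x0 t0 t00 p X tau; exact: (supfam_subsol_ineq (z0 := (x0, t0)) F).
Qed.

(** If the supremum failed to be a supersolution at [z0], a bump lifted slightly
    above its lower envelope would be a subsolution near [z0]; the maximum of the
    supremum and of this bump, glued where the bump is lower, is again a member of
    the family, and is larger than the supremum near [z0]. *)
Lemma supfam_supersol f c S : perron_family f c S -> 0 <= c ->
  compactly_supported_in_space (supfam S) ->
  (forall v, visc_subsol f (fun=> 0) v -> compactly_supported_in_space v ->
    (forall z, 0 <= z.2 -> 0 <= v z) -> S v) ->
  visc_supersol f (fun=> 0) (supfam S).
Proof.
move=> F c0 cSU Smax; have [bf Ssub _ _] := F.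
have bU := supfam_locally_bounded F.
have bNU := locally_boundedN bU.
split=> //.
  move=> x; rewrite lsc_envE oppr_ge0; apply: usc_le => //; exists 1 => // w wt _ _.
  by rewrite oppr_le0; have /andP[] := supfam_le F wt.
move=> x0 t0 t00 p X tau; rewrite /subjet.
pose b := usc_env Q (fun w => - supfam S w).
have -> : (fun w => - lsc_env Q (supfam S) w) = b.
  by apply/funext => w; rewrite lsc_envE opprK.
pose P := - p; pose Xh := - X; pose th := - tau.
rewrite -/P -/Xh -/th => jb; rewrite leNgt; apply/negP => strict.
have /superjetP[sXh jbP] := jb.
have sX : X^T = X by rewrite -[X]opprK -/Xh linearN/= sXh.
have [del del0 delP] := strict_sub_near bf sX strict.
pose z0 : V * R := (x0, t0).
have [e [r1 [e0 /andP[r10 r11] bumpP]]] := bump_jets_close z0 P th sXh del0.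
have [r2 r20] := jbP e e0; rewrite -/z0 => r2P.
have [r [r0 rlt1 rr1 rr2 [rt rdel]]] := small_radius r10 r11 r20 t00 del0.
pose kap := e * r ^+ 2 / 8.
have r20' : 0 < r ^+ 2 by rewrite exprn_gt0.
have kap0 : 0 < kap by rewrite divr_gt0// mulr_gt0.
(* the height of the bump at z0 uses half of the lift kap of psi *)
pose eta := r ^+ 2 / 32; have eta0 : 0 < eta by rewrite divr_gt0.
have etaE : 2 * e * eta = kap / 2 by rewrite /eta /kap; field.
pose B := jet_bump z0 P Xh th e eta.
pose psi w : R := kap - b z0 - B w.
pose inside w : bool := (enorm (w.1 - x0) < r) && (`|w.2 - t0| < r).
have insr2 w : inside w -> enorm (w.1 - z0.1) < r2 /\ `|w.2 - z0.2| < r2.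
  by move=> /andP[h1 h2]; split; [exact: lt_trans rr2|exact: lt_trans rr2].
have insT w : inside w -> 0 < w.2.
  by move=> /andP[_]; rewrite ltr_norml => /andP[h _]; move: rt h; lra.
(* psi stays below the lower envelope except in the middle of the cylinder *)
have psi_le w : 0 <= w.2 -> inside w -> psi w <= supfam S w + kap - e * gauge w z0.
  move=> wt iw; have [h1 h2] := insr2 w iw.
  have h3 := r2P w wt h1 h2.
  have h4 := bump_ge z0 P Xh th w (ltW e0) eta0; rewrite -/B in h4.
  have h5 : - supfam S w <= b w by exact: usc_ge bNU wt.
  move: h3 h4 h5; rewrite /quadratic -/(gauge w z0) /psi; clear.
  move: (b w) (b z0) (B w) (supfam S w) (gauge _ _) (2^-1 * _) (dotp _ _) => b1 b2 b3 b4 b5 b6 b7.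
  lra.
pose v w : R := if inside w then Num.max (supfam S w) (psi w) else (supfam S) w.
have Uv w : supfam S w <= v w by rewrite /v; case: ifP => // _; rewrite le_max lexx.
have vU w : 0 <= w.2 -> v w <= supfam S w + kap.
  move=> wt; rewrite /v; case: ifP => [iw|_]; last by rewrite lerDl ltW.
  rewrite ge_max lerDl (ltW kap0)/=; apply: le_trans (psi_le w wt iw) _.
  by rewrite gerBl mulr_ge0 ?gauge_ge0// ltW.
have far w : 0 <= w.2 -> r / 2 < enorm (w.1 - x0) \/ r / 2 < `|w.2 - t0| -> v w = (supfam S) w.
  move=> wt wfar; rewrite /v; case: ifP => // iw; apply/max_idPl.
  apply: le_trans (psi_le w wt iw) _; rewrite -addrA gerDl subr_le0 /kap.
  rewrite -mulrA; apply: ler_wpM2l; first exact: ltW.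
  have h1 : r ^+ 2 / 8 <= r / 2 by rewrite expr2; move: r0 rlt1; clear; nra.
  have h2 : r ^+ 2 / 8 <= (r / 2) ^+ 2 by rewrite exprMn; move: (sqr_ge0 r); clear; lra.
  case: wfar => wfar.
    apply: le_trans h2 _; rewrite /gauge; apply: le_trans (_ : enorm (w.1 - z0.1) ^+ 2 <= _).
      by apply: le_sqr; [rewrite divr_ge0// ltW|exact: ltW].
    by rewrite lerDr.
  apply: le_trans h1 _; rewrite /gauge; apply: le_trans (ltW wfar) _.
  by rewrite lerDl exprn_ge0// enorm_ge0.
have bv : locally_bounded_on Q v.
  apply/locally_boundedP => z zt; have [M [s s0 sP]] := (locally_boundedP (supfam S)).1 bU z zt.
  exists (M + kap), s => // w wt w1 w2.
  have /andP[U0 _] := supfam_le F wt.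
  have := sP w wt w1 w2; rewrite !ger0_norm//; last exact: le_trans (Uv w).
  by move=> h; apply: le_trans (vU w wt) _; rewrite lerD2r.
have UvS z : 0 <= z.2 -> usc_env Q (supfam S) z <= usc_env Q v z.
  by move=> zt; apply: usc_mono => //; exists 1.
have farS z : 0 <= z.2 -> r / 2 < enorm (z.1 - x0) \/ r / 2 < `|z.2 - t0| ->
    usc_env Q v z <= usc_env Q (supfam S) z.
  move=> zt zfar; apply: usc_mono => //.
  case: zfar => zfar.
    exists (enorm (z.1 - x0) - r / 2); first by rewrite subr_gt0.
    move=> w wt w1 _; rewrite far//; left.
    have := enormD (z.1 - w.1) (w.1 - x0); rewrite subrKA -(enormN (z.1 - w.1)) opprB.
    by move: w1; clear; move: (enorm _) (enorm _) (enorm _) => b1 b2 b3; lra.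
  exists (`|z.2 - t0| - r / 2); first by rewrite subr_gt0.
  move=> w wt _ w2; rewrite far//; right.
  have := ler_normD (z.2 - w.2) (w.2 - t0); rewrite subrKA -(normrN (z.2 - w.2)) opprB.
  by move: w2; clear; move: (`|_|) (`|_|) (`|_|) => b1 b2 b3; lra.
have psi_lsc z : lsc_at (fun w => - psi w) z /\ lsc_at psi z.
  have [l1 l2] := lsc_at_bump z0 z P th sXh (ltW e0) eta0.
  split=> eps eps0.
    have [s s0 sP] := l1 _ eps0; exists s => // w wt w1 w2.
    have := sP w wt w1 w2; rewrite /psi -/B; clear.
    by move: (B w) (B z) (b z0) => b1 b2 b3; lra.
  have [s s0 sP] := l2 _ eps0; exists s => // w wt w1 w2.
  have := sP w wt w1 w2; rewrite /psi -/B; clear.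
  by move: (B w) (B z) (b z0) => b1 b2 b3; lra.
have f_lsc_usc x : lsc_env setT f x <= usc_env setT f x.
  apply: (@le_trans _ _ (f x)); last exact: usc_setT_ge.
  rewrite lsc_envE lerNl.
  by apply: (@usc_setT_ge _ (fun y => - f y)); have FF := nbhs_setT_proper x; exact: bounded_nearN.
have vsub : visc_subsol f (fun=> 0) v.
  split=> //.
    move=> x; apply: le_trans (supfam_initial x F c0); apply: farS => //; right => /=.
    by rewrite sub0r normrN gtr0_norm//; move: rt r0; clear; lra.
  move=> x t tt q Y l jv; pose z : V * R := (x, t).
  have zt : 0 <= z.2 := ltW tt.
  have [vz|zv] := leP (usc_env Q v z) (usc_env Q (supfam S) z).
    apply: (supfam_subsol_ineq (z0 := z) F) => //.
    apply: (superjet_ge ltr01 _ _ jv); first by apply/eqP; rewrite eq_le vz UvS.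
    by move=> w wt _ _; exact: UvS.
  have iz : inside z.
    rewrite /inside; apply/negP => /negP; rewrite negb_and -!leNgt => nz.
    have zfar : r / 2 < enorm (z.1 - x0) \/ r / 2 < `|z.2 - t0|.
      by case/orP: nz => nz; [left|right]; apply: lt_le_trans nz; move: r0; clear; lra.
    by move: zv; rewrite ltNge farS.
  have izn : exists2 s, 0 < s & forall w, enorm (w.1 - z.1) < s -> `|w.2 - z.2| < s -> inside w.
    case/andP: iz => i1 i2.
    exists (Num.min (r - enorm (z.1 - x0)) (r - `|z.2 - t0|)).
      by rewrite lt_min !subr_gt0 i1.
    move=> w; rewrite !lt_min => /andP[h1 _] /andP[_ h2]; apply/andP; split.
      rewrite -(subrKA z.1); apply: le_lt_trans (enormD _ _) _.
      by move: h1; clear; move: (enorm _) (enorm _) => b1 b2; lra.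
    rewrite -(subrKA z.2); apply: le_lt_trans (ler_normD _ _) _.
    by move: h2; clear; move: (`|_|) (`|_|) => b1 b2; lra.
  have [s s0 sP] := izn.
  have psiv w : 0 <= w.2 -> inside w -> psi w <= usc_env Q v w.
    move=> wt iw; apply: le_trans (usc_ge bv wt).
    by rewrite /v iw le_max lexx orbT.
  have vpsi : usc_env Q v z = psi z.
    apply/eqP; rewrite eq_le psiv// andbT.
    apply/ler_addgt0Pr => eps eps0.
    have [l1 _] := psi_lsc z; have [s1 s10 s1P] := l1 _ eps0.
    pose a := Num.max (usc_env Q (supfam S) z) (psi z) + eps.
    have Ua : usc_env Q (supfam S) z < a by rewrite /a ltr_pwDr// le_max lexx.
    have [s2 s20 s2P] := usc_lt0 bU zt Ua.
    have va : usc_env Q v z <= a.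
      apply: usc_le => //; exists (Num.min s1 s2); first by rewrite lt_min s10.
      move=> w wt; rewrite !lt_min => /andP[h1 h2] /andP[h3 h4].
      have h5 := s1P w wt h1 h3; have h6 := ltW (s2P w wt h2 h4).
      have h7 : psi w <= a.
        apply: (@le_trans _ _ (psi z + eps)); last by rewrite /a lerD2r le_max lexx orbT.
        by move: h5; clear; move: (psi w) (psi z) => b1 b2; lra.
      by rewrite /v; case: ifP => // _; rewrite ge_max h6.
    have [pU|Up] := leP (usc_env Q (supfam S) z) (psi z).
      by move: va; rewrite /a (max_idPr pU).
    exfalso; have : usc_env Q v z <= usc_env Q (supfam S) z.
      apply/ler_addgt0Pr => eps' eps'0.
      have Ua' : usc_env Q (supfam S) z < usc_env Q (supfam S) z + eps' by rewrite ltrDl.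
      have [s4 s40 s4P] := usc_lt0 bU zt Ua'.
      have [s5 s50 s5P] := l1 _ eps'0.
      apply: usc_le => //; exists (Num.min s4 s5); first by rewrite lt_min s40.
      move=> w wt; rewrite !lt_min => /andP[h1 h2] /andP[h3 h4].
      have h5 := ltW (s4P w wt h1 h3); have h6 := s5P w wt h2 h4.
      rewrite /v; case: ifP => // _; rewrite ge_max h5/=.
      by move: h6 Up; clear; move: (psi w) (psi z) (usc_env _ _ _) => b1 b2 b3; lra.
    by rewrite leNgt zv.
  have jpsi : superjet psi z q Y l.
    apply: (superjet_ge s0 _ _ jv); first by rewrite vpsi.
    by move=> w wt w1 w2; apply: psiv => //; exact: sP.
  have zr : enorm (z.1 - z0.1) <= r1.
    by case/andP: iz => i1 _; apply: le_trans rr1; exact: ltW.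
  have [q' [Y' [l' [jB sY' q'P Y'X l't]]]] := bumpP eta z eta0 zr.
  have jNpsi : superjet (fun w => - psi w) z q' Y' l'.
    apply: (superjet_le ltr01 _ jB) => w wt _ _.
    rewrite /psi -/B.
    by move: (B w) (B z) (b z0) => b1 b2 b3; lra.
  have tz : 0 < z.2 by [].
  have [qE lE YY'] := superjet_opposite tz jpsi jNpsi.
  have sNY' : (- Y')^T = - Y' by rewrite linearN/= sY'.
  have /superjetP[sY _] := jv.
  have h1 : l + Ham_lower q Y <= l + Ham_lower q (- Y').
    by rewrite lerD2l; exact: Ham_lower_mono.
  apply: le_trans h1 _.
  have h2 : l + Ham_lower q (- Y') <= l + Ham_upper q (- Y').
    by rewrite lerD2l; exact: Ham_lower_upper.
  apply: le_trans h2 _; apply: le_trans (f_lsc_usc x); apply/ltW/delP => //.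
  - by case/andP: iz => i1 _; exact: lt_trans rdel.
  - by rewrite qE -[p]opprK -/P -opprD enormN.
  - by move=> i j; have := Y'X i j; rewrite !mxE -normrN opprD !opprK.
  - by rewrite lE -[tau]opprK -/th -opprD normrN.
have vcs : compactly_supported_in_space v.
  move=> T T0; have [s s0 sP] := cSU T T0.
  exists (Num.max s (enorm x0 + r)); first by rewrite lt_max s0.
  move=> x t nx tT; rewrite /v ifF.
    by apply: sP => //; apply: contra_not nx; rewrite /eball/= lt_max => ->.
  apply/negP => /andP[/= h _]; apply: nx; rewrite /eball/= subr0 lt_max.
  apply/orP; right; rewrite -(subrK x0 x) addrC; apply: le_lt_trans (enormD _ _) _.
  by rewrite ltrD2l.
have Sv : S v.
  apply: Smax => // z zt; apply: le_trans (Uv z).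
  by have /andP[] := supfam_le F zt.
(* the supremum would exceed itself near z0 *)
pose gap := kap / 4; have gap0 : 0 < gap by rewrite divr_gt0.
have psi0 : psi z0 = kap / 2 - b z0.
  by rewrite /psi /B bump_center etaE; field.
have [_ l2] := psi_lsc z0; have [s s0 sP] := l2 _ gap0.
have : b z0 <= b z0 - gap.
  apply: usc_le => //; first exact: ltW.
  exists (Num.min s r); first by rewrite lt_min s0.
  move=> w wt; rewrite !lt_min => /andP[h1 h2] /andP[h3 h4].
  have iw : inside w by rewrite /inside h2.
  have h5 := sP w wt h1 h3.
  have h6 : psi w <= (supfam S) w.
    by apply: le_trans (supfam_ge F Sv wt); rewrite /v iw le_max lexx orbT.
  move: h5 h6; rewrite psi0 /gap; clear.
  by move: (b z0) (psi w) (supfam S w) => b1 b2 b3; lra.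
by rewrite leNgt gtrBl gap0.
Qed.

(** * The unit disc as a stationary front *)

Definition disc c : V * R -> R := fun w => if enorm w.1 <= 1 then c * w.2 else 0.

Lemma disc_in c x t : enorm x <= 1 -> disc c (x, t) = c * t.
Proof. by rewrite /disc /= => ->. Qed.

Lemma disc_bounds c w : 0 <= c -> 0 <= w.2 -> 0 <= disc c w <= c * w.2.
Proof. by move=> c0 w0; rewrite /disc; case: ifP; rewrite lexx mulr_ge0. Qed.

Lemma disc_locally_bounded c : 0 <= c -> locally_bounded_on Q (disc c).
Proof.
move=> c0; apply/locally_boundedP => z z0; exists (c * (z.2 + 1)), 1 => // w w0 _ wz.
have /andP[h1 h2] := disc_bounds c0 w0; rewrite ger0_norm//; apply: le_trans h2 _.
by apply: ler_wpM2l => //; move: wz; rewrite ltr_norml => /andP[_]; lra.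
Qed.

Lemma disc_compact_support c : compactly_supported_in_space (disc c).
Proof.
move=> T _; exists 2 => // x t nx _; rewrite /disc/= ifF//; apply/negP => x1; apply: nx.
by rewrite /eball/= subr0; lra.
Qed.

Lemma disc_usc c z : 0 < c -> 0 <= z.2 -> usc_env Q (disc c) z = disc c z.
Proof.
move=> c0 z0; have bd := disc_locally_bounded (ltW c0).
apply/eqP; rewrite eq_le (usc_ge bd z0) andbT; have [z1|z1] := lerP (enorm z.1) 1.
  rewrite {2}/disc z1; apply/ler_addgt0Pr => e e0; apply: usc_le => //.
  exists (e / c); first by rewrite divr_gt0.
  move=> w w0 _; rewrite ltr_pdivlMr// => wz; have /andP[_ h] := disc_bounds (ltW c0) w0.
  apply: le_trans h _; rewrite -lerBlDl -mulrBr mulrC; apply: le_trans (ltW wz).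
  by rewrite ler_pM2r// ler_norm.
have -> : disc c z = 0 by rewrite /disc leNgt z1.
apply: usc_le => //; exists (enorm z.1 - 1); first by rewrite subr_gt0.
move=> w _ wz _; rewrite /disc ifF//; apply/negbTE; rewrite -ltNge.
have := enormD (z.1 - w.1) w.1; rewrite subrK -(enormN (z.1 - w.1)) opprB.
by move: wz; clear; move: (enorm _) (enorm _) (enorm _) => b1 b2 b3; lra.
Qed.

Lemma disc_flat_curve c z p X tau y q r : 0 <= z.2 -> superjet (disc c) z p X tau ->
  enorm z.1 <= 1 -> 0 < r ->
  (forall h, 0 < h < r -> enorm (z.1 + h *: y + h ^+ 2 *: q) <= 1) ->
  0 <= dotp p y /\ (dotp p y = 0 -> 0 <= dotp p q + 2^-1 * dotp (y *m X) y).
Proof.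
move=> z0 jd z1 r0 inside; apply: (superjet_flat_curve z0 jd r0) => h /inside h1.
by rewrite /disc z1/= h1.
Qed.

(** A short segment that starts at [z.1] and enters the disc stays in it. *)
Lemma disc_inward c z p X tau y : 0 <= z.2 -> superjet (disc c) z p X tau ->
  enorm z.1 <= 1 -> enorm z.1 < 1 \/ dotp z.1 y < 0 ->
  0 <= dotp p y /\ (dotp p y = 0 -> 0 <= dotp (y *m X) y).
Proof.
move=> z0 jd z1 zy; suff [r r0 rP] : exists2 r, 0 < r &
    forall h, 0 < h < r -> enorm (z.1 + h *: y + h ^+ 2 *: 0) <= 1.
  have [h1 h2] := disc_flat_curve z0 jd z1 r0 rP; split=> // /h2.
  by rewrite (_ : dotp p 0 = 0) ?add0r ?pmulr_rge0 ?invr_gt0// dotp2 !mxE; ring.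
have y1 : 0 < enorm y + 1 by rewrite ltr_wpDl// enorm_ge0.
case: zy => zy.
  exists ((1 - enorm z.1) / (enorm y + 1)); first by rewrite divr_gt0// subr_gt0.
  move=> h /andP[h0]; rewrite ltr_pdivlMr// => h1; rewrite scaler0 addr0.
  apply: le_trans (enormD _ _) _; rewrite enormZ ?(ltW h0)//.
  by move: h1 h0; clear; move: (enorm _) (enorm _) => b1 b2; nra.
exists (- dotp z.1 y / (enorm y ^+ 2 + 1)).
  by rewrite divr_gt0 ?oppr_gt0// ltr_wpDl// sqr_ge0.
move=> h /andP[h0]; rewrite ltr_pdivlMr ?ltr_wpDl ?sqr_ge0// => h1; rewrite scaler0 addr0.
apply: le_of_sqr => //; have := le_sqr (enorm_ge0 _) z1; rewrite !enorm_sqr !mxE expr1n.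
move: h1 h0 zy; rewrite enorm_sqr dotp2; clear.
move: (z.1 0 0) (z.1 0 1) (y 0 0) (y 0 1) => a1 a2 b1 b2 h1 h0 h2 h3.
have := ltW (mulr_gt0 h0 h0); have := ler_wpM2l (ltW h0) (ltW h1); nra.
Qed.

(** For [k > 1/2] the parabola bends towards the centre faster than the unit circle,
    and so stays in the disc near [z.1]. *)
Lemma disc_tangential c z p X tau y k : 0 <= z.2 -> superjet (disc c) z p X tau ->
  enorm z.1 = 1 -> dotp z.1 y = 0 -> 2^-1 < k ->
  0 <= dotp p y /\
  (dotp p y = 0 -> 0 <= - (k * enorm y ^+ 2) * dotp p z.1 + 2^-1 * dotp (y *m X) y).
Proof.
move=> z0 jd z1 zy k2; have k0 : 0 < k by apply: lt_trans k2; rewrite invr_gt0.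
have z1' : enorm z.1 <= 1 by rewrite z1.
pose N := enorm y ^+ 2; have N0 : 0 <= N by rewrite sqr_ge0.
have [r r0 rP] : exists2 r, 0 < r & forall h, 0 < h < r ->
    enorm (z.1 + h *: y + h ^+ 2 *: (- (k * N) *: z.1)) <= 1.
  exists (Num.min 1 ((2 * k - 1) / (k ^+ 2 * N + 1))).
    rewrite lt_min ltr01 divr_gt0//; first by lra.
    by rewrite ltr_wpDl// mulr_ge0// sqr_ge0.
  move=> h; rewrite lt_min => /and3P[h0 h1].
  rewrite ltr_pdivlMr; last by rewrite ltr_wpDl// mulr_ge0// sqr_ge0.
  move=> h2; apply: le_of_sqr => //; rewrite expr1n enorm_sqr !mxE.
  have zE : z.1 0 0 ^+ 2 + z.1 0 1 ^+ 2 = 1 by rewrite -enorm_sqr z1 expr1n.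
  have NE : y 0 0 ^+ 2 + y 0 1 ^+ 2 = N by rewrite -enorm_sqr.
  move: zy zE NE; rewrite dotp2.
  move: (z.1 0 0) (z.1 0 1) (y 0 0) (y 0 1) => a1 a2 b1 b2 zy zE NE.
  rewrite (_ : _ + _ = (1 - k * N * h ^+ 2) ^+ 2 * (a1 ^+ 2 + a2 ^+ 2)
     + 2 * h * (1 - k * N * h ^+ 2) * (a1 * b1 + a2 * b2)
     + h ^+ 2 * (b1 ^+ 2 + b2 ^+ 2)); last by ring.
  rewrite zE zy NE mulr1 mulr0 addr0.
  rewrite (_ : _ + _ = 1 - N * h ^+ 2 * (2 * k - 1 - k ^+ 2 * N * h ^+ 2)); last by ring.
  rewrite gerBl; apply: mulr_ge0; first by rewrite mulr_ge0// sqr_ge0.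
  have h3 : k ^+ 2 * N * h ^+ 2 <= k ^+ 2 * N * h.
    by apply: ler_wpM2l; [rewrite mulr_ge0// sqr_ge0|rewrite expr2 ler_piMl// ltW].
  move: h3 h2 h0; rewrite mulrDr mulr1 (mulrC h); clear.
  by move: (_ * h) (_ * h ^+ 2) => b3 b4; lra.
have [h1 h2] := disc_flat_curve z0 jd z1' r0 rP; split=> // /h2.
by rewrite (_ : dotp p _ = - (k * N) * dotp p z.1)//; rewrite !dotp2 !mxE; ring.
Qed.

Lemma Ham_lower0_le0 X : X^T = X -> (forall y, 0 <= dotp (y *m X) y) ->
  Ham_lower 0 X <= 0.
Proof.
move=> sX X0; apply: le_trans (_ : Ham_lower 0 0 <= 0); last first.
  by apply: le_trans _ (Ham_upper00 _); apply: Ham_lower_upper; rewrite trmx0.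
apply: Ham_lower_mono => //; first by rewrite trmx0.
by move=> y; rewrite (_ : dotp (y *m 0) y = 0)// quad2 !mxE; ring.
Qed.

(** At a boundary point [x], the directions that enter the disc force
    [p = - lam x] with [lam >= 0].  For the unit tangent [T], letting [k] decrease
    to 1/2 in [disc_tangential] gives [0 <= lam + X T . T], which is the
    inequality claimed: the level line bends at most like the unit circle. *)
Lemma disc_Ham c z p X tau : 0 <= z.2 -> superjet (disc c) z p X tau ->
  enorm z.1 <= 1 -> Ham_lower p X <= 0.
Proof.
move=> z0 jd z1; have /superjetP[sX _] := jd.
have quadN y : dotp ((- y) *m X) (- y) = dotp (y *m X) y by rewrite !quad2 !mxE; ring.
move: z1; rewrite le_eqVlt => /orP[/eqP z1|z1]; last first.
  have jin y := disc_inward (y := y) z0 jd (ltW z1) (or_introl z1).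
  have p0 : p = 0 by apply: dotpN_ge0; have [] := jin (- p).
  rewrite p0; apply: Ham_lower0_le0 => // y; have [_] := jin y; apply.
  by rewrite p0 dotp2 !mxE; ring.
have z1' : enorm z.1 <= 1 by rewrite z1.
have zE : z.1 0 0 ^+ 2 + z.1 0 1 ^+ 2 = 1 by rewrite -enorm_sqr z1 expr1n.
have zN : dotp z.1 (- z.1) < 0.
  by rewrite dotp2 !mxE; move: zE; clear; move: (z.1 0 0) (z.1 0 1) => a1 a2; lra.
pose lam := dotp p (- z.1).
have lam0 : 0 <= lam by have [] := disc_inward z0 jd z1' (or_intror zN).
pose T := vec2 (- z.1 0 1) (z.1 0 0).
have zT : dotp z.1 T = 0 by rewrite dotp2 !vec2E; ring.
have zNT : dotp z.1 (- T) = 0 by rewrite dotp2 !mxE /=; ring.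
have one : 2^-1 < 1 :> R by lra.
have pT : dotp p T = 0.
  have [h1 _] := disc_tangential z0 jd z1 zT one.
  have [h2 _] := disc_tangential z0 jd z1 zNT one.
  have pNT : dotp p (- T) = - dotp p T by rewrite !dotp2 !mxE /=; ring.
  by apply/eqP; rewrite eq_le h1 andbT -oppr_ge0 -pNT.
have pE : p = (- lam) *: z.1.
  have e1 : - p 0 0 * z.1 0 1 + p 0 1 * z.1 0 0 = 0.
    by rewrite -pT dotp2 !vec2E; ring.
  move: e1 zE; rewrite /lam dotp2 !mxE => e1 zE.
  apply: rV2P; rewrite !mxE.
    transitivity (p 0 0 * (z.1 0 0 ^+ 2 + z.1 0 1 ^+ 2)); first by rewrite zE mulr1.
    by apply/eqP; rewrite -subr_eq0 -(mulr0 (- z.1 0 1)) -e1; apply/eqP; ring.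
  transitivity (p 0 1 * (z.1 0 0 ^+ 2 + z.1 0 1 ^+ 2)); first by rewrite zE mulr1.
  by apply/eqP; rewrite -subr_eq0 -(mulr0 (z.1 0 0)) -e1; apply/eqP; ring.
have pz : dotp p z.1 = - lam by rewrite /lam !dotp2 !mxE; ring.
have [lz|lpos] := eqVneq lam 0.
  have p0 : p = 0 by rewrite pE lz oppr0 scale0r.
  have p0y y : dotp p y = 0 by rewrite p0 dotp2 !mxE; ring.
  rewrite p0; apply: Ham_lower0_le0 => // y.
  case: (ltgtP (dotp z.1 y) 0) => zy.
  - by have [_] := disc_inward z0 jd z1' (or_intror zy); apply.
  - have zNy : dotp z.1 (- y) < 0.
      by move: zy; rewrite !dotp2 !mxE; clear; move: (z.1 0 0) (z.1 0 1) => a1 a2; lra.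
    by have [_] := disc_inward z0 jd z1' (or_intror zNy); rewrite quadN; apply.
  - have [_ /(_ (p0y _))] := disc_tangential z0 jd z1 zy one.
    by rewrite p0y mulr0 add0r pmulr_rge0// invr_gt0.
have lgt0 : 0 < lam by rewrite lt_def lpos.
have p0 : p != 0.
  rewrite pE; apply/eqP => h; have := congr1 (fun q => dotp q q) h.
  have -> : dotp (- lam *: z.1) (- lam *: z.1) = lam ^+ 2 * (z.1 0 0 ^+ 2 + z.1 0 1 ^+ 2).
    by rewrite dotp2 !mxE; ring.
  rewrite zE mulr1 dotp2 !mxE => /eqP; rewrite mul0r addr0 => /eqP h2.
  by move: (exprn_gt0 2 lgt0); rewrite h2 ltxx.
have TN : enorm T ^+ 2 = 1 by rewrite enorm_sqr !vec2E sqrrN addrC.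
have curvature : 0 <= lam + dotp (T *m X) T.
  apply/ler_addgt0Pr => e e0.
  have k2 : 2^-1 < 2^-1 + e / (2 * lam) by rewrite ltrDl divr_gt0// mulr_gt0.
  have [_ /(_ pT)] := disc_tangential z0 jd z1 zT k2.
  rewrite TN mulr1 pz mulrNN mulrDl => h; rewrite -(pmulr_rge0 _ (_ : 0 < 2^-1 :> R)) ?invr_gt0//.
  suff -> : 2^-1 * (lam + dotp (T *m X) T + e) =
     2^-1 * lam + e / (2 * lam) * lam + 2^-1 * dotp (T *m X) T by [].
  by field; rewrite gt_eqF.
apply: le_trans (Ham_lower_le_Ham sX p0) _.
have pN : enorm p = lam.
  apply/eqP; rewrite -(@eqrXn2 _ 2%N) ?enorm_ge0// enorm_sqr pE !mxE.
  by rewrite !exprMn sqrrN -mulrDr zE mulr1.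
rewrite /Ham /= trsigma2// -enorm_sqr pN.
suff -> : p 0 1 ^+ 2 * X 0 0 - p 0 0 * p 0 1 * (X 0 1 + X 1 0) + p 0 0 ^+ 2 * X 1 1 =
    lam ^+ 2 * dotp (T *m X) T.
  by rewrite [_ * dotp _ _]mulrC mulfK ?expf_neq0//; move: curvature; clear; lra.
by rewrite quad2 !vec2E {1 2 3 4}pE !mxE; ring.
Qed.

(** Inside the disc the growth rate [c] equals the source, and outside the
    function is constant; on the unit circle [disc_Ham] applies. *)
Lemma disc_subsol c : 0 < c -> visc_subsol (source c 1) (fun=> 0) (disc c).
Proof.
move=> c0; have bd := disc_locally_bounded (ltW c0); split=> // [x|x t t0 p X tau jU].
  by rewrite disc_usc// /disc/= mulr0; case: ifP.
have t0' : 0 <= t := ltW t0.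
have jd : superjet (disc c) (x, t) p X tau.
  apply: (superjet_ge ltr01 _ _ jU); first by rewrite disc_usc.
  by move=> w w0 _ _; rewrite disc_usc.
apply: le_trans (source_lsc_usc _ _ (ltW c0)).
have [x1|x1] := lerP (enorm x) 1; last first.
  have j0 : superjet (fun=> 0) (x, t) p X tau.
    have r0 : 0 < enorm x - 1 by rewrite subr_gt0.
    apply: (superjet_ge r0 _ _ jd) => [|w w0 _ _]; first by rewrite /disc /= leNgt x1.
    by have /andP[] := disc_bounds (ltW c0) w0.
  have [-> -> X0] := superjet_const0 (z := (x, t)) t0 j0.
  have /superjetP[sX _] := jd.
  by rewrite add0r; apply: le_trans (Ham_lower0_le0 sX X0) (source_ge0 _ _ (ltW c0)).
rewrite source_in; last by move=> i; apply: le_trans x1; exact: coord_le_enorm.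
have h1 := @disc_Ham c (x, t) p X tau t0' jd x1.
suff : tau <= c by move: h1; clear; move: (Ham_lower _ _) => b1; lra.
apply/ler_addgt0Pr => e e0; have /superjetP[_ /(_ _ e0)[r r0 rP]] := jd.
pose h := Num.min (r / 2) t.
have h0 : 0 < h by rewrite lt_min t0 divr_gt0.
have hr : h < r by apply: (@le_lt_trans _ _ (r / 2)); [rewrite ge_min lexx|lra].
have ht : h <= t by rewrite ge_min lexx orbT.
have := rP (x, t - h); rewrite /= subrr enorm0 quad2 dotp2 !mxE addrAC subrr add0r normrN.
rewrite (gtr0_norm h0) subr_ge0 !disc_in// => /(_ ht r0 hr) h2.
rewrite -(ler_pM2r h0); move: h2; clear; nra.
Qed.

(** * Subsolutions below the maximal solution *)

Definition nonneg_subsol c d v := [/\ visc_subsol (source c d) (fun=> 0) v,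
  compactly_supported_in_space v & forall z, 0 <= z.2 -> 0 <= v z].

Lemma nonneg_subsol_family c d v : 0 < c -> nonneg_subsol c d v ->
  perron_family (source c d) c (nonneg_subsol c d).
Proof.
move=> c0 Sv; split; last by exists v.
- by move=> x; exact/source_bounded/ltW.
- by move=> u [].
- move=> u [x t] [su cu u0] t0; rewrite u0//=; apply: le_trans (subsol_le_time c0 su cu x t0).
  by apply: usc_ge => //; case: su.
Qed.

(** The barrier with [s = 1] has a height that depends on the subsolution, but a
    support that does not. *)
Lemma supfam_compact_support c d v : 0 < c -> 0 < d -> nonneg_subsol c d v ->
  compactly_supported_in_space (supfam (nonneg_subsol c d)).
Proof.
move=> c0 d0 Sv T T0; have F := nonneg_subsol_family c0 Sv.
have b0 : 0 < 2 * d + 1 by lra.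
exists (2 * d + 1 + T) => [|x t nx /andP[t0 tT]]; first by lra.
apply/eqP; rewrite eq_le; have /andP[-> _] := supfam_le F (z := (x, t)) t0; rewrite andbT.
rewrite leNgt; apply/negP => /(supfam_lt F (z := (x, t)) t0)[u [su cu u0]].
have [||M M0 uM] := subsol_le_barrier (b := 2 * d + 1) (s := 1) c0 ltr01 b0 ler01 d0 _ _ su cu.
- by rewrite expr2; move: d0; clear; nra.
- by move=> s s0; rewrite mul1r addrAC subrr add0r.
have bu : locally_bounded_on Q u by case: su.
rewrite ltNge => /negP; apply; apply: le_trans (usc_ge (z := (x, t)) bu t0) _.
apply: le_trans (uM x t t0) _.
rewrite /cube_pos (max_idPl _) ?expr0n ?mulr0// subr_le0.
apply: le_sqr; first by rewrite mul1r; lra.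
rewrite mul1r; apply: (@le_trans _ _ (2 * d + 1 + T)); first by lra.
by rewrite leNgt; apply/negP => h; apply: nx; rewrite /eball/= subr0.
Qed.

(** The supremum of the family is a compactly supported solution, hence lies
    below the maximal one. *)
Lemma nonneg_subsol_le_maximal c d u v : 0 < c -> 0 < d ->
  maximal_visc_sol (source c d) (fun=> 0) u -> nonneg_subsol c d v ->
  forall x t, 0 <= t -> v (x, t) <= u (x, t).
Proof.
move=> c0 d0 [_ _ umax] Sv x t t0; have F := nonneg_subsol_family c0 Sv.
have cS := supfam_compact_support c0 d0 Sv.
apply: le_trans (supfam_ge F Sv (z := (x, t)) t0) _; apply: umax => //; split.
  exact: supfam_subsol F (ltW c0).
by apply: supfam_supersol F (ltW c0) cS _ => w sw cw w0; split.
Qed.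

Lemma maximal_ge_in_disc c u x t : 0 < c ->
  maximal_visc_sol (source c 1) (fun=> 0) u -> enorm x <= 1 -> 0 <= t ->
  c * t <= u (x, t).
Proof.
move=> c0 umax x1 t0; rewrite -(disc_in c t x1).
apply: (nonneg_subsol_le_maximal c0 ltr01 umax) t0; split.
- exact: disc_subsol.
- exact: disc_compact_support.
- by move=> z z0; have /andP[] := disc_bounds (ltW c0) z0.
Qed.

End evolution.

(** * Time averages *)

Section time_averages.
Variable R : realType.
Local Notation V := 'rV[R]_2.
Local Notation Q := (spacetime R 2).
Implicit Types (x y : V) (a b c d e r s k l m t C M : R) (A K : set V).
Implicit Types (u v : V * R -> R) (z w : V * R) (f : V -> R).

Lemma uniform_cvg (F : R -> V -> R) A f :
  (forall e, 0 < e -> \forall t \near +oo, forall x, A x -> `|f x - F t x| < e) ->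
  {uniform A, F @ +oo --> f}.
Proof.
move=> FP P /uniform_nbhs[E [+ EP]].
rewrite -entourage_ballE => -[e /= e0 eE].
apply: filterS (FP e e0) => t tP; apply: EP => x Ax; apply: eE; exact: tP.
Qed.

Lemma near_infty_large M : \forall t \near +oo, 0 < t /\ M < t.
Proof.
exists (Num.max 0 M); split; first exact: num_real.
by move=> t; rewrite gt_max => /andP[].
Qed.

Lemma avg_cvg u A c C : (forall x t, A x -> 0 <= t -> `|u (x, t) - c * t| <= C) ->
  {uniform A, (fun t x => u (x, t) / t) @ +oo --> (fun=> c)}.
Proof.
move=> uC; apply: uniform_cvg => e e0; apply: filterS (near_infty_large (C / e)) => t [t0].
rewrite ltr_pdivrMr// => Ct x Ax; have := uC x t Ax (ltW t0) => h.
have -> : c - u (x, t) / t = - ((u (x, t) - c * t) / t) by field; rewrite gt_eqF.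
by rewrite normrN normrM normfV (gtr0_norm t0) ltr_pdivrMr// (mulrC e); exact: le_lt_trans Ct.
Qed.

Lemma avg_liminf_ge u K a C : (forall x t, K x -> 0 <= t -> a * t - C <= u (x, t)) ->
  (a%:E <= limf_einf (fun t => ereal_inf [set (u (x, t) / t)%:E | x in K]) (pinfty_nbhs R))%E.
Proof.
move=> uC; rewrite limf_einfE; apply/lee_subgt0Pr => e e0.
apply: le_ereal_sup_tmp; eexists.
  by exists [set t | 0 < t /\ C / e < t]; [exact: near_infty_large|reflexivity].
apply: le_ereal_inf_tmp => _ [t [t0]] + <-; rewrite ltr_pdivrMr// => Ct.
apply: le_ereal_inf_tmp => _ [x Kx <-]; rewrite -EFinB lee_fin ler_pdivlMr//.
have := uC x t Kx (ltW t0); move: Ct; rewrite mulrBl (mulrC t).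
by move: (e * t) (a * t) => b1 b2; lra.
Qed.

Lemma avg_limsup_le u K b C : (forall x t, K x -> 0 <= t -> u (x, t) <= b * t + C) ->
  (limf_esup (fun t => ereal_sup [set (u (x, t) / t)%:E | x in K]) (pinfty_nbhs R) <= b%:E)%E.
Proof.
move=> uC; rewrite limf_esupE; apply/lee_addgt0Pr => e e0.
apply: ge_ereal_inf; eexists.
  by exists [set t | 0 < t /\ C / e < t]; [exact: near_infty_large|reflexivity].
apply: ge_ereal_sup => _ [t [t0]] + <-; rewrite ltr_pdivrMr// => Ct.
apply: ge_ereal_sup => _ [x Kx <-]; rewrite -EFinD lee_fin ler_pdivrMr//.
have := uC x t Kx (ltW t0); move: Ct; rewrite mulrDl (mulrC t).
by move: (e * t) (b * t) => b1 b2; lra.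
Qed.

Lemma compact_enorm_bounded K : compact K -> exists2 b, 0 <= b & forall x, K x -> enorm x <= b.
Proof.
move=> /compact_bounded[M0 [_ /(_ (M0 + 1))]]; rewrite ltrDl => /(_ ltr01).
move: (M0 + 1) => M MP.
have h x : K x -> enorm x <= 2 * M.
  move=> Kx; apply: le_trans (enorm_le_coord x) _.
  have hx : mx_norm x <= M by exact: MP.
  have co (i : 'I_2) : `|x 0 i| <= M.
    apply: le_trans hx; rewrite mx_normrE.
    exact: (le_bigmax _ (fun ij : 'I_1 * 'I_2 => `|x ij.1 ij.2|) (0, i)).
  by have := co 0; have := co 1; move: (`|_|) (`|_|) => b1 b2; lra.
by exists `|2 * M| => // x /h hx; apply: le_trans hx (ler_norm _).
Qed.

Lemma closure_eball01 x : closure (eball 0 1) x -> enorm x <= 1.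
Proof.
move=> cx; apply/ler_addgt0Pr => e e0.
have xe : nbhs x [set y | enorm (y - x) < e] by apply/ball_enormP; exists e.
have [y [/=]] := cx _ xe; rewrite /eball/= subr0 => y1 yx.
have := enormD (x - y) y; rewrite subrK -(enormN (x - y)) opprB.
by move: y1 yx; move: (enorm _) (enorm _) (enorm _) => b1 b2 b3; lra.
Qed.

End time_averages.

Theorem theorem1p2 (R : realType) (c d : R) (u : 'rV[R]_2 * R -> R)
  (c_gt0 : 0 < c) (d_gt0 : 0 < d)
  (u_max : maximal_visc_sol (fun x => c * \1_(square d) x) (fun=> 0) u) :
  [/\ d < 1 / Num.sqrt 2 ->
        (exists M : R, forall x t, 0 <= t -> `|u (x, t)| <= M) /\
        {uniform, (fun t x => u (x, t) / t) @ +oo --> (fun=> 0)},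
      1 < d ->
        {family compact, (fun t x => u (x, t) / t) @ +oo --> (fun=> c)},
      d = 1 ->
        {uniform closure (eball 0 1),
          (fun t x => u (x, t) / t) @ +oo --> (fun=> c)}
    & 1 / Num.sqrt 2 < d < 1 ->
        exists alpha beta : R, [/\ 0 < alpha, alpha < beta, beta < c &
          forall K : set 'rV[R]_2, compact K ->
            (alpha%:E <= limf_einf
               (fun t => ereal_inf [set (u (x, t) / t)%:E | x in K]) (pinfty_nbhs R))%E /\
            (limf_esup
               (fun t => ereal_sup [set (u (x, t) / t)%:E | x in K]) (pinfty_nbhs R)
               <= beta%:E)%E]].
Proof.
have [[su sp] cu _] := u_max.
have bu : locally_bounded_on (spacetime R 2) u by case: su.
have u_usc x t : 0 <= t -> u (x, t) <= usc_env (spacetime R 2) u (x, t).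
  by move=> t0; exact: usc_ge.
have lsc_u x t : 0 <= t -> lsc_env (spacetime R 2) u (x, t) <= u (x, t).
  by move=> t0; rewrite lsc_envE lerNl; exact: usc_ge (locally_boundedN bu) _.
have u_ge0 x t : 0 <= t -> 0 <= u (x, t).
  by move=> t0; apply: le_trans (supersol_ge0 c_gt0 sp cu x t0) (lsc_u x t t0).
have u_le x t : 0 <= t -> u (x, t) <= c * t.
  by move=> t0; apply: le_trans (u_usc x t t0) (subsol_le_time c_gt0 su cu x t0).
have s2 : 0 < Num.sqrt 2 :> R by rewrite sqrtr_gt0.
have s22 : Num.sqrt 2 ^+ 2 = 2 :> R by rewrite sqr_sqrtr.
split.
- rewrite ltr_pdivlMr// => ds.
  pose b := (d * Num.sqrt 2 + 1) / 2.
  have db : d * Num.sqrt 2 < b by rewrite /b; lra.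
  have b1 : b < 1 by rewrite /b; lra.
  have b0 : 0 < b by apply: lt_trans db; rewrite mulr_gt0.
  have d2 : 2 * d ^+ 2 < b ^+ 2.
    by rewrite -s22 mulrC -exprMn ltr_pXn2r// ?nnegrE ltW// mulr_gt0.
  have k0 : 0 < 1 - b by rewrite subr_gt0.
  have [|M M0 uM] := subsol_le_barrier c_gt0 k0 b0 (lexx 0) d_gt0 d2 _ su cu.
    by move=> t t0; rewrite !mul0r !(add0r, addr0).
  have uB x t : 0 <= t -> `|u (x, t)| <= M * cube_pos (b ^+ 2).
    move=> t0; rewrite ger0_norm ?u_ge0//; apply: le_trans (u_usc x t t0) _.
    apply: le_trans (uM x t t0) _; rewrite mul0r addr0; apply: ler_wpM2l => //.
    have h : Num.max 0 (b ^+ 2 - enorm x ^+ 2) <= Num.max 0 (b ^+ 2).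
      have h0 : b ^+ 2 - enorm x ^+ 2 <= b ^+ 2 by rewrite gerBl sqr_ge0.
      by rewrite ge_max !le_max lexx h0 orbT.
    by apply: lerXn2r h; rewrite nnegrE le_max lexx.
  split; first by eexists; exact: uB.
  by apply: (@avg_cvg R u _ 0) => x t _ t0; rewrite mul0r subr0; exact: uB.
- move=> d1; apply/fam_cvgP => K /compact_enorm_bounded[B B0 KB].
  apply: uniform_cvg => e e0.
  have e2 : 0 < e / 2 by rewrite divr_gt0.
  have [k [M [s [k0 M0 uM]]]] := supersol_ge_radial c_gt0 d1 e2 sp cu.
  pose C := k * B ^+ 2 + M * Num.max 0 (B ^+ 2 - s) ^+ 2.
  apply: filterS (near_infty_large (C / (e / 2))) => t [t0].
  rewrite ltr_pdivrMr// => Ct x Kx.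
  have xB : enorm x ^+ 2 <= B ^+ 2 by apply: le_sqr; [exact: enorm_ge0|exact: KB].
  have h1 : k * enorm x ^+ 2 + M * Num.max 0 (enorm x ^+ 2 - s) ^+ 2 <= C.
    apply: lerD; apply: ler_wpM2l => //.
    by apply: pos_part_sqr_mono; rewrite lerD2r.
  have h2 := le_trans (uM x t (ltW t0)) (lsc_u x t (ltW t0)).
  have h3 := u_le x t (ltW t0).
  rewrite ger0_norm; last by rewrite subr_ge0 ler_pdivrMr.
  rewrite ltrBlDr -ltrBlDl ltr_pdivlMr// mulrBl.
  move: h1 h2 h3 Ct; rewrite mulrBl; clear.
  move: (k * _ + _) (c * t) (u (x, t)) C => b1 b2 b3 b4.
  by lra.
- move=> d1; subst d; apply: (avg_cvg (C := 0)) => x t /closure_eball01 x1 t0.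
  by rewrite normr_le0 subr_eq0 eq_le u_le//= maximal_ge_in_disc.
- case/andP; rewrite ltr_pdivrMr// => ds d1.
  have d2 : 1 < 2 * d ^+ 2.
    by rewrite -s22 mulrC -exprMn exprn_egt1.
  have [al [m [a [rho [al0 m0 /andP[a0 arho] ual]]]]] :=
    supersol_ge_separable c_gt0 d_gt0 d2 sp cu.
  have [be [m' [a' [rho' [/andP[be0 bec] m'0 /andP[a'0 arho'] ube]]]]] :=
    subsol_le_sliding c_gt0 d_gt0 d1 su cu.
  exists (Num.min al (be / 2)), be; split=> //.
  + by rewrite lt_min al0 divr_gt0.
  + by apply: (@le_lt_trans _ _ (be / 2)); [rewrite ge_min lexx orbT|lra].
  move=> K /compact_enorm_bounded[B B0 KB].
  have KBi (x : 'rV[R]_2) i : K x -> `|x 0 i| <= B.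
    by move=> Kx; apply: le_trans (coord_le_enorm x i) (KB x Kx).
  split.
    apply: (avg_liminf_ge (C := m * (slope rho a * B + slope rho a * B + 2 * rho))) => x t Kx t0.
    apply: le_trans (le_trans (ual x t t0) (lsc_u x t t0)); apply: lerB.
      by apply: ler_wpM2r => //; rewrite ge_min lexx.
    have up i : arch rho a (x 0 i) <= slope rho a * B.
      apply: le_trans (arch_le a0 arho _) _; apply: ler_wpM2l; last exact: KBi.
      exact: slope_a_ge0.
    by apply: ler_wpM2l => //; rewrite lerD2r; apply: lerD.
  apply: (avg_limsup_le (C := m' * ramp (B + rho'))) => x t Kx t0.
  apply: le_trans (le_trans (u_usc x t t0) (ube x t t0)) _; rewrite lerD2l.
  apply: ler_wpM2l => //; apply: ramp_homo; apply: lerD.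
    by apply: le_trans (ler_norm _) _; rewrite normrN; exact: KBi.
  by rewrite lerNl; exact: arch_ge.
Qed.
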